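(* Let $d\ge2$, $n\in\mathbb{N}$, let $A_0,\ldots,A_n\in M_d(\mathbb{C})$ be arbitrary, let $g_1,\ldots,g_n$ be i.i.d. standard real Gaussian random variables, let $s_1,\ldots,s_n$ be a free semicircular family in a $C^*$-probability space $(\mathcal{A},\tau)$, and define $$X=A_0+\sum_{i=1}^n g_iA_i,\qquad X_{\rm free}=A_0\otimes\mathbf{1}+\sum_{i=1}^nA_i\otimes s_i.$$ Then for all $p\in\mathbb{N}$ $$\Big|\,\mathbf{E}[\mathrm{tr}\,|X|^{2p}]^{\frac1{2p}}-(\mathrm{tr}\otimes\tau)(|X_{\rm free}|^{2p})^{\frac1{2p}}\Big|\le2p^{\frac34}\,\tilde v(X).$$
   Context: $\mathrm{tr}\,M=\frac1d\mathrm{Tr}\,M$ is the normalized trace on $M_d(\mathbb{C})$, $\mathrm{Tr}$ the unnormalized trace, $\|\cdot\|$ the operator norm, $|Y|=(Y^*Y)^{1/2}$. $\mathbf{E}[Y]^\alpha$ means $(\mathbf{E}Y)^\alpha$. The parameters are $$\sigma(X)^2=\Big\|\sum_{i=1}^nA_i^*A_i\Big\|\vee\Big\|\sum_{i=1}^nA_iA_i^*\Big\|,\qquad v(X)^2=\sup_{\mathrm{Tr}|M|^2\le1}\sum_{i=1}^n|\mathrm{Tr}[A_iM]|^2=\|\mathrm{Cov}(X)\|,$$ and $\tilde v(X)^2=v(X)\sigma(X)$, where $M$ ranges over $M_d(\mathbb{C})$ and $\mathrm{Cov}(X)$ is the $d^2\times d^2$ covariance matrix of the entries of $X$. A free semicircular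 family is a family of self-adjoint elements $s_1,\ldots,s_n$ of a $C^*$-probability space $(\mathcal{A},\tau)$ (a unital $C^*$-algebra $\mathcal{A}$ with a faithful state $\tau$) such that for all $q\ge1$ and $k_1,\ldots,k_q\in\{1,\ldots,n\}$, $\tau(s_{k_1}\cdots s_{k_q})=\sum_{\pi\in\mathrm{NC}_2([q])}\prod_{\{i,j\}\in\pi}\delta_{k_ik_j}$, where $\mathrm{NC}_2([q])$ is the set of noncrossing pair partitions of $\{1,\ldots,q\}$. $X_{\rm free}$ is an element of $M_d(\mathbb{C})\otimes\mathcal{A}$. *)

(* Defs.v *)
(* MathComp / MathComp-Analysis; the complex numbers are R[i] for R : realType. *)
From HB Require Import structures.
From mathcomp Require Import all_boot all_order all_algebra.
From mathcomp Require Import complex.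
From mathcomp Require Import all_classical all_reals all_analysis.

Set Implicit Arguments.
Unset Strict Implicit.
Unset Printing Implicit Defensive.
Import Order.TTheory GRing.Theory Num.Theory.
Import numFieldNormedType.Exports.
Local Open Scope classical_set_scope.
Local Open Scope sesquilinear_scope.
Local Open Scope ring_scope.

(** * C*-algebras *)

(* The norm is an explicit R-valued function: the library has no common
   ancestor of rings and normed modules other than [numDomainType], so a
   noncommutative [algType] cannot also be a [normedModType].
   An [algType] is unital with 1 != 0. *)
HB.mixin Record isCStarAlgebra (R : realType) A & GRing.Algebra R[i] A := {
  cstar : A -> A;
  cnorm : A -> R;
  cstarD : {morph cstar : x y / x + y};
  cstarZ : forall (c : R[i]) x, cstar (c *: x) = c^* *: cstar x;
  cstarM : forall x y, cstar (x * y) = cstar y * cstar x;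
  cstarK : involutive cstar;
  cnorm_eq0 : forall x, cnorm x = 0 -> x = 0;
  ler_cnormD : forall x y, cnorm (x + y) <= cnorm x + cnorm y;
  cnormZ : forall (c : R[i]) x, cnorm (c *: x) = Normc.normc c * cnorm x;
  ler_cnormM : forall x y, cnorm (x * y) <= cnorm x * cnorm y;
  cnorm_cstar : forall x, cnorm (cstar x * x) = cnorm x ^+ 2;
  cnorm_complete : forall u : nat -> A,
    (forall e : R, 0 < e -> exists N, forall m n, (N <= m)%N -> (N <= n)%N ->
       cnorm (u m - u n) < e) ->
    exists l : A, forall e : R, 0 < e -> exists N, forall n, (N <= n)%N ->
       cnorm (u n - l) < e
}.

#[short(type="cstarAlgType")]
HB.structure Definition CStarAlgebra (R : realType) :=
  {A of isCStarAlgebra R A & GRing.Algebra R[i] A}.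

Section CStarProbabilitySpace.
Context {R : realType} {A : cstarAlgType R}.

(* In R[i], [0 <= z] says that z is real and nonnegative. *)
Definition faithful_state (tau : {scalar A}) : Prop :=
  [/\ tau 1 = 1 :> R[i],
      forall a : A, 0 <= (tau (cstar a * a) : R[i])
    & forall a : A, tau (cstar a * a) = 0 :> R[i] -> a = 0].

(* NC_2([q]), with {1, ..., q} replaced by 'I_q *)
Definition pair_partition q (pi : {set {set 'I_q}}) : bool :=
  finset.partition pi [set: 'I_q]%SET && [forall B in pi, #|B| == 2].

Definition noncrossing q (pi : {set {set 'I_q}}) : bool :=
  [forall B in pi, forall B' in pi,
    forall a in B, forall c in B, forall b in B', forall e in B',
      [&& a < b, b < c & c < e]%N ==> (B == B')].

Definition NC2 q : {set {set {set 'I_q}}} :=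
  [set pi | pair_partition pi && noncrossing pi]%SET.

(* For a block B = {i, j}, the boolean below is [k i == k j]. *)
Definition free_semicircular (tau : {scalar A}) n (s : 'I_n -> A) : Prop :=
  (forall i, cstar (s i) = s i) /\
  forall q (k : 'I_q -> 'I_n), (0 < q)%N ->
    tau (\prod_(j < q) s (k j)) =
    \sum_(pi in NC2 q) \prod_(B in pi)
      [forall i in B, forall j in B, k i == k j]%:R :> R[i].

End CStarProbabilitySpace.

(** * Complex matrices *)

Section Matrices.
Context {R : realType} {d : nat}.
Implicit Types M : 'M[R[i]]_d.

Definition ntr M : R[i] := d%:R^-1 * \tr M.

(* (M^* M)^(1/2), by functional calculus on the spectral decomposition
   U^-1 D U of the Hermitian matrix M^* M *)
Definition absmx M : 'M[R[i]]_d :=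
  let H := M^t* *m M in
  invmx (spectralmx H) *m diag_mx (map_mx sqrtC (spectral_diag H))
    *m spectralmx H.

Lemma absmx_sqr M : absmx M ^+ 2 = M^t* *m M.
Proof.
set H := M^t* *m M.
have Hn : H \is normalmx.
  by apply/normalmxP; rewrite /H trmx_mul map_mxM trmxCK.
rewrite [RHS](orthomx_spectralP Hn) expr2 -[LHS]/(absmx M *m absmx M) /absmx -/H.
have Pu := spectral_unit H.
rewrite !mulmxA mulmxK // -[_ *m diag_mx _ *m diag_mx _]mulmxA mulmx_diag.
congr (_ *m diag_mx _ *m _); apply/rowP => j.
by rewrite !mxE -expr2 sqrtCK.
Qed.

Definition cnorm2 (x : 'cV[R[i]]_d) : R :=
  Num.sqrt (\sum_j Normc.normc (x j 0) ^+ 2).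

Definition opnorm M : R :=
  sup [set cnorm2 (M *m x) | x in [set x | cnorm2 x <= 1]].

Definition sigma n (A : 'I_n -> 'M[R[i]]_d) : R :=
  Num.sqrt (Num.max (opnorm (\sum_i ((A i)^t* *m A i)))
                    (opnorm (\sum_i (A i *m (A i)^t*)))).

Definition vpar n (A : 'I_n -> 'M[R[i]]_d) : R :=
  Num.sqrt (sup [set \sum_i Normc.normc (\tr (A i *m M)) ^+ 2 |
                 M in [set M | \tr (absmx M ^+ 2) <= 1]]).

Definition vtilde n (A : 'I_n -> 'M[R[i]]_d) : R :=
  Num.sqrt (vpar A * sigma A).

End Matrices.

(** * M_d(C) (x) A, identified with M_d(A) *)

Section TensorMatrices.
Context {R : realType} {A : cstarAlgType R} {d : nat}.

Definition tensmx (M : 'M[R[i]]_d) (a : A) : 'M[A]_d :=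
  map_mx (fun z => z *: a) M.

Definition adjmx (Y : 'M[A]_d) : 'M[A]_d := map_mx cstar Y^T.

Definition tr_tens (tau : {scalar A}) (Y : 'M[A]_d) : R[i] :=
  d%:R^-1 * \sum_k (tau (Y k k) : R[i]).

(* |Y|^(2p), that is ((Y^* Y)^(1/2))^(2p) = (Y^* Y)^p; see the next lemma. *)
Definition abs_exp2 (Y : 'M[A]_d) (p : nat) : 'M[A]_d := (adjmx Y * Y) ^+ p.

Lemma abs_exp2E (Y absY : 'M[A]_d) (p : nat) :
  absY ^+ 2 = adjmx Y * Y -> absY ^+ (2 * p) = abs_exp2 Y p.
Proof. by rewrite exprM => ->. Qed.

End TensorMatrices.

(** * The two models *)

Section Models.
Context {R : realType}.

Definition mutually_independent {dT : measure_display} {T : measurableType dT}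
    (P : probability T R) n (g : 'I_n -> {RV P >-> R}) : Prop :=
  forall (J : {set 'I_n}) (B : 'I_n -> set R), (forall i, measurable (B i)) ->
    P (\bigcap_(i in [set` J]) (g i @^-1` B i)) =
    (\prod_(i in J) P (g i @^-1` B i))%E.

Definition iid_standard_gaussian {dT : measure_display}
    {T : measurableType dT} (P : probability T R) n
    (g : 'I_n -> {RV P >-> R}) : Prop :=
  mutually_independent g /\
  forall i (B : set R), measurable B -> distribution P (g i) B = normal_prob 0 1 B.

Definition Xgauss {T : Type} {d n : nat} (A0 : 'M[R[i]]_d)
    (A : 'I_n -> 'M[R[i]]_d) (g : 'I_n -> T -> R) (w : T) : 'M[R[i]]_d :=
  A0 + \sum_i (g i w)%:C%C *: A i.

Definition Xfree {CA : cstarAlgType R} {d n : nat} (A0 : 'M[R[i]]_d)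
    (A : 'I_n -> 'M[R[i]]_d) (s : 'I_n -> CA) : 'M[CA]_d :=
  tensmx A0 1 + \sum_i tensmx (A i) (s i).

End Models.

(* Main.v *)
Require Import Defs.
From mathcomp Require Import all_boot all_order all_algebra.
From mathcomp Require Import ring lra zify.
Set Implicit Arguments.
Unset Strict Implicit.
Unset Printing Implicit Defensive.
Import GRing.Theory.
Local Open Scope ring_scope.

(** Both moments are the values at the ends of one smooth path.

After replacing each A_i by the Hermitian matrix with off-diagonal blocks A_i
and A_i^*, put, for real theta and a real vector x,
  X(theta, x) = A_0 (x) 1 + sin theta * sum_i x_i A_i (x) 1
                          + cos theta * sum_i A_i (x) s_i,
and let phi_p(theta) be the expectation of (Tr (x) tau) X(theta, g)^(2p). Then
phi_p(0) is the free moment and phi_p(pi/2) the Gaussian one.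

The derivative of phi_p.  Write E for id (x) tau. Gaussian integration by parts
turns a factor g_i into a sum over the positions of a second A_i, with terms
Tr A_i E(X^k A_i X^l); the Schwinger-Dyson equation for s_i, which is the
recursion of noncrossing pairings on their least element, gives the same sum
with E(X^k) A_i E(X^l) in place of E(X^k A_i X^l). Since the derivative of sin
is cos and that of cos is - sin, phi_p' is sin theta cos theta times a sum of
the differences ([dmean_momentE]).

The difference.  E fails to be multiplicative only through pairings that join
the two sides; singling out the innermost joining pair ([free_covariance])
writes the difference as a sum of terms
  sum_(i, j) Tr E(X^d A_i X^a) A_j E(X^b) A_i E(X^c) A_j,
in which the pairs i and j cross. Such a term is a value of a Hankel form in
(a, b, c, d): the matrices E(X^(j + k)) are Gram matrices of vectors V_j
([moment_factorization]), so Cauchy-Schwarz makes the form log-convex, hence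
bounded by its values with a single nonzero exponent ([hankel_max]). There
one sees directly that the term is at most
  kappa * s2 * Tr E(X^(a+b+c+d))      ([crossing_bound]),
where kappa bounds the norm of c |-> sum_i c_i A_i and s2 the norm of
sum_i A_i^2. For the Hermitian matrices built from the A_i these are 2 v^2 and
sigma^2. Hence |phi_p'| <= 4 p^4 v^2 sigma^2 phi_(p-2).

The differential inequality.  For normalized traces, k |-> phi_k is log-convex
with value 1 at 0, so phi_(p-2) <= phi_p^(1 - 2/p) by Lyapunov's inequality
([lyapunov_powR]), and the derivative of phi_p^(2/p) is at most
8 p^3 v^2 sigma^2. The mean value theorem on [0, pi/2], an interval of length
below 2, bounds the difference of the values of phi_p^(2/p) at the ends by
16 p^3 v^2 sigma^2. These are the fourth powers of the two norms to be
compared, and |a - b|^4 <= |a^4 - b^4| for nonnegative a and b. *)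

(** * Noncrossing pairings *)

Section NCP.
Context {q : nat}.
Implicit Types (I : {set 'I_q}) (pi : {set {set 'I_q}}).

Definition nc_pairings I : {set {set {set 'I_q}}} :=
  [set pi | [&& partition pi I, [forall B in pi, #|B| == 2] & noncrossing pi]].

Lemma nc_pairingsP I pi :
  pi \in nc_pairings I <->
  [/\ forall B, B \in pi -> #|B| = 2 /\ B \subset I,
      forall x, x \in I -> exists2 B, B \in pi & x \in B,
      forall B B' x, B \in pi -> B' \in pi -> x \in B -> x \in B' -> B = B'
    & forall B B' (a b c e : 'I_q), B \in pi -> B' \in pi -> a \in B -> c \in B ->
        b \in B' -> e \in B' -> (a < b)%N -> (b < c)%N -> (c < e)%N -> B = B'].
Proof.
rewrite inE; split.
  case/and3P=> /and3P[/eqP cov /trivIsetP tri n0] /forall_inP c2 /forall_inP nx.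
  split.
  - move=> B BP; split; first exact/eqP/c2.
    by rewrite -cov; apply: bigcup_sup.
  - by move=> x; rewrite -cov => /bigcupP[B ? ?]; exists B.
  - move=> B B' x BP BP' xB xB'; apply/eqP/negPn/negP=> ne.
    by have /disjoint_setI0/setP/(_ x) := tri _ _ BP BP' ne; rewrite !inE xB xB'.
  - move=> B B' a b c e BP BP' aB cB bB' eB' ab bc ce.
    have /forall_inP/(_ _ BP') := nx _ BP.
    move=> /forall_inP/(_ _ aB) /forall_inP/(_ _ cB) /forall_inP/(_ _ bB').
    by move=> /forall_inP/(_ _ eB'); rewrite ab bc ce => /eqP.
case=> c2 cov tri nx; apply/and3P; split.
- apply/and3P; split.
  + rewrite eqEsubset; apply/andP; split; apply/subsetP=> x.
      by case/bigcupP=> B BP xB; have [_ /subsetP] := c2 _ BP; apply.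
    by move=> /cov[B BP xB]; apply/bigcupP; exists B.
  + apply/trivIsetP=> B B' BP BP' ne; rewrite -setI_eq0.
    apply/eqP/setP=> x; rewrite !inE; apply/negbTE/negP=> /andP[xB xB'].
    by rewrite (tri _ _ _ BP BP' xB xB') eqxx in ne.
  + by apply/negP=> /c2[]; rewrite cards0.
- by apply/forall_inP=> B /c2[->].
- apply/forall_inP=> B BP; apply/forall_inP=> B' BP'.
  apply/forall_inP=> a aB; apply/forall_inP=> c cB.
  apply/forall_inP=> b bB; apply/forall_inP=> e eB.
  by apply/implyP=> /and3P[ab bc ce]; apply/eqP; apply: (nx B B' a b c e).
Qed.

Lemma NC2E : NC2 q = nc_pairings [set: 'I_q].
Proof. by apply/setP=> pi; rewrite !inE andbA. Qed.

Definition join_pair (a c : 'I_q) (p : {set {set 'I_q}} * {set {set 'I_q}}) :=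
  [set a; c] |: (p.1 :|: p.2).

Definition split_pair (I1 I2 : {set 'I_q}) pi :=
  ([set B in pi | B \subset I1], [set B in pi | B \subset I2]).

(** The blocks other than that of the least element [a] lie on one side of
    the partner [c] of [a], by noncrossingness. *)
Lemma nc_pairings_split I (a c : 'I_q) (I1 := [set x in I | (a < x < c)%N])
    (I2 := [set x in I | (c < x)%N]) :
  a \in I -> c \in I -> (a < c)%N -> {in I, forall x : 'I_q, (a <= x)%N} ->
  forall pi, pi \in nc_pairings I -> [set a; c] \in pi ->
  join_pair a c (split_pair I1 I2 pi) = pi.
Proof.
move=> aI cI ac amin pi piI acpi.
have [c2 cov tri nx] := (nc_pairingsP _ _).1 piI.
apply/setP=> B; rewrite !inE; apply/idP/idP.
  by case/or3P=> [/eqP->//|/andP[]//|/andP[]//].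
move=> BP; rewrite BP /=; case: (altP (B =P [set a; c])) => //= ne.
have [/eqP/cards2P[x [y [nexy Bxy]]] /subsetP BI] := c2 _ BP.
have side z : z \in B -> (a < z)%N && (z != c :> nat).
  move=> zB; apply/andP; split.
    rewrite ltn_neqAle (amin z (BI _ zB)) andbT; apply/eqP=> az.
    have {}az : a = z by apply: val_inj.
    by case/eqP: ne; apply: (tri _ _ z) => //; rewrite !inE az eqxx.
  apply/eqP=> zc; have {}zc : z = c by apply: val_inj.
  by case/eqP: ne; apply: (tri _ _ z) => //; rewrite !inE zc eqxx orbT.
have noc u v : u \in B -> v \in B -> (u < c)%N -> (c < v)%N -> False.
  move=> uB vB uc cv; case/eqP: ne; symmetry.
  apply: (nx _ _ a u c v) => //; rewrite ?inE ?eqxx ?orbT //.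
  by case/andP: (side _ uB).
have xB : x \in B by rewrite Bxy !inE eqxx.
have yB : y \in B by rewrite Bxy !inE eqxx orbT.
have /andP[ax xc] := side _ xB; have /andP[ay yc] := side _ yB.
have [xlt|xgt|E] := ltngtP x c; last by rewrite E eqxx in xc.
  apply/orP; left; apply/subsetP=> z; rewrite {1}Bxy !inE => /orP[]/eqP->.
    by rewrite BI // ax xlt.
  rewrite BI // ay /=; case: (ltngtP y c) yc => // cy _.
  by case: (noc x y).
apply/orP; right; apply/subsetP=> z; rewrite {1}Bxy !inE => /orP[]/eqP->.
  by rewrite BI // xgt.
rewrite BI //=; case: (ltngtP y c) yc => // cy _.
by case: (noc y x).
Qed.

(** The converse: pairings of the two sides of [c] can be joined freely, because
    no point of the one lies between two points of the other. *)
Lemma nc_pairings_join I (a c : 'I_q) (I1 := [set x in I | (a < x < c)%N])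
    (I2 := [set x in I | (c < x)%N]) :
  a \in I -> c \in I -> (a < c)%N -> {in I, forall x : 'I_q, (a <= x)%N} ->
  forall p, (join_pair a c p \in nc_pairings I) && ([set a; c] \in join_pair a c p)
     && (split_pair I1 I2 (join_pair a c p) == p)
  = (p.1 \in nc_pairings I1) && (p.2 \in nc_pairings I2).
Proof.
move=> aI cI ac amin [p1 p2] /=.
apply/idP/idP.
  case/andP=> /andP[PI _] /eqP[E1 E2].
  have [c2 cov tri nx] := (nc_pairingsP _ _).1 PI.
  have sub1 B : B \in p1 -> B \in join_pair a c (p1, p2) /\ B \subset I1.
    by rewrite -{1}E1 !inE /= => /andP[].
  have sub2 B : B \in p2 -> B \in join_pair a c (p1, p2) /\ B \subset I2.
    by rewrite -{1}E2 !inE /= => /andP[].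
  apply/andP; split; apply/nc_pairingsP; split.
  - by move=> B /sub1[/c2[? _] ?].
  - move=> x; rewrite inE => /and3P[xI ax xc].
    have [B BP xB] := cov _ xI; exists B => //.
    move: BP xB; rewrite !inE /= => /or3P[/eqP->|//|].
      by rewrite !inE => /orP[]/eqP xE; rewrite xE ltnn in ax xc.
    by case/sub2=> _ /subsetP s /s; rewrite inE ltnNge (ltnW xc) andbF.
  - by move=> B B' x /sub1[? _] /sub1[? _]; apply: tri.
  - by move=> B B' x b y e /sub1[? _] /sub1[? _]; apply: nx.
  - by move=> B /sub2[/c2[? _] ?].
  - move=> x; rewrite inE => /andP[xI cx].
    have [B BP xB] := cov _ xI; exists B => //.
    move: BP xB; rewrite !inE /= => /or3P[/eqP->||//].
      rewrite !inE => /orP[]/eqP xE; rewrite xE ?ltnn // in cx.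
      by rewrite ltnNge (ltnW ac) in cx.
    by case/sub1=> _ /subsetP s /s; rewrite inE [(x < c)%N]ltnNge (ltnW cx) !andbF.
  - by move=> B B' x /sub2[? _] /sub2[? _]; apply: tri.
  - by move=> B B' x b y e /sub2[? _] /sub2[? _]; apply: nx.
case/andP=> P1 P2.
have [c21 cov1 tri1 nx1] := (nc_pairingsP _ _).1 P1.
have [c22 cov2 tri2 nx2] := (nc_pairingsP _ _).1 P2.
have s1 B x : B \in p1 -> x \in B -> x \in I /\ (a < x < c)%N.
  by move=> /c21[_ /subsetP s] /s; rewrite inE => /andP[].
have s2 B x : B \in p2 -> x \in B -> x \in I /\ (c < x)%N.
  by move=> /c22[_ /subsetP s] /s; rewrite inE => /andP[].
have s0 x : x \in [set a; c] -> x = a \/ x = c.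
  by rewrite !inE => /orP[]/eqP; [left|right].
have n0 B : B \in p1 \/ B \in p2 -> exists x, x \in B.
  case=> [/c21|/c22] [cB _]; apply/set0Pn; apply/eqP=> B0; by rewrite B0 cards0 in cB.
rewrite -andbA; apply/and3P; split.
- apply/nc_pairingsP; split.
  + move=> B; rewrite !inE /= => /or3P[/eqP->|BP|BP].
    * rewrite cards2; split; first by case: eqP ac => // ->; rewrite ltnn.
      by apply/subsetP=> x /s0[]->.
    * by have [-> _] := c21 _ BP; split=> //; apply/subsetP=> x /(s1 _ _ BP)[].
    * by have [-> _] := c22 _ BP; split=> //; apply/subsetP=> x /(s2 _ _ BP)[].
  + move=> x xI; have := amin x xI; rewrite leq_eqVlt => /orP[/eqP ax|ax].
      by exists [set a; c]; rewrite !inE ?eqxx // (val_inj ax) eqxx.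
    have [xc|cx|xc] := ltngtP x c.
    * have [|B BP xB] := cov1 x; first by rewrite inE xI ax xc.
      by exists B => //; rewrite !inE /= BP orbT.
    * have [|B BP xB] := cov2 x; first by rewrite inE xI cx.
      by exists B => //; rewrite !inE /= BP !orbT.
    * by exists [set a; c]; rewrite !inE ?eqxx // (val_inj xc) eqxx orbT.
  + move=> B B' x; rewrite !inE /=.
    case/or3P=> [/eqP->|BP|BP]; case/or3P=> [/eqP->|BP'|BP'] //.
    * by move=> /s0 xx /(s1 _ _ BP')[_]; case: xx => ->; rewrite ltnn ?andbF.
    * by move=> /s0 xx /(s2 _ _ BP')[_]; case: xx => ->; lia.
    * by move=> /(s1 _ _ BP)[_ +] /s0 xx; case: xx => ->; rewrite ltnn ?andbF.
    * exact: tri1.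
    * by move=> /(s1 _ _ BP)[_ +] /(s2 _ _ BP')[_]; lia.
    * by move=> /(s2 _ _ BP)[_ +] /s0 xx; case: xx => ->; lia.
    * by move=> /(s2 _ _ BP)[_ +] /(s1 _ _ BP')[_]; lia.
    * exact: tri2.
  + move=> B B' x b y e; rewrite !inE /=.
    case/or3P=> [/eqP->|BP|BP]; case/or3P=> [/eqP->|BP'|BP'] //.
    * move=> /s0 x0 /s0 y0 /(s1 _ _ BP')[_ +] /(s1 _ _ BP')[_].
      by case: y0 => ->; case: x0 => ->; lia.
    * move=> /s0 x0 /s0 y0 /(s2 _ _ BP')[_ +] /(s2 _ _ BP')[_].
      by case: y0 => ->; case: x0 => ->; lia.
    * move=> /(s1 _ _ BP)[_ +] /(s1 _ _ BP)[_ +] /s0 x0 /s0 y0.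
      by case: y0 => ->; case: x0 => ->; lia.
    * exact: nx1.
    * by move=> /(s1 _ _ BP)[_ +] /(s1 _ _ BP)[_ +] /(s2 _ _ BP')[_ +] /(s2 _ _ BP')[_]; lia.
    * move=> /(s2 _ _ BP)[_ +] /(s2 _ _ BP)[_ +] /s0 x0 /s0 y0.
      by case: y0 => ->; case: x0 => ->; lia.
    * by move=> /(s2 _ _ BP)[_ +] /(s2 _ _ BP)[_ +] /(s1 _ _ BP')[_ +] /(s1 _ _ BP')[_]; lia.
    * exact: nx2.
- by rewrite !inE eqxx.
- apply/eqP; congr pair; apply/setP=> B; rewrite !inE /=; apply/idP/idP.
  + case/andP=> /or3P[/eqP->|//|BP] /subsetP s.
      by have := s a; rewrite !inE eqxx ltnn andbF => /(_ isT).
    have [|x xB] := n0 B; first by right.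
    by have := s _ xB; have [_] := s2 _ _ BP xB; rewrite inE; lia.
  + move=> BP; rewrite BP orbT /=.
    by apply/subsetP=> x /(s1 _ _ BP)[]; rewrite inE => -> ->.
  + case/andP=> /or3P[/eqP->|BP|//] /subsetP s.
      by have := s a; rewrite !inE eqxx => /(_ isT); lia.
    have [|x xB] := n0 B; first by left.
    by have := s _ xB; have [_] := s1 _ _ BP xB; rewrite inE; lia.
  + move=> BP; rewrite BP !orbT /=.
    by apply/subsetP=> x /(s2 _ _ BP)[]; rewrite inE => -> ->.
Qed.

Context {C : eqType} {K : comNzRingType}.
Variable k : nat -> C.

Definition pairing_weight pi : K :=
  \prod_(B in pi) [forall i in B, forall j in B, k (i : 'I_q) == k (j : 'I_q)]%:R.

Definition nc_sum I : K := \sum_(pi in nc_pairings I) pairing_weight pi.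

Lemma nc_sum0 : nc_sum set0 = 1.
Proof.
rewrite /nc_sum (big_pred1 set0) ?/pairing_weight ?big_set0 // => pi.
apply/idP/eqP => [/nc_pairingsP[c2 _ _ _]|->].
  apply/setP=> B; rewrite inE; apply/negP=> /c2[c0]; rewrite subset0 => /eqP B0.
  by rewrite B0 cards0 in c0.
by apply/nc_pairingsP; split=> [B|x|B B' x|B B' a b c e]; rewrite inE.
Qed.

(** Catalan recursion: the least element [a] is matched with some [c], and
    [nc_pairings_split] and [nc_pairings_join] identify what remains with a
    noncrossing pairing inside ([a], [c]) and one to the right of [c]. *)
Lemma nc_sum_rec I (a : 'I_q) :
  a \in I -> {in I, forall x : 'I_q, (a <= x)%N} ->
  nc_sum I = \sum_(c in I | (a < c)%N) (k a == k c)%:R *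
    nc_sum [set x in I | (a < x < c)%N] * nc_sum [set x in I | (c < x)%N].
Proof.
move=> aI amin.
have part pi : pi \in nc_pairings I ->
    \sum_(c in I | (a < c)%N) ([set a; c] \in pi)%:R = 1 :> K.
  move=> piI; have [c2 cov tri nx] := (nc_pairingsP _ _).1 piI.
  have [B BP aB] := cov _ aI.
  have [/eqP/cards2P[x [y [nexy Bxy]]] /subsetP BI] := c2 _ BP.
  have [c [cI ac Bac]] : exists c, [/\ c \in I, (a < c)%N & B = [set a; c]].
    have hh u v : B = [set u; v] -> u != v -> a = u ->
        exists c, [/\ c \in I, (a < c)%N & B = [set a; c]].
      move=> Buv ne au; exists v; have vI : v \in I.
        by apply: BI; rewrite Buv !inE eqxx orbT.
      split=> //; last by rewrite au.
      by rewrite ltn_neqAle amin // andbT au.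
    have: a \in [set x; y] by rewrite -Bxy.
    rewrite !inE => /orP[]/eqP aE; first exact: (hh x y).
    by apply: (hh y x); rewrite // 1?eq_sym // Bxy finset.setUC.
  rewrite (bigD1 c) /= ?cI ?ac // -Bac BP big1 ?addr0 // => c' /andP[/andP[cI' ac'] ne].
  case: (boolP (_ \in pi)) => // P'; case/eqP: ne.
  have E : [set a; c'] = [set a; c].
    by rewrite -Bac; apply: (tri _ _ a) => //; rewrite !inE eqxx.
  have: c' \in [set a; c] by rewrite -E !inE eqxx orbT.
  by rewrite !inE => /orP[]/eqP // cc; rewrite cc ltnn in ac'.
rewrite /nc_sum.
transitivity (\sum_(pi in nc_pairings I) \sum_(c in I | (a < c)%N)
    ([set a; c] \in pi)%:R * pairing_weight pi).
  by apply: eq_bigr => pi piI; rewrite -big_distrl /= part ?mul1r.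
rewrite exchange_big /=; apply: eq_bigr => c /andP[cI ac].
transitivity (\sum_(pi | (pi \in nc_pairings I) && ([set a; c] \in pi))
    pairing_weight pi).
  rewrite [RHS]big_mkcondr /=; apply: eq_bigr => pi _.
  by case: ifP; rewrite ?mul1r ?mul0r.
set I1 := [set x in I | (a < x < c)%N]; set I2 := [set x in I | (c < x)%N].
rewrite (reindex_onto (join_pair a c) (split_pair I1 I2)) /=; last first.
  by move=> pi /andP[piI acpi]; apply: (@nc_pairings_split I).
under eq_bigl => p do rewrite nc_pairings_join //.
rewrite -mulrA big_distrlr /= pair_big /= big_distrr /=.
apply: eq_bigr => -[p1 p2] /= /andP[P1 P2].
have [c21 _ _ _] := (nc_pairingsP _ _).1 P1.
have [c22 _ _ _] := (nc_pairingsP _ _).1 P2.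
have ne1 : [set a; c] \notin p1 :|: p2.
  rewrite !inE; apply/negP => /orP[/c21|/c22] [_ /subsetP/(_ a)];
  rewrite !inE eqxx => /(_ isT); lia.
rewrite /pairing_weight /join_pair /= big_setU1 //=; congr (_ * _).
  congr (_%:R); congr nat_of_bool; apply/idP/idP.
    move=> /forall_inP/(_ a); rewrite !inE eqxx => /(_ isT) /forall_inP/(_ c).
    by rewrite !inE eqxx orbT => /(_ isT).
  move=> /eqP kac; apply/forall_inP=> x; rewrite !inE => /orP[]/eqP->;
  by apply/forall_inP=> y; rewrite !inE => /orP[]/eqP->; rewrite ?kac.
rewrite -bigU /=; first by apply: eq_bigl => B; rewrite !inE.
rewrite disjoint_subset; apply/subsetP=> B B1; rewrite inE; apply/negP=> B2.
have [cB /subsetP sB] := c21 _ B1; have [_ /subsetP sB'] := c22 _ B2.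
have [x xB] : exists x, x \in B.
  by apply/set0Pn; apply/eqP=> B0; rewrite B0 cards0 in cB.
by have := sB _ xB; have := sB' _ xB; rewrite !inE; lia.
Qed.

Definition nc_int l h : K := nc_sum [set x : 'I_q | (l <= x < h)%N].

Lemma nc_int0 l : nc_int l l = 1.
Proof.
rewrite -[RHS]nc_sum0; congr nc_sum; apply/setP=> x; rewrite !inE; lia.
Qed.

Lemma nc_int_rec l h : (l < h)%N -> (h <= q)%N ->
  nc_int l h = \sum_(l.+1 <= c < h) (k l == k c)%:R * nc_int l.+1 c * nc_int c.+1 h.
Proof.
move=> lh hq.
have lq : (l < q)%N by exact: leq_trans hq.
rewrite {1}/nc_int (@nc_sum_rec _ (Ordinal lq)) ?inE ?leqnn //=; last first.
  by move=> x; rewrite inE => /andP[].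
pose F c := (k l == k c)%:R * nc_int l.+1 c * nc_int c.+1 h.
rewrite (eq_bigr (fun c : 'I_q => F c)); last first.
  move=> c /andP[]; rewrite inE => /andP[lc ch] lc'; rewrite /F.
  congr (_ * nc_sum _ * nc_sum _); apply/setP=> x; rewrite !inE; lia.
rewrite (eq_bigl (fun c : 'I_q => (l < c < h)%N)); last first.
  by move=> c; rewrite inE; lia.
rewrite -(big_mkord (fun c => (l < c < h)%N) F).
rewrite [RHS](big_nat_widen l.+1 h q) // (@big_cat_nat _ _ _ l.+1 0) //=.
rewrite big_nat_cond big1 ?add0r; last by move=> i; lia.
rewrite [LHS]big_nat_cond [RHS]big_nat_cond.
by apply: eq_bigl => i; lia.
Qed.
End NCP.
Arguments nc_int q {C K} k l h.

(** The recursion refers to letters only by comparing them, so the sum depends on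
    the word and not on the place where it is read. *)
Lemma nc_int_eq (C : eqType) (K : comNzRingType) q q' (k k' : nat -> C) l l' m :
  (l + m <= q)%N -> (l' + m <= q')%N ->
  (forall j, (j < m)%N -> k (l + j)%N = k' (l' + j)%N) ->
  @nc_int q C K k l (l + m) = @nc_int q' C K k' l' (l' + m).
Proof.
elim/ltn_ind: m l l' => -[|m] IH l l' lq lq' kk; first by rewrite !addn0 !nc_int0.
rewrite !nc_int_rec; try lia.
rewrite -{1}[l.+1]add0n big_addn -{1}[l'.+1]add0n [in RHS]big_addn.
have -> : (l + m.+1 - l.+1 = m)%N by lia.
have -> : (l' + m.+1 - l'.+1 = m)%N by lia.
apply: eq_big_nat => c cm.
have := kk 0 isT; rewrite !addn0 => ->.
have -> : (c + l.+1 = l + c.+1)%N by lia.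
have -> : (c + l'.+1 = l' + c.+1)%N by lia.
rewrite kk ?ltnS; last by case/andP: cm.
congr (_ * _ * _).
  have -> : (l + c.+1 = l.+1 + c)%N by lia.
  have -> : (l' + c.+1 = l'.+1 + c)%N by lia.
  by apply: IH; try lia; move=> j jc; rewrite !addSnnS; apply: kk; lia.
have -> : (l + m.+1 = (l + c.+1).+1 + (m - c.+1))%N by lia.
have -> : (l' + m.+1 = (l' + c.+1).+1 + (m - c.+1))%N by lia.
apply: IH; try lia; move=> j jc.
have -> : ((l + c.+1).+1 + j = l + (c.+2 + j))%N by lia.
have -> : ((l' + c.+1).+1 + j = l' + (c.+2 + j))%N by lia.
by apply: kk; lia.
Qed.

From mathcomp Require Import complex.
From mathcomp Require Import all_classical all_reals all_analysis.
From mathcomp Require Import measurable_realfun.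
Import Order.TTheory Num.Theory.

(** * The Schwinger-Dyson equation for a semicircular family *)

Section Splits.
Context {T : Type}.
Fixpoint splits (L : seq T) : seq (seq T * T * seq T) :=
  if L is z :: L' then
    ([::], z, L') :: [seq (z :: x.1.1, x.1.2, x.2) | x <- splits L']
  else [::].

Context {V : nmodType}.
Implicit Types (F : seq T * T * seq T -> V).

Lemma big_splits_cons F z L : \sum_(x <- splits (z :: L)) F x =
  F ([::], z, L) + \sum_(x <- splits L) F (z :: x.1.1, x.1.2, x.2).
Proof. by rewrite /= big_cons big_map. Qed.

Lemma big_splits_cat F L z K : \sum_(x <- splits (L ++ z :: K)) F x =
  \sum_(x <- splits L) F (x.1.1, x.1.2, x.2 ++ z :: K) + F (L, z, K) +
  \sum_(x <- splits K) F (L ++ z :: x.1.1, x.1.2, x.2).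
Proof.
elim: L F => [|a L IH] F; first by rewrite big_splits_cons big_nil add0r.
by rewrite cat_cons !big_splits_cons IH /= !addrA.
Qed.

Lemma big_splits_coassoc (F : seq T -> T -> seq T -> T -> seq T -> V) L :
  \sum_(y <- splits L) \sum_(z <- splits y.1.1) F z.1.1 z.1.2 z.2 y.1.2 y.2 =
  \sum_(y <- splits L) \sum_(z <- splits y.2) F y.1.1 y.1.2 z.1.1 z.1.2 z.2.
Proof.
elim: L F => [|a L IH] F; first by rewrite !big_nil.
rewrite !big_splits_cons /= big_nil add0r -(IH (fun b => F (a :: b))) -big_split /=.
by apply: eq_bigr => y _; rewrite big_splits_cons.
Qed.

Lemma big_splits_nth F L z0 : \sum_(x <- splits L) F x =
  \sum_(c < size L) F (take c L, nth z0 L c, drop c.+1 L).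
Proof.
elim: L F => [|a L IH] F; first by rewrite big_nil big_ord0.
by rewrite big_splits_cons IH big_ord_recl /= drop0.
Qed.

Lemma big_splits_nseq F z m : \sum_(x <- splits (nseq m z)) F x =
  \sum_(c < m) F (nseq c z, z, nseq (m.-1 - c) z).
Proof.
elim: m F => [|m IH] F; first by rewrite big_nil big_ord0.
rewrite [nseq _ _]/= big_splits_cons IH big_ord_recl /= subn0; congr (_ + _).
apply: eq_bigr => c _; rewrite /bump /= add1n.
by have -> : (m.-1 - c = m - c.+1)%N by lia.
Qed.

End Splits.

Lemma size_splits T (L : seq T) x : List.In x (splits L) ->
  (size x.1.1 < size L)%N /\ (size x.2 < size L)%N.
Proof.
elim: L x => [|a L IH] x //= [<- //|] /List.in_map_iff[y [<- /IH[]]] /=.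
by rewrite !ltnS => ? /ltnW ?.
Qed.

Lemma eq_big_In (V : nmodType) T (s : seq T) (F G : T -> V) :
  (forall x, List.In x s -> F x = G x) -> \sum_(x <- s) F x = \sum_(x <- s) G x.
Proof.
elim: s => [|a s IH] FG; first by rewrite !big_nil.
by rewrite !big_cons FG ?IH //; [move=> x xs; apply: FG; right | left].
Qed.

Section Tens.
Context {R : realType} {CA : cstarAlgType R} {D : nat}.
Implicit Types (M N : 'M[R[i]]_D) (a b : CA) (Y : 'M[CA]_D).

Lemma tensmxM M N a b : tensmx M a *m tensmx N b = tensmx (M *m N) (a * b).
Proof.
apply/matrixP=> i j; rewrite !mxE scaler_suml; apply: eq_bigr => k _.
by rewrite !mxE -scalerAl -scalerAr scalerA.
Qed.

Lemma tensmxDl M N a : tensmx (M + N) a = tensmx M a + tensmx N a.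
Proof. by apply/matrixP=> i j; rewrite !mxE scalerDl. Qed.

Lemma tensmx0l a : tensmx (0 : 'M[R[i]]_D) a = 0.
Proof. by apply/matrixP=> i j; rewrite !mxE scale0r. Qed.

Lemma tensmx11 : tensmx 1%:M 1 = 1%:M :> 'M[CA]_D.
Proof. by apply/matrixP=> i j; rewrite !mxE; case: eqP; rewrite ?scale1r ?scale0r. Qed.

Definition emb M : 'M[CA]_D := tensmx M 1.

Lemma embM M N : emb (M *m N) = emb M *m emb N.
Proof. by rewrite /emb tensmxM mulr1. Qed.

Lemma tensmx_embl M a : emb M *m tensmx 1%:M a = tensmx M a.
Proof. by rewrite /emb tensmxM mulmx1 mul1r. Qed.

Lemma tensmx_embr M a : tensmx 1%:M a *m emb M = tensmx M a.
Proof. by rewrite /emb tensmxM mul1mx mulr1. Qed.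

Variable tau : {scalar CA}.

(** The map id (x) tau from M_D(A) to M_D(C). *)
Definition cexp Y : 'M[R[i]]_D := \matrix_(i, j) (tau (Y i j) : R[i]).

Lemma cexpD Y Y' : cexp (Y + Y') = cexp Y + cexp Y'.
Proof. by apply/matrixP=> i j; rewrite !mxE linearD. Qed.

Lemma cexp_sum I (r : seq I) (F : I -> 'M[CA]_D) :
  cexp (\sum_(i <- r) F i) = \sum_(i <- r) cexp (F i).
Proof.
elim: r => [|x r IH]; last by rewrite !big_cons cexpD IH.
by rewrite !big_nil; apply/matrixP=> i j; rewrite !mxE linear0.
Qed.

Lemma cexp_embl M Y : cexp (emb M *m Y) = M *m cexp Y.
Proof.
apply/matrixP=> i j; rewrite !mxE linear_sum; apply: eq_bigr => k _.
by rewrite !mxE -scalerAl mul1r linearZ.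
Qed.

Lemma cexp_embr M Y : cexp (Y *m emb M) = cexp Y *m M.
Proof.
apply/matrixP=> i j; rewrite !mxE linear_sum; apply: eq_bigr => k _.
by rewrite !mxE -scalerAr mulr1 linearZ mulrC.
Qed.

Lemma cexp_tens M a : cexp (tensmx M a) = (tau a : R[i]) *: M.
Proof. by apply/matrixP=> i j; rewrite !mxE linearZ mulrC. Qed.
End Tens.

Section SchwingerDyson.
Context {R : realType} {CA : cstarAlgType R} {D : nat}.
Variables (tau : {scalar CA}) (htau : faithful_state tau).
Variables (n : nat) (s : 'I_n -> CA) (hs : free_semicircular tau s).
Notation E := (@cexp R CA D tau).

Definition sword (w : seq 'I_n) : CA := \prod_(i <- w) s i.

Lemma tau_sword w : tau (sword w) = nc_int (size w) (onth w) 0 (size w) :> R[i].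
Proof.
case: (posnP (size w)) => [/size0nil->|w0].
  by rewrite nc_int0 /sword big_nil; case: htau.
have := hs.2 _ (tnth (in_tuple w)) w0.
rewrite /nc_int /nc_sum NC2E /sword.
have <- : \prod_(j < size w) s (tnth (in_tuple w) j) = \prod_(i <- w) s i.
  by rewrite [RHS](big_tnth _ _ w).
move=> ->; rewrite (_ : [set x : 'I_(size w) | _] = [set: _]); last first.
  by apply/setP=> x; rewrite !inE /= ltn_ord.
apply: eq_bigr => pi _; apply: eq_bigr => B _; congr (nat_of_bool _)%:R.
have cE (x : 'I_(size w)) : onth w x = Some (tnth (in_tuple w) x).
  rewrite (tnth_nth (tnth (in_tuple w) x)) /=.
  by rewrite onthE (nth_map (tnth (in_tuple w) x)).
by apply: eq_forallb_in => x xB; apply: eq_forallb_in => y yB; rewrite !cE.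
Qed.

(** The Schwinger-Dyson equation for scalar words: the letter [i] is matched with
    an equal letter of [w], and the two parts of [w] factorize. *)
Lemma tau_sword_rec i w : tau (sword (i :: w)) =
  \sum_(x <- splits w) (x.1.2 == i)%:R * (tau (sword x.1.1) * tau (sword x.2)) :> R[i].
Proof.
rewrite tau_sword nc_int_rec //= big_add1 /= big_mkord (big_splits_nth _ _ i).
apply: eq_bigr => c _; rewrite /= !tau_sword -mulrA.
have cw : (c < size w)%N by [].
congr (_%:R * _).
  by congr nat_of_bool; rewrite /= onthE (nth_map i) // eq_sym.
congr (_ * _).
  have -> : (c.+1 = 1 + c)%N by [].
  rewrite size_take cw -[in RHS](add0n c).
  apply: nc_int_eq => //=; first lia.
  by move=> j jc; rewrite add0n !onthE map_take nth_take.
rewrite size_drop.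
have -> : ((size w).+1 = c.+2 + (size w - c.+1))%N by lia.
rewrite -{3}[(size w - c.+1)%N]add0n.
apply: nc_int_eq => [||j jc]; [by rewrite /=; lia|by rewrite add0n|].
rewrite -[LHS]/(onth w (c.+1 + j)) add0n !onthE map_drop nth_drop //.
Qed.

(** The pair (B, C) stands for the operator B (x) 1 + sum_j C_j (x) s_j. Words in
    such pairs, rather than powers of one operator, make inductions on the length
    possible. *)
Definition affine := ('M[R[i]]_D * ('I_n -> 'M[R[i]]_D))%type.
Definition letter i : 'M[CA]_D := tensmx 1%:M (s i).
Definition aff (Z : affine) : 'M[CA]_D := emb Z.1 + \sum_j tensmx (Z.2 j) (s j).
Definition caff (M : 'M[R[i]]_D) : affine := (M, fun=> 0).

Fixpoint aprod (L : seq affine) : 'M[CA]_D :=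
  if L is Z :: L' then aff Z *m aprod L' else 1%:M.

Lemma aff_caff M : aff (caff M) = emb M.
Proof. by rewrite /aff /= big1 ?addr0 // => j _; rewrite tensmx0l. Qed.

Lemma affE Z : aff Z = emb Z.1 + \sum_j emb (Z.2 j) *m letter j.
Proof. by rewrite /aff; congr (_ + _); apply: eq_bigr => j _; rewrite tensmx_embl. Qed.

Lemma affEr Z : aff Z = emb Z.1 + \sum_j letter j *m emb (Z.2 j).
Proof. by rewrite /aff; congr (_ + _); apply: eq_bigr => j _; rewrite tensmx_embr. Qed.

Lemma aprod_cat L K : aprod (L ++ K) = aprod L *m aprod K.
Proof. by elim: L => [|Z L IH] /=; rewrite ?mul1mx // IH mulmxA. Qed.

Lemma cexp1 : E 1%:M = 1%:M.
Proof. by rewrite -tensmx11 cexp_tens; case: htau => -> _ _; rewrite scale1r. Qed.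

(** Words of scalar letters followed by affine factors: in the induction on the
    affine part, the letters of its first factor move to the scalar part. *)
Let W w L := tensmx 1%:M (sword w) *m aprod L.

Let W_cons w Z L : E (W w (Z :: L)) =
  Z.1 *m E (W w L) + \sum_j Z.2 j *m E (W (rcons w j) L).
Proof.
rewrite /W /= /aff mulmxA mulmxDr mulmxDl cexpD; congr (_ + _).
  by rewrite tensmx_embr -tensmx_embl -mulmxA cexp_embl.
rewrite mulmx_sumr mulmx_suml cexp_sum; apply: eq_bigr => j _.
rewrite tensmxM mul1mx -cexp_embl mulmxA tensmx_embl.
by rewrite /W /sword -cats1 big_cat big_seq1.
Qed.

Let W_sd i w L : E (W (i :: w) L) =
  \sum_(x <- splits w) ((x.1.2 == i)%:R * tau (sword x.1.1) : R[i]) *: E (W x.2 L) +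
  \sum_(y <- splits L) E (W w y.1.1) *m y.1.2.2 i *m E (aprod y.2).
Proof.
elim: L w => [|Z L IH] w.
  rewrite [X in _ + X]big_nil addr0 /W /= mulmx1 cexp_tens tau_sword_rec scaler_suml.
  by apply: eq_bigr => x _; rewrite mulmx1 cexp_tens scalerA mulrA.
rewrite W_cons. under eq_bigr => j _ do rewrite rcons_cons IH.
rewrite IH big_splits_cons /=.
under [X in _ = X + _]eq_bigr => x _ do rewrite W_cons.
have sp (F : seq 'I_n * 'I_n * seq 'I_n -> 'M[R[i]]_D) j :
  \sum_(x <- splits (rcons w j)) F x =
  \sum_(x <- splits w) F (x.1.1, x.1.2, rcons x.2 j) + F (w, j, [::]).
  rewrite -cats1 big_splits_cat big_nil addr0; congr (_ + _).
  by apply: eq_bigr => x _; rewrite cats1.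
rewrite (eq_bigr (fun j =>
   \sum_(x <- splits w) ((x.1.2 == i)%:R * tau (sword x.1.1) : R[i]) *: (Z.2 j *m E (W (rcons x.2 j) L))
   + ((j == i)%:R * tau (sword w) : R[i]) *: (Z.2 j *m E (aprod L))
   + \sum_(y <- splits L) Z.2 j *m E (W (rcons w j) y.1.1) *m y.1.2.2 i *m E (aprod y.2))); last first.
  move=> j _; rewrite sp !mulmxDr; congr (_ + _ + _).
  - by rewrite mulmx_sumr; apply: eq_bigr => x _; rewrite -scalemxAr.
  - rewrite -scalemxAr; congr (_ *: (_ *m E _)).
    by rewrite /W /sword big_nil tensmx11 mul1mx.
  - by rewrite mulmx_sumr; apply: eq_bigr => x _; rewrite !mulmxA.
rewrite !big_split /= mulmxDr.
have -> : \sum_(j < n) ((j == i)%:R * tau (sword w) : R[i]) *: (Z.2 j *m E (aprod L)) =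
   E (W w [::]) *m Z.2 i *m E (aprod L).
  rewrite (bigD1 i) //= eqxx mul1r big1 ?addr0; last first.
    by move=> j /negbTE->; rewrite mul0r scale0r.
  by rewrite /W /= mulmx1 cexp_tens -!scalemxAl mul1mx.
have -> : \sum_(x <- splits L) E (W w (Z :: x.1.1)) *m x.1.2.2 i *m E (aprod x.2) =
  Z.1 *m (\sum_(y <- splits L) E (W w y.1.1) *m y.1.2.2 i *m E (aprod y.2)) +
  \sum_(j < n) \sum_(y <- splits L) Z.2 j *m E (W (rcons w j) y.1.1) *m y.1.2.2 i *m E (aprod y.2).
  rewrite exchange_big mulmx_sumr -big_split /=; apply: eq_bigr => y _.
  by rewrite W_cons !mulmxDl !mulmx_suml !mulmxA.
have -> : \sum_(x <- splits w) ((x.1.2 == i)%:R * tau (sword x.1.1) : R[i]) *: 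
     (Z.1 *m E (W x.2 L) + \sum_j Z.2 j *m E (W (rcons x.2 j) L)) =
  Z.1 *m (\sum_(x <- splits w) ((x.1.2 == i)%:R * tau (sword x.1.1) : R[i]) *: E (W x.2 L)) +
  \sum_(j < n) \sum_(x <- splits w) ((x.1.2 == i)%:R * tau (sword x.1.1) : R[i]) *: (Z.2 j *m E (W (rcons x.2 j) L)).
  rewrite exchange_big mulmx_sumr -big_split /=; apply: eq_bigr => x _.
  by rewrite scalerDr scalemxAr scaler_sumr.
rewrite -!addrA; congr (_ + _); rewrite [LHS]addrCA; congr (_ + _); exact: addrCA.
Qed.

(** The letter [s i] is matched with a letter of one of the affine factors of
    [L]; that factor contributes its coefficient at [i], and its two sides decouple. *)
Lemma schwinger_dyson i L : E (letter i *m aprod L) =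
  \sum_(y <- splits L) E (aprod y.1.1) *m y.1.2.2 i *m E (aprod y.2).
Proof.
have := W_sd i [::] L; rewrite big_nil add0r /W /sword big_cons big_nil mulr1 => ->.
by apply: eq_bigr => y _; rewrite tensmx11 mul1mx.
Qed.
End SchwingerDyson.

(** * Free covariance of two words *)

Section Covariance.
Context {R : realType} {CA : cstarAlgType R} {D : nat}.
Variables (tau : {scalar CA}) (htau : faithful_state tau).
Variables (n : nat) (s : 'I_n -> CA) (hs : free_semicircular tau s).
Notation E := (@cexp R CA D tau).
Notation P := (@aprod R CA D n s).
Notation affine := (@affine R D n).
Notation caff := (@caff R D n).
Notation letter := (@letter R CA D n s).
Notation aff := (@aff R CA D n s).
Notation aprod_cat := (@aprod_cat R CA D n s).

Lemma cexp_aff_cons Z (Y : 'M[CA]_D) :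
  E (aff Z *m Y) = Z.1 *m E Y + \sum_i Z.2 i *m E (letter i *m Y).
Proof.
rewrite affE mulmxDl cexpD cexp_embl mulmx_suml cexp_sum; congr (_ + _).
by apply: eq_bigr => i _; rewrite -mulmxA cexp_embl.
Qed.

Lemma schwinger_dyson_cat i L Z K : E (letter i *m P (L ++ Z :: K)) =
  \sum_(x <- splits L) E (P x.1.1) *m x.1.2.2 i *m E (P (x.2 ++ Z :: K)) +
  E (P L) *m Z.2 i *m E (P K) +
  \sum_(x <- splits K) E (P (L ++ Z :: x.1.1)) *m x.1.2.2 i *m E (P x.2).
Proof. by rewrite schwinger_dyson // big_splits_cat. Qed.

Definition letter_aff j : affine := (0 : 'M[R[i]]_D, fun i : 'I_n => (i == j)%:R *: 1%:M : 'M[R[i]]_D).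

Lemma aff_letter j : aff (letter_aff j) = letter j.
Proof.
rewrite -[LHS]/(emb 0 + \sum_i tensmx ((i == j)%:R *: 1%:M) (s i)) /emb tensmx0l add0r (bigD1 j) //= eqxx scale1r big1 ?addr0 //.
by move=> i /negbTE->; rewrite scale0r tensmx0l.
Qed.

(** The letter may also stand inside a word: a match to its right encloses the part
    of [K] before the match, a match to its left the part of [L] after it. The
    enclosed part is replaced by its expectation. Induction on [L]: matching the
    first letter of the word instead yields both kinds of terms. *)
Lemma schwinger_dyson_int j L K : E (P (L ++ letter_aff j :: K)) =
  \sum_(y <- splits K) E (P (L ++ caff (E (P y.1.1) *m y.1.2.2 j) :: y.2)) +
  \sum_(y <- splits L) E (P (y.1.1 ++ caff (y.1.2.2 j *m E (P y.2)) :: K)).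
Proof.
elim/ltn_ind: {L}(size L) {-2}L (erefl (size L)) K => m IHm [|Z L] sL K.
  rewrite big_nil addr0 /= aff_letter schwinger_dyson //.
  by apply: eq_bigr => y _; rewrite /= aff_caff cexp_embl.
have IHL L' K' : (size L' <= size L)%N -> _ := fun h =>
  IHm (size L') (leq_ltn_trans h (eq_leq sL)) L' erefl K'.
rewrite big_splits_cons !cat_cons /= cexp_aff_cons IHL //.
have step i : E (letter i *m P (L ++ letter_aff j :: K)) =
    \sum_(y <- splits K) E (letter i *m P (L ++ caff (E (P y.1.1) *m y.1.2.2 j) :: y.2))
    + (i == j)%:R *: (E (P L) *m E (P K))
    + \sum_(y <- splits L) E (letter i *m P (y.1.1 ++ caff (y.1.2.2 j *m E (P y.2)) :: K)).
  rewrite schwinger_dyson_cat /=.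
  rewrite (eq_big_In (G := fun x => 
     \sum_(y <- splits K) E (P x.1.1) *m x.1.2.2 i *m E (P (x.2 ++ caff (E (P y.1.1) *m y.1.2.2 j) :: y.2)) +
     \sum_(y <- splits x.2) E (P x.1.1) *m x.1.2.2 i *m E (P (y.1.1 ++ caff (y.1.2.2 j *m E (P y.2)) :: K)))); last first.
    by move=> x /size_splits[_ /ltnW xL]; rewrite IHL // mulmxDr !mulmx_sumr.
  rewrite [X in _ + X = _](eq_bigr (fun x : seq affine * affine * seq affine =>
     \sum_(y <- splits x.1.1) E (P (L ++ caff (E (P y.1.1) *m y.1.2.2 j) :: y.2)) *m x.1.2.2 i *m E (P x.2) +
     \sum_(y <- splits L) E (P (y.1.1 ++ caff (y.1.2.2 j *m E (P y.2)) :: x.1.1)) *m x.1.2.2 i *m E (P x.2))); last first.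
    by move=> x _; rewrite IHL // !mulmxDl !mulmx_suml.
  rewrite !big_split /=.
  rewrite (big_splits_coassoc (fun a b c d e => 
     E (P (L ++ caff (E (P a) *m b.2 j) :: c)) *m d.2 i *m E (P e))).
  rewrite -(big_splits_coassoc (fun a b c d e =>
     E (P a) *m b.2 i *m E (P (c ++ caff (d.2 j *m E (P e)) :: K)))).
  have -> : E (P L) *m ((i == j)%:R *: 1%:M) *m E (P K) = (i == j)%:R *: (E (P L) *m E (P K)).
    by rewrite -scalemxAr mulmx1 scalemxAl.
  rewrite [in RHS](eq_bigr (fun y : seq affine * affine * seq affine =>
     \sum_(x <- splits L) E (P x.1.1) *m x.1.2.2 i *m E (P (x.2 ++ caff (E (P y.1.1) *m y.1.2.2 j) :: y.2)) +
     \sum_(x <- splits y.2) E (P (L ++ caff (E (P y.1.1) *m y.1.2.2 j) :: x.1.1)) *m x.1.2.2 i *m E (P x.2))); last first.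
    by move=> y _; rewrite schwinger_dyson_cat /= mulmx0 mul0mx addr0.
  rewrite [X in _ = _ + _ + X](eq_bigr (fun y : seq affine * affine * seq affine =>
     \sum_(x <- splits y.1.1) E (P x.1.1) *m x.1.2.2 i *m E (P (x.2 ++ caff (y.1.2.2 j *m E (P y.2)) :: K)) +
     \sum_(x <- splits K) E (P (y.1.1 ++ caff (y.1.2.2 j *m E (P y.2)) :: x.1.1)) *m x.1.2.2 i *m E (P x.2))); last first.
    by move=> y _; rewrite schwinger_dyson_cat /= mulmx0 mul0mx addr0.
  rewrite !big_split /= [in RHS](@exchange_big _ _ _ _ _ (splits K) (splits L)) /=.
  rewrite [in LHS](@exchange_big _ _ _ _ _ (splits K) (splits L)) /=.
  have shuffle (a1 a2 a3 a4 a5 : 'M[R[i]]_D) :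
      a1 + a2 + a3 + (a4 + a5) = a1 + a4 + a3 + (a2 + a5).
    by rewrite !addrA (ACl (1*4*3*2*5))%AC.
  exact: shuffle.
have expd T (r : seq T) (Y : T -> 'M[CA]_D) : \sum_(y <- r) E (aff Z *m Y y) =
    Z.1 *m (\sum_(y <- r) E (Y y)) +
    \sum_i Z.2 i *m \sum_(y <- r) E (letter i *m Y y).
  under eq_bigr => y _ do rewrite cexp_aff_cons.
  rewrite big_split /= mulmx_sumr exchange_big; congr (_ + _).
  by apply: eq_bigr => i _; rewrite mulmx_sumr.
rewrite !expd aff_caff cexp_embl mulmxDr -!addrA; congr (_ + _).
rewrite [RHS]addrCA [RHS]addrA [RHS]addrCA; congr (_ + _).
rewrite (eq_bigr _ (fun i _ => congr1 (mulmx (Z.2 i)) (step i))).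
rewrite [LHS](eq_bigr (fun i =>
   Z.2 i *m \sum_(y <- splits K) E (letter i *m P (L ++ caff (E (P y.1.1) *m y.1.2.2 j) :: y.2))
   + (i == j)%:R *: (Z.2 i *m E (P L) *m E (P K))
   + Z.2 i *m \sum_(y <- splits L) E (letter i *m P (y.1.1 ++ caff (y.1.2.2 j *m E (P y.2)) :: K)))); last first.
  by move=> i _; rewrite !mulmxDr -scalemxAr mulmxA.
rewrite !big_split /= -!addrA [RHS]addrCA; congr (_ + _); congr (_ + _).
by rewrite (bigD1 j) //= eqxx scale1r big1 ?addr0 // => i /negbTE->; rewrite scale0r.
Qed.

(** Moving the last factor to the front: the trace property of
    [tr (x) tau] on the algebra generated by the semicircular family. *)
Lemma cexp_letterC i L : E (P L *m letter i) = E (letter i *m P L).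
Proof.
have := schwinger_dyson_int i L [::]; rewrite big_nil add0r aprod_cat /= aff_letter mulmx1 => ->.
rewrite schwinger_dyson //; apply: eq_bigr => y _.
by rewrite aprod_cat /= aff_caff mulmx1 cexp_embr mulmxA.
Qed.

Lemma mxtrace_cexpC L K : \tr (E (P L *m P K)) = \tr (E (P K *m P L)).
Proof.
elim: K L => [|Z K IH] L /=; first by rewrite mulmx1 mul1mx.
rewrite mulmxA; have -> : P L *m aff Z = P (rcons L Z).
  by rewrite -cats1 aprod_cat /= mulmx1.
rewrite IH -cats1 aprod_cat /= mulmx1 mulmxA -aprod_cat -mulmxA.
rewrite -aprod_cat cexp_aff_cons affEr mulmxDr cexpD cexp_embr !mxtraceD.
rewrite mxtrace_mulC; congr (_ + _).
rewrite mulmx_sumr cexp_sum !linear_sum; apply: eq_bigr => i _ /=.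
by rewrite mulmxA cexp_embr cexp_letterC mxtrace_mulC.
Qed.

(** The free covariance of two words is carried by their innermost common
    pair: what lies between its two ends decouples. *)
Lemma free_covariance M L K :
  E (P L *m emb M *m P K) - E (P L) *m M *m E (P K) =
  \sum_(y <- splits L) \sum_(z <- splits K) \sum_j
    E (P y.1.1 *m emb (y.1.2.2 j *m E (P y.2) *m M *m E (P z.1.1) *m z.1.2.2 j)
       *m P z.2).
Proof.
elim/ltn_ind: {K}(size K) {-2}K (erefl (size K)) M => m IHm [|Z K] sK M.
  rewrite /= mulmx1 cexp_embr cexp1 // mulmx1 subrr.
  by rewrite big1 // => y _; rewrite big_nil.
have IHK K' M' : (size K' <= size K)%N -> _ := fun h =>
  IHm (size K') (leq_ltn_trans h (eq_leq sK)) K' erefl M'.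
have midE (L' K' : seq affine) N : P (L' ++ caff N :: K') = P L' *m emb N *m P K'.
  by rewrite aprod_cat /= aff_caff mulmxA.
have mid0 (L' K' : seq affine) : E (P (L' ++ caff 0 :: K')) = 0.
  rewrite midE /emb tensmx0l mulmx0 mul0mx.
  by apply/matrixP=> a b; rewrite !mxE linear0.
have mid1 (L' : seq affine) N : E (P (L' ++ [:: caff N])) = E (P L') *m N.
  by rewrite midE /= mulmx1 cexp_embr.
pose C := Z.2.
have e1 : E (P L *m emb M *m P (Z :: K)) = E (P L *m emb (M *m Z.1) *m P K) +
    \sum_j (\sum_(y <- splits K) E (P L *m emb (M *m C j *m E (P y.1.1) *m y.1.2.2 j) *m P y.2)
     + \sum_(y <- splits L) E (P y.1.1 *m emb (y.1.2.2 j *m E (P y.2) *m M *m C j) *m P K)).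
  rewrite /= {1}affE mulmxDl mulmxDr cexpD embM !mulmxA; congr (_ + _).
  rewrite mulmx_sumr mulmx_suml cexp_sum; apply: eq_bigr => j _.
  rewrite -[X in X *m P K]mulmxA.
  have -> : P L *m (emb M *m (emb (C j) *m letter j)) *m P K =
      P ((L ++ [:: caff (M *m C j)]) ++ letter_aff j :: K).
    by rewrite !aprod_cat /= aff_caff aff_letter mulmx1 embM !mulmxA.
  rewrite schwinger_dyson_int; congr (_ + _).
    by apply: eq_bigr => y _; rewrite -catA midE /= aff_caff !embM !mulmxA.
  rewrite big_splits_cat big_nil addr0 /= mul0mx mid0 addr0.
  by apply: eq_bigr => y _; rewrite mid1 midE !mulmxA.
have e2 : E (P L) *m M *m E (P (Z :: K)) = E (P L) *m (M *m Z.1) *m E (P K) +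
    \sum_j \sum_(y <- splits K) E (P L) *m (M *m C j *m E (P y.1.1) *m y.1.2.2 j) *m E (P y.2).
  rewrite /= cexp_aff_cons mulmxDr !mulmxA; congr (_ + _).
  rewrite mulmx_sumr; apply: eq_bigr => j _.
  rewrite schwinger_dyson // !mulmx_sumr; apply: eq_bigr => y _.
  by rewrite !mulmxA.
have embD N N' : emb (N + N') = emb N + emb N' :> 'M[CA]_D by apply: tensmxDl.
have emb_sum I (r : seq I) (N : I -> 'M[R[i]]_D) :
    emb (\sum_(x <- r) N x) = \sum_(x <- r) emb (N x) :> 'M[CA]_D.
  elim: r => [|x r IH]; last by rewrite !big_cons embD IH.
  by rewrite !big_nil /emb tensmx0l.
pose G (y : seq affine * affine * seq affine) i j a b c d e : 'M[R[i]]_D :=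
  E (P y.1.1 *m emb (y.1.2.2 i *m E (P y.2) *m (M *m C j *m E (P a) *m b j) *m E (P c) *m d i) *m P e).
have e3 : \sum_j \sum_(y <- splits K) E (P L *m emb (M *m C j *m E (P y.1.1) *m y.1.2.2 j) *m P y.2)
   - \sum_j \sum_(y <- splits K) E (P L) *m (M *m C j *m E (P y.1.1) *m y.1.2.2 j) *m E (P y.2) =
   \sum_(y <- splits L) \sum_i \sum_j \sum_(x <- splits K) \sum_(z <- splits x.2)
      G y i j x.1.1 x.1.2.2 z.1.1 z.1.2.2 z.2.
  rewrite -sumrB /=.
  rewrite (eq_bigr (fun j => \sum_(x <- splits K) \sum_(y <- splits L)
     \sum_(z <- splits x.2) \sum_i G y i j x.1.1 x.1.2.2 z.1.1 z.1.2.2 z.2)).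
    rewrite (eq_bigr (fun j => \sum_(y <- splits L) \sum_i \sum_(x <- splits K) 
     \sum_(z <- splits x.2) G y i j x.1.1 x.1.2.2 z.1.1 z.1.2.2 z.2)).
      rewrite exchange_big; apply: eq_bigr => y _; exact: exchange_big.
    move=> j _; rewrite exchange_big; apply: eq_bigr => y _.
    rewrite [RHS]exchange_big; apply: eq_bigr => x _; exact: exchange_big.
  move=> j _; rewrite -sumrB; apply: eq_big_In => x /size_splits[_ /ltnW xK].
  by rewrite IHK.
pose Phi (y z : seq affine * affine * seq affine) i N : 'M[R[i]]_D :=
  E (P y.1.1 *m emb (y.1.2.2 i *m E (P y.2) *m M *m N *m z.1.2.2 i) *m P z.2).
have PhiD y z i N N' : Phi y z i (N + N') = Phi y z i N + Phi y z i N'.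
  by rewrite /Phi mulmxDr mulmxDl embD mulmxDr mulmxDl cexpD.
have Phi_sum y z i I (r : seq I) N :
    Phi y z i (\sum_(x <- r) N x) = \sum_(x <- r) Phi y z i (N x).
  by rewrite /Phi mulmx_sumr mulmx_suml emb_sum mulmx_sumr mulmx_suml cexp_sum.
have e4 y : \sum_(z <- splits (Z :: K)) \sum_i Phi y z i (E (P z.1.1)) =
   \sum_j E (P y.1.1 *m emb (y.1.2.2 j *m E (P y.2) *m M *m C j) *m P K) +
   (\sum_(z <- splits K) \sum_i Phi y z i (Z.1 *m E (P z.1.1)) +
   \sum_i \sum_j \sum_(x <- splits K) \sum_(z <- splits x.1.1)
      G y i j z.1.1 z.1.2.2 z.2 x.1.2.2 x.2).
  have -> : \sum_i \sum_j \sum_(x <- splits K) \sum_(z <- splits x.1.1)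
      G y i j z.1.1 z.1.2.2 z.2 x.1.2.2 x.2 =
     \sum_(x <- splits K) \sum_i \sum_j \sum_(z <- splits x.1.1)
      G y i j z.1.1 z.1.2.2 z.2 x.1.2.2 x.2.
    rewrite [RHS]exchange_big; apply: eq_bigr => i _; exact: exchange_big.
  rewrite (big_splits_cons (fun z => \sum_i Phi y z i (E (P z.1.1)))) -big_split.
  apply: (congr2 (fun a b : 'M[R[i]]_D => a + b)).
    have E0 : E (P [::]) = 1%:M by exact: cexp1.
    by apply: eq_bigr => j _; rewrite /Phi /C; cbn [fst snd]; rewrite E0 mulmx1.
  apply: eq_bigr => z _; rewrite -big_split; apply: eq_bigr => i _.
  rewrite (cexp_aff_cons Z (P z.1.1)) PhiD Phi_sum; congr (_ + _).
  apply: eq_bigr => j _; rewrite schwinger_dyson // mulmx_sumr Phi_sum.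
  by apply: eq_bigr => w _; rewrite /Phi /G !mulmxA.
rewrite [RHS](eq_bigr _ (fun y _ => e4 y)).
have S0 : \sum_(y <- splits L) \sum_(z <- splits K) \sum_i Phi y z i (Z.1 *m E (P z.1.1)) =
    E (P L *m emb (M *m Z.1) *m P K) - E (P L) *m (M *m Z.1) *m E (P K).
  rewrite (IHK K (M *m Z.1) (leqnn _)).
  apply: eq_bigr => y _; apply: eq_bigr => z _; apply: eq_bigr => i _.
  by rewrite /Phi !mulmxA.
rewrite [RHS]big_split [X in _ = _ + X]big_split S0.
have e5 : \sum_(y <- splits L) \sum_i \sum_j \sum_(x <- splits K) \sum_(z <- splits x.1.1)
      G y i j z.1.1 z.1.2.2 z.2 x.1.2.2 x.2 =
   \sum_(y <- splits L) \sum_i \sum_j \sum_(x <- splits K) \sum_(z <- splits x.2)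
      G y i j x.1.1 x.1.2.2 z.1.1 z.1.2.2 z.2.
  apply: eq_bigr => y _; apply: eq_bigr => i _; apply: eq_bigr => j _.
  by rewrite (big_splits_coassoc (fun a b c d e => G y i j a b.2 c d.2 e)).
rewrite e5 -e3 e1 e2 big_split [X in _ + (_ + X)]exchange_big /=.
have shuffle (a b c d f : 'M[R[i]]_D) : a + (b + c) - (d + f) = c + (a - d + (b - f)).
  by rewrite opprD !addrA (ACl (3*1*4*2*5))%AC.
exact: shuffle.
Qed.

Variable Z : affine.
Notation X := (aff Z).

Lemma aprod_nseq m : P (nseq m Z) = X ^+ m.
Proof. by elim: m => [|m IH] //=; rewrite IH exprS. Qed.

Lemma mxtrace_cexp_pow u v w M N :
  \tr (E (X ^+ u *m emb M *m X ^+ v *m emb N *m X ^+ w)) =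
  \tr (E (X ^+ (w + u) *m emb M *m X ^+ v *m emb N)).
Proof.
have := mxtrace_cexpC (nseq u Z ++ caff M :: nseq v Z ++ [:: caff N]) (nseq w Z).
by rewrite !aprod_cat /= !aprod_cat /= !aff_caff !mulmx1 !aprod_nseq exprD !mulmxA.
Qed.

Lemma schwinger_dyson_pow i m : E (letter i *m X ^+ m) =
  \sum_(k < m) E (X ^+ k) *m Z.2 i *m E (X ^+ (m.-1 - k)).
Proof.
rewrite -aprod_nseq schwinger_dyson // big_splits_nseq.
by apply: eq_bigr => k _; rewrite /= !aprod_nseq.
Qed.

Lemma free_covariance_pow M u v :
  E (X ^+ u *m emb M *m X ^+ v) - E (X ^+ u) *m M *m E (X ^+ v) =
  \sum_(a < u) \sum_(c < v) \sum_j
    E (X ^+ a *m emb (Z.2 j *m E (X ^+ (u.-1 - a)) *m M *m E (X ^+ c) *m Z.2 j)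
       *m X ^+ (v.-1 - c)).
Proof.
rewrite -!aprod_nseq free_covariance big_splits_nseq; apply: eq_bigr => a _.
rewrite big_splits_nseq; apply: eq_bigr => c _; apply: eq_bigr => j _.
by rewrite /= !aprod_nseq.
Qed.
End Covariance.

(** * Positivity of the trace *)

Local Open Scope sesquilinear_scope.

Section CauchySchwarz.
Context {C : numClosedFieldType}.

Lemma quadratic_herm (p r b g : C) :
  (forall z : C, 0 <= p + z^* * b + z * g + `|z| ^+ 2 * r) ->
  0 <= p -> 0 <= r -> g = b^*.
Proof.
move=> pos p0 r0.
have re z : (z^* * b + z * g)^* = z^* * b + z * g.
  apply/CrealP.
  have -> : z^* * b + z * g = p + z^* * b + z * g + `|z| ^+ 2 * r - p - `|z| ^+ 2 * r by ring.
  by rewrite !rpredB ?ger0_real // mulr_ge0 // exprn_ge0.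
have := re 1; rewrite rmorph1 !mul1r rmorphD /= => e1.
have := re 'i; rewrite conjCi rmorphD !rmorphM /= rmorphN /= conjCi opprK => e2.
have i0 : 'i != 0 :> C by exact: neq0Ci.
have e3 : b^* - g^* = - b + g.
  apply: (mulfI i0); rewrite mulrDr mulrN -mulNr e2; ring.
have e4 : 2 * b^* = 2 * g.
  have -> : 2 * b^* = (b^* + g^*) + (b^* - g^*) by ring.
  by rewrite e1 e3; ring.
by apply/esym; apply: (mulfI _ e4); rewrite pnatr_eq0.
Qed.

(** The discriminant argument over the complex numbers, for a quadratic form that
    is only known to be nonnegative; [b] and [g] are conjugate by
    [quadratic_herm]. *)
Lemma quadratic_CS (p r b g : C) :
  (forall z : C, 0 <= p + z^* * b + z * g + `|z| ^+ 2 * r) ->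
  0 <= p -> 0 <= r -> `|b| ^+ 2 <= p * r.
Proof.
move=> pos p0 r0.
have gE := quadratic_herm pos p0 r0.
have {}pos t : 0 <= t -> 0 <= p - t * `|b| ^+ 2 *+ 2 + t ^+ 2 * `|b| ^+ 2 * r.
  move=> t0; have := pos (- t * b); rewrite gE.
  have tr : t^* = t by apply/CrealP; exact: ger0_real.
  rewrite rmorphM rmorphN /= tr normrM normrN (ger0_norm t0) exprMn normCK.
  by congr (0 <= _); ring.
have [r_0|rn0] := eqVneq r 0.
  rewrite r_0 mulr0; case: (eqVneq b 0) => [->|bn0]; first by rewrite normr0 expr0n.
  have bg : 0 < `|b| ^+ 2 by rewrite exprn_gt0 // normr_gt0.
  have bn : `|b| ^+ 2 != 0 by rewrite gt_eqF.
  have t0 : 0 <= (p + 1) / (`|b| ^+ 2 *+ 2).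
    by rewrite divr_ge0 ?addr_ge0 ?mulrn_wge0 // ltW.
  have := pos _ t0; rewrite r_0 mulr0 addr0.
  have -> : p - (p + 1) / (`|b| ^+ 2 *+ 2) * `|b| ^+ 2 *+ 2 = -1.
    by field; rewrite normr_eq0.
  by rewrite oppr_ge0 ler10.
have rg : 0 < r by rewrite lt_def rn0.
have := pos r^-1; rewrite invr_ge0 => /(_ r0).
have -> : p - r^-1 * `|b| ^+ 2 *+ 2 + r^-1 ^+ 2 * `|b| ^+ 2 * r = p - `|b| ^+ 2 / r.
  by field.
by rewrite subr_ge0 ler_pdivrMr.
Qed.
End CauchySchwarz.

Section Positivity.
Context {R : realType} {CA : cstarAlgType R}.
Notation C := R[i].
Variables (tau : {scalar CA}) (htau : faithful_state tau).
Local Notation star := (@cstar R CA).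

Lemma tauZ (c : C) a : tau (c *: a) = c * (tau a : C) :> C.
Proof. by rewrite linearZ. Qed.

Lemma mulZZ (a b : C) (x y : CA) : (a *: x) * (b *: y) = (a * b) *: (x * y).
Proof. by rewrite -scalerAl -scalerAr scalerA. Qed.

Lemma cstar1 : star 1 = 1.
Proof. by rewrite -[LHS]mul1r -{1}[1]cstarK -cstarM mul1r cstarK. Qed.

Lemma cstar0 : star 0 = 0.
Proof. by apply: (addIr (star 0)); rewrite -cstarD !add0r. Qed.

Lemma cstar_sum I (r : seq I) (F : I -> CA) :
  star (\sum_(i <- r) F i) = \sum_(i <- r) star (F i).
Proof. by elim: r => [|x r IH]; rewrite ?big_nil ?cstar0 // !big_cons cstarD IH. Qed.

Lemma tau_mulstar_ge0 y : 0 <= (tau (y * star y) : C).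
Proof. by case: htau => _ pos _; have := pos (star y); rewrite cstarK. Qed.

Lemma tau_CauchySchwarz (J : finType) (y z : J -> CA) :
  `|\sum_j (tau (y j * star (z j)) : C)| ^+ 2 <=
  (\sum_j (tau (y j * star (y j)) : C)) * (\sum_j (tau (z j * star (z j)) : C)).
Proof.
apply: (quadratic_CS (g := \sum_j (tau (z j * star (y j)) : C))) => [c||]; last first.
- by apply: sumr_ge0 => j _; apply: tau_mulstar_ge0.
- by apply: sumr_ge0 => j _; apply: tau_mulstar_ge0.
rewrite !mulr_sumr -!big_split /=; apply: sumr_ge0 => j _.
have := tau_mulstar_ge0 (y j + c *: z j).
rewrite cstarD cstarZ mulrDl !mulrDr -!scalerAl -!scalerAr !linearD /= !linearZ /=.
by rewrite !addrA mulrA -normCK.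
Qed.

(** A positive functional is Hermitian, by testing positivity on 1 + z a. *)
Lemma tau_star a : tau (star a) = (tau a : C)^* :> C.
Proof.
have := @quadratic_herm _ (tau 1 : C) (tau (a * star a) : C) (tau a : C) (tau (star a) : C).
apply=> [z||]; last exact: tau_mulstar_ge0; last first.
  by rewrite -[1]mulr1 -{2}cstar1 tau_mulstar_ge0.
have := tau_mulstar_ge0 (1 + z^* *: a).
rewrite cstarD cstarZ cstar1 conjCK mulrDl !mulrDr !mul1r !mulr1 mulZZ.
rewrite !linearD /= !tauZ normCK [z * z^*]mulrC !addrA.
by rewrite [X in 0 <= X -> _](ACl (1*3*2*4))%AC.
Qed.

Variable D : nat.
Implicit Types (Y : 'M[CA]_D) (M : 'M[C]_D).
Notation E := (@cexp R CA D tau).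

Lemma adjmxM Y Y' : adjmx (Y *m Y') = adjmx Y' *m adjmx Y.
Proof.
apply/matrixP=> i j; rewrite !mxE cstar_sum; apply: eq_bigr => k _.
by rewrite !mxE cstarM.
Qed.

Lemma adjmx_emb M : adjmx (emb M) = emb (M^t*) :> 'M[CA]_D.
Proof. by apply/matrixP=> i j; rewrite !mxE cstarZ cstar1. Qed.

Lemma adjmx1 : adjmx (1%:M : 'M[CA]_D) = 1%:M.
Proof.
by apply/matrixP=> i j; rewrite !mxE eq_sym; case: eqP; rewrite ?cstar1 ?cstar0.
Qed.

Lemma adjmx_exp Y k : adjmx Y = Y -> adjmx (Y ^+ k) = Y ^+ k.
Proof.
move=> sY; elim: k => [|k IH]; first exact: adjmx1.
by rewrite exprS [LHS]adjmxM IH sY -[RHS]exprS exprSr.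
Qed.

Lemma mxtrace_cexp_adj Y Y' : \tr (E (Y *m adjmx Y')) =
  \sum_x \sum_z (tau (Y x z * star (Y' x z)) : C).
Proof.
apply: eq_bigr => x _; rewrite !mxE linear_sum; apply: eq_bigr => z _.
by rewrite !mxE.
Qed.

Lemma mxtrace_cexp_adj_ge0 Y : 0 <= \tr (E (Y *m adjmx Y)).
Proof.
rewrite mxtrace_cexp_adj; apply: sumr_ge0 => x _; apply: sumr_ge0 => z _.
exact: tau_mulstar_ge0.
Qed.

Lemma mxtrace_CauchySchwarz (J : finType) (y z : J -> 'M[CA]_D) :
  `|\sum_j \tr (E (y j *m adjmx (z j)))| ^+ 2 <=
  (\sum_j \tr (E (y j *m adjmx (y j)))) * (\sum_j \tr (E (z j *m adjmx (z j)))).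
Proof.
have h (u v : J -> 'M[CA]_D) : \sum_j \tr (E (u j *m adjmx (v j))) =
   \sum_(jxz : J * ('I_D * 'I_D)) (tau (u jxz.1 jxz.2.1 jxz.2.2 * star (v jxz.1 jxz.2.1 jxz.2.2)) : C).
  rewrite -(pair_bigA _ (fun j xz => tau (u j xz.1 xz.2 * star (v j xz.1 xz.2)) : C)).
  apply: eq_bigr => j _; rewrite mxtrace_cexp_adj.
  by rewrite -(pair_bigA _ (fun x z => tau (u j x z * star (v j x z)) : C)).
by rewrite !h; apply: tau_CauchySchwarz.
Qed.

(** Every finite Hankel block of matrix moments [E (X ^+ (j + k))] factors as
    [V_j^* V_k], since its Gram matrix is positive semidefinite. *)
Lemma moment_factorization (X : 'M[CA]_D) (K : nat) : adjmx X = X ->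
  exists N, exists V : nat -> 'M[C]_(N, D), forall j k, (j < K)%N -> (k < K)%N ->
    (V j)^t* *m V k = E (X ^+ (j + k)).
Proof.
move=> sX.
pose U := ('I_K * 'I_D)%type; pose N := #|{: U}|.
pose ix (u : 'I_N) : U := enum_val u.
pose G : 'M[C]_N := \matrix_(u, v)
  E (X ^+ ((ix u).1 + (ix v).1)) (ix u).2 (ix v).2.
have Xkl k l : X ^+ (k + l) = adjmx (X ^+ k) *m X ^+ l.
  by rewrite adjmx_exp // exprD.
have EG u v : G u v = \sum_x (tau (star ((X ^+ (ix u).1) x (ix u).2) *
    (X ^+ (ix v).1) x (ix v).2) : C).
  by rewrite !mxE Xkl !mxE linear_sum; apply: eq_bigr => x _; rewrite !mxE.
have pos (c : 'I_N -> C) : 0 <= \sum_u \sum_v (c u)^* * G u v * c v.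
  have -> : \sum_u \sum_v (c u)^* * G u v * c v =
    \sum_x (tau (star (\sum_u c u *: (X ^+ (ix u).1) x (ix u).2) *
        (\sum_u c u *: (X ^+ (ix u).1) x (ix u).2)) : C).
    under eq_bigr => u _. under eq_bigr => v _ do rewrite EG mulr_sumr mulr_suml.
    rewrite exchange_big. over. rewrite exchange_big; apply: eq_bigr => x _ /=.
    rewrite cstar_sum mulr_suml linear_sum; apply: eq_bigr => u _.
    rewrite mulr_sumr linear_sum; apply: eq_bigr => v _.
    by rewrite cstarZ mulZZ tauZ; ring.
  by apply: sumr_ge0 => x _; case: htau => _ + _; apply.
have Gh : G^t* = G.
  apply/matrixP=> u v; rewrite [LHS]mxE [X in X^*]mxE !EG rmorph_sum /=.
  apply: eq_bigr => x _.
  by rewrite -tau_star cstarM cstarK.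
pose Pm := spectralmx G; pose sp := spectral_diag G.
have GE : G = Pm^t* *m diag_mx sp *m Pm.
  have nG : G \is normalmx by apply/normalmxP; rewrite Gh.
  by rewrite [LHS](orthomx_spectralP nG) invmx_unitary // spectral_unitarymx.
have PP : Pm *m Pm^t* = 1%:M by apply/unitarymxP; exact: spectral_unitarymx.
have sp0 i : 0 <= sp 0 i.
  have -> : sp 0 i = (Pm *m G *m Pm^t*) i i.
    rewrite GE !mulmxA PP mul1mx -mulmxA PP mulmx1 !mxE eqxx mulr1n //.
  have := pos (fun u => (Pm i u)^*); congr (0 <= _).
  rewrite !mxE exchange_big; apply: eq_bigr => v _; rewrite !mxE mulr_suml.
  by apply: eq_bigr => u _; rewrite conjCK.
(* A square root of G from its spectral decomposition. *)
pose W := diag_mx (map_mx sqrtC sp) *m Pm.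
have WW : W^t* *m W = G.
  rewrite [RHS]GE /W trmx_mul map_mxM -!mulmxA; congr (_ *m _); rewrite !mulmxA.
  congr (_ *m _); rewrite tr_diag_mx map_diag_mx mulmx_diag; congr diag_mx.
  apply/rowP=> i; rewrite !mxE -[LHS]/((sqrtC (sp 0 i))^* * sqrtC (sp 0 i)).
  rewrite (CrealP _) -?expr2 ?sqrtCK //.
  by rewrite ger0_real // sqrtC_ge0.
clearbody W.
(* V_k collects the columns of W indexed by (k, x), for all x. *)
exists N, (fun k => \matrix_(r, x) if insub k is Some k' then W r (enum_rank ((k', x) : U)) else 0).
move=> j k jK kK; apply/matrixP=> x y.
have := congr1 (fun M : 'M[C]_N => M (enum_rank ((Ordinal jK, x) : U)) (enum_rank ((Ordinal kK, y) : U))) WW.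
rewrite /G [in X in _ = X -> _]mxE /ix !enum_rankK /= => <-.
rewrite !mxE; apply: eq_bigr => r _.
by rewrite !mxE !insubT.
Qed.
End Positivity.

(** * Hankel forms *)

(** Once a log-convex sequence increases it keeps increasing, so no value exceeds
    both the first and the last one. *)
Lemma log_convex_max (C : numDomainType) (g : nat -> C) (S : nat) (B : C) :
  (forall t, (t <= S)%N -> 0 <= g t) ->
  (forall t, (t.+2 <= S)%N -> g t.+1 ^+ 2 <= g t * g t.+2) ->
  g 0%N <= B -> g S <= B -> forall t, (t <= S)%N -> g t <= B.
Proof.
move=> g0 lc gB0 gBS.
have gr t : (t <= S)%N -> g t \is Num.real by move=> /g0; exact: ger0_real.
have up t : (t.+2 <= S)%N -> g t < g t.+1 -> g t.+1 < g t.+2.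
  move=> tS lt; rewrite real_ltNge ?gr ?(ltnW tS) //; apply/negP => le.
  have p1 : 0 < g t.+1 by apply: le_lt_trans lt; rewrite g0 // ltnW // ltnW.
  have := lc t tS; rewrite real_leNgt ?rpredX ?rpredM ?gr ?(ltnW tS) //; last by rewrite ltnW // ltnW.
  apply/negP; rewrite negbK expr2.
  apply: le_lt_trans (_ : g t * g t.+1 < _); last by rewrite ltr_pM2r.
  by rewrite ler_wpM2l // g0 // ltnW // ltnW.
elim=> [//|t IH] tS.
have gt := IH (ltnW tS).
have [le|lt] := real_leP (gr _ tS) (gr _ (ltnW tS)); first exact: le_trans gt.
apply: le_trans gBS.
have inc k : (t.+1 + k <= S)%N -> g t.+1 <= g (t.+1 + k)%N /\ g (t + k)%N < g (t.+1 + k)%N.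
  elim: k => [|k IHk] kS; first by rewrite !addn0.
  have kS' : (t.+1 + k <= S)%N by move: kS; rewrite addnS => /ltnW.
  have [l1 l2] := IHk kS'; move: kS; rewrite !addnS !addSn => kS.
  have l3 := up _ kS l2; split=> //.
  by apply: le_trans l1 _; apply: ltW; rewrite addSn.
by have [] := inc (S - t.+1)%N; rewrite subnKC.
Qed.

Section Hankel.
Context {R : realType} {CA : cstarAlgType R} {D : nat}.
Notation C := R[i].
Variables (tau : {scalar CA}) (htau : faithful_state tau).
Notation E := (@cexp R CA D tau).
Variable X : 'M[CA]_D.
Hypothesis sX : adjmx X = X.
Hypothesis trX : forall u v w M N,
  \tr (E (X ^+ u *m emb M *m X ^+ v *m emb N *m X ^+ w)) =
  \tr (E (X ^+ (w + u) *m emb M *m X ^+ v *m emb N)).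

Definition word_trace d a (M N : 'M[C]_D) : C :=
  \tr (E (X ^+ d *m emb M *m X ^+ a *m emb N)).

Lemma word_traceC d a M N : word_trace d a M N = word_trace a d N M.
Proof.
have := trX 0 d a N M; rewrite addn0 /word_trace => <-.
rewrite expr0 mul1mx cexp_embr mxtrace_mulC -cexp_embl.
by congr (\tr (E _)); rewrite !mulmxA.
Qed.

Lemma word_trace_sumr d a M I (r : seq I) (z : I -> C) N :
  word_trace d a M (\sum_(k <- r) z k *: N k) = \sum_(k <- r) z k * word_trace d a M (N k).
Proof.
rewrite /word_trace cexp_embr mulmx_sumr linear_sum; apply: eq_bigr => k _ /=.
by rewrite -scalemxAr linearZ /= cexp_embr.
Qed.

Lemma word_trace_suml d a N I (r : seq I) (z : I -> C) M :
  word_trace d a (\sum_(k <- r) z k *: M k) N = \sum_(k <- r) z k * word_trace d a (M k) N.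
Proof. by rewrite word_traceC word_trace_sumr; apply: eq_bigr => k _; rewrite word_traceC. Qed.

Variables (K N : nat) (V : nat -> 'M[C]_(N, D)).
Hypothesis VE : forall j k, (j < K)%N -> (k < K)%N -> (V j)^t* *m V k = E (X ^+ (j + k)).

Notation tensor := ('I_D * 'I_D -> 'M[C]_D).
Implicit Types S : tensor.

(** The factors V_b and V_c replace the moments E(X^b) and E(X^c), of which they are
    the halves. *)
Definition comb S b c (r : 'I_N * 'I_N) : 'M[C]_D :=
  \sum_k (V b r.1 k.1 * (V c r.2 k.2)^*) *: S k.

(** Half of a Hankel form: by [hankelE] the form is the inner product of two legs,
    whose exponents add up. *)
Definition leg S a b c d r : 'M[CA]_D := X ^+ d *m emb (comb S b c r) *m X ^+ a.

Definition hankel_form S S' a b c d : C :=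
  \sum_k \sum_k' E (X ^+ b) k'.1 k.1 * E (X ^+ c) k.2 k'.2 * word_trace d a (S k) ((S' k')^t*).

Lemma hankelE S S' a b c d a' b' c' d' :
  (b < K)%N -> (b' < K)%N -> (c < K)%N -> (c' < K)%N ->
  \sum_r \tr (E (leg S a b c d r *m adjmx (leg S' a' b' c' d' r))) =
  hankel_form S S' (a + a') (b + b') (c + c') (d + d').
Proof.
move=> bK bK' cK cK'.
have step r : \tr (E (leg S a b c d r *m adjmx (leg S' a' b' c' d' r))) =
   \sum_k \sum_k' ((V b r.1 k.1 * (V b' r.1 k'.1)^*) * ((V c r.2 k.2)^* * V c' r.2 k'.2))
      * word_trace (d + d') (a + a') (S k) ((S' k')^t*).
  rewrite /leg !adjmxM adjmx_emb !adjmx_exp // !mulmxA.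
  have -> : X ^+ d *m emb (comb S b c r) *m X ^+ a *m X ^+ a' =
            X ^+ d *m emb (comb S b c r) *m X ^+ (a + a') by rewrite exprD mulmxA.
  rewrite trX -[LHS]/(word_trace _ _ _ _) addnC {1}/comb word_trace_suml; apply: eq_bigr => k _.
  have -> : (comb S' b' c' r)^t* =
     \sum_k' ((V b' r.1 k'.1)^* * V c' r.2 k'.2) *: (S' k')^t*.
    apply/matrixP=> x y; rewrite /comb !mxE !summxE rmorph_sum /=; apply: eq_bigr => k' _.
    by rewrite !mxE !rmorphM /= conjCK.
  rewrite word_trace_sumr mulr_sumr; apply: eq_bigr => k' _.
  by rewrite !mulrA; congr (_ * _); ring.
rewrite (eq_bigr _ (fun r _ => step r)) exchange_big; apply: eq_bigr => k _.
rewrite exchange_big; apply: eq_bigr => k' _ /=.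
rewrite -mulr_suml; congr (_ * _).
rewrite -(pair_bigA _ (fun r1 r2 => (V b r1 k.1 * (V b' r1 k'.1)^*) * ((V c r2 k.2)^* * V c' r2 k'.2))) /=.
rewrite -big_distrlr /= addnC -!VE // !mxE; congr (_ * _); apply: eq_bigr => r _; rewrite !mxE //.
by rewrite mulrC.
Qed.

Lemma hankel_CS S S' a b c d a' b' c' d' :
  (b < K)%N -> (b' < K)%N -> (c < K)%N -> (c' < K)%N ->
  `|hankel_form S S' (a + a') (b + b') (c + c') (d + d')| ^+ 2 <=
  hankel_form S S a.*2 b.*2 c.*2 d.*2 * hankel_form S' S' a'.*2 b'.*2 c'.*2 d'.*2.
Proof.
move=> bK bK' cK cK'; rewrite -!addnn -!hankelE //.
exact: mxtrace_CauchySchwarz.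
Qed.

Lemma hankel_ge0 S a b c d : (b < K)%N -> (c < K)%N ->
  0 <= hankel_form S S a.*2 b.*2 c.*2 d.*2.
Proof.
move=> bK cK; rewrite -!addnn -hankelE //.
by apply: sumr_ge0 => r _; exact: mxtrace_cexp_adj_ge0.
Qed.

(** Discrete Hadamard three-lines argument: a Hankel form is logarithmically
    convex in the exchange of any two exponents, hence it is largest when one
    exponent carries all the weight. *)
Lemma hankel_max S (B : C) s : (s < K)%N ->
  hankel_form S S s.*2 0 0 0 <= B -> hankel_form S S 0 s.*2 0 0 <= B ->
  hankel_form S S 0 0 s.*2 0 <= B -> hankel_form S S 0 0 0 s.*2 <= B ->
  forall a b c d, (a + b + c + d)%N = s -> hankel_form S S a.*2 b.*2 c.*2 d.*2 <= B.
Proof.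
move=> sK Ba Bb Bc Bd.
pose h a b c d := hankel_form S S a.*2 b.*2 c.*2 d.*2.
have hlc a b c d a' b' c' d' a1 b1 c1 d1 : (b < K)%N -> (b' < K)%N -> (c < K)%N -> (c' < K)%N ->
    (a + a' = a1.*2)%N -> (b + b' = b1.*2)%N -> (c + c' = c1.*2)%N ->
    (d + d' = d1.*2)%N -> (b1 < K)%N -> (c1 < K)%N ->
    h a1 b1 c1 d1 ^+ 2 <= h a b c d * h a' b' c' d'.
  move=> bK bK' cK cK' ea eb ec ed bK1 cK1.
  have := @hankel_CS S S a b c d a' b' c' d' bK bK' cK cK'.
  by rewrite ea eb ec ed ger0_norm // hankel_ge0.
have h0 a b c d : (b < K)%N -> (c < K)%N -> 0 <= h a b c d by apply: hankel_ge0.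
have mab a b c d : (a + b + c + d = s)%N -> h (a + b)%N 0%N c d <= B ->
    h 0%N (a + b)%N c d <= B -> h a b c d <= B.
  move=> e B1 B2.
  have := @log_convex_max _ (fun t => h t (a + b - t)%N c d) (a + b) B.
  rewrite subn0 subnn => /(_ _ _ B2 B1 a); rewrite addKn; apply; last lia.
    by move=> t ?; apply: h0; lia.
  by move=> t ?; apply: hlc; lia.
have mcd a b c d : (a + b + c + d = s)%N -> h a b (c + d)%N 0%N <= B ->
    h a b 0%N (c + d)%N <= B -> h a b c d <= B.
  move=> e B1 B2.
  have := @log_convex_max _ (fun t => h a b t (c + d - t)%N) (c + d) B.
  rewrite subn0 subnn => /(_ _ _ B2 B1 c); rewrite addKn; apply; last lia.
    by move=> t ?; apply: h0; lia.
  by move=> t ?; apply: hlc; lia.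
have mac a b c d : (a + b + c + d = s)%N -> h (a + c)%N b 0%N d <= B ->
    h 0%N b (a + c)%N d <= B -> h a b c d <= B.
  move=> e B1 B2.
  have := @log_convex_max _ (fun t => h t b (a + c - t)%N d) (a + c) B.
  rewrite subn0 subnn => /(_ _ _ B2 B1 a); rewrite addKn; apply; last lia.
    by move=> t ?; apply: h0; lia.
  by move=> t ?; apply: hlc; lia.
have mad a b c d : (a + b + c + d = s)%N -> h (a + d)%N b c 0%N <= B ->
    h 0%N b c (a + d)%N <= B -> h a b c d <= B.
  move=> e B1 B2.
  have := @log_convex_max _ (fun t => h t b c (a + d - t)%N) (a + d) B.
  rewrite subn0 subnn => /(_ _ _ B2 B1 a); rewrite addKn; apply; last lia.
    by move=> t ?; apply: h0; lia.
  by move=> t ?; apply: hlc; lia.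
have mbc a b c d : (a + b + c + d = s)%N -> h a (b + c)%N 0%N d <= B ->
    h a 0%N (b + c)%N d <= B -> h a b c d <= B.
  move=> e B1 B2.
  have := @log_convex_max _ (fun t => h a t (b + c - t)%N d) (b + c) B.
  rewrite subn0 subnn => /(_ _ _ B2 B1 b); rewrite addKn; apply; last lia.
    by move=> t ?; apply: h0; lia.
  by move=> t ?; apply: hlc; lia.
have mbd a b c d : (a + b + c + d = s)%N -> h a (b + d)%N c 0%N <= B ->
    h a 0%N c (b + d)%N <= B -> h a b c d <= B.
  move=> e B1 B2.
  have := @log_convex_max _ (fun t => h a t c (b + d - t)%N) (b + d) B.
  rewrite subn0 subnn => /(_ _ _ B2 B1 b); rewrite addKn; apply; last lia.
    by move=> t ?; apply: h0; lia.
  by move=> t ?; apply: hlc; lia.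
move=> a b c d e; rewrite -[X in X <= _]/(h a b c d).
have ha : h s 0%N 0%N 0%N <= B by [].
have hb : h 0%N s 0%N 0%N <= B by [].
have hc : h 0%N 0%N s 0%N <= B by [].
have hd : h 0%N 0%N 0%N s <= B by [].
apply: mab => //; apply: mcd; rewrite ?addn0 ?add0n ?addnA //.
- by apply: mac; rewrite ?addn0 ?add0n ?addnA ?e.
- by apply: mad; rewrite ?addn0 ?add0n ?addnA ?e.
- by apply: mbc; rewrite ?addn0 ?add0n ?addnA ?e.
- by apply: mbd; rewrite ?addn0 ?add0n ?addnA ?e.
Qed.
End Hankel.

(** * The bound on crossing terms *)

Lemma sum_swap13 (V : nmodType) (I1 I2 I3 : finType) (F : I1 -> I2 -> I3 -> V) :
  \sum_a \sum_b \sum_c F a b c = \sum_c \sum_b \sum_a F a b c.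
Proof.
rewrite exchange_big [RHS]exchange_big; apply: eq_bigr => b _; exact: exchange_big.
Qed.

Section SumOrder.
Context {V : nmodType} {I1 I2 I3 I4 : finType}.
Variable F : I1 -> I2 -> I3 -> I4 -> V.
Lemma sum_swapAC : \sum_a \sum_b \sum_c \sum_d F a b c d = \sum_c \sum_b \sum_a \sum_d F a b c d.
Proof. exact: (sum_swap13 (fun a b c => \sum_d F a b c d)). Qed.
Lemma sum_swapBD : \sum_a \sum_b \sum_c \sum_d F a b c d = \sum_a \sum_d \sum_c \sum_b F a b c d.
Proof. by apply: eq_bigr => a _; exact: sum_swap13. Qed.
Lemma sum_swapP : \sum_a \sum_b \sum_c \sum_d F a b c d = \sum_c \sum_d \sum_a \sum_b F a b c d.
Proof.
rewrite sum_swapAC; apply: eq_bigr => c _.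
rewrite (sum_swap13 (fun b a d => F a b c d)); apply: eq_bigr => d _ //.
Qed.
End SumOrder.

Section Frobenius.
Context {C : numClosedFieldType}.
Definition frob2 m n (M : 'M[C]_(m, n)) : C := \sum_x \sum_y `|M x y| ^+ 2.

Lemma frob2E m n (M : 'M[C]_(m, n)) : \tr (M *m M^t*) = frob2 M.
Proof.
apply: eq_bigr => x _; rewrite mxE; apply: eq_bigr => y _.
by rewrite !mxE normCK.
Qed.

Lemma frob2_tr m n (M : 'M[C]_(m, n)) : frob2 (M^t*) = frob2 M.
Proof.
rewrite /frob2 exchange_big; apply: eq_bigr => x _; apply: eq_bigr => y _.
by rewrite !mxE norm_conjC.
Qed.

Lemma frob2_ge0 m n (M : 'M[C]_(m, n)) : 0 <= frob2 M.
Proof. by apply: sumr_ge0 => x _; apply: sumr_ge0 => y _; rewrite exprn_ge0. Qed.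
End Frobenius.

Section Crossing.
Context {R : realType} {CA : cstarAlgType R} {D n : nat}.
Notation C := R[i].
Variables (tau : {scalar CA}) (htau : faithful_state tau).
Notation E := (@cexp R CA D tau).
Variable X : 'M[CA]_D.
Hypothesis sX : adjmx X = X.
Hypothesis trX : forall u v w M N,
  \tr (E (X ^+ u *m emb M *m X ^+ v *m emb N *m X ^+ w)) =
  \tr (E (X ^+ (w + u) *m emb M *m X ^+ v *m emb N)).
Variable A : 'I_n -> 'M[C]_D.
Hypothesis sA : forall i, (A i)^t* = A i.
Variables kap s2 : C.
Hypothesis kap0 : 0 <= kap.
Hypothesis s20 : 0 <= s2.
Hypothesis Acov : forall c : 'I_n -> C,
  frob2 (\sum_i c i *: A i) <= kap * \sum_i `|c i| ^+ 2.
Hypothesis Avar : forall N (W : 'M[C]_(N, D)),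
  \sum_i frob2 (W *m A i) <= s2 * frob2 W.

Notation wtr := (word_trace tau X).
Notation hankel := (hankel_form tau X).

Definition cov4 (k l x y : 'I_D) : C := \sum_i A i k l * A i x y.
(** [tensor_row] and [tensor_mid] are two flattenings of the covariance tensor
    sum_i A_i (x) A_i: in the first the index pair is a position in one factor, in
    the second it consists of one coordinate from each factor. A crossing term
    is the Hankel form of the first against the second. *)
Definition tensor_row (k : 'I_D * 'I_D) : 'M[C]_D := \matrix_(x, y) cov4 k.1 k.2 x y.
Definition tensor_mid (k : 'I_D * 'I_D) : 'M[C]_D := \matrix_(x, y) cov4 x k.2 k.1 y.

(** The covariance parameter controls contraction with sum_i A_i (x) A_i whatever
    stands in the other slots. *)
Lemma cov_bound N1 N2 (B : 'I_n -> 'M[C]_(N1, N2)) :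
  \sum_p \sum_q \sum_x \sum_y `|\sum_i B i p q * A i x y| ^+ 2 <= kap * \sum_i frob2 (B i).
Proof.
have -> : \sum_i frob2 (B i) = \sum_p \sum_q \sum_i `|B i p q| ^+ 2.
  by rewrite exchange_big; apply: eq_bigr => p _; rewrite exchange_big.
rewrite mulr_sumr; apply: ler_sum => p _; rewrite mulr_sumr; apply: ler_sum => q _.
apply: le_trans (Acov (fun i => B i p q)); rewrite le_eqVlt; apply/orP; left; apply/eqP.
apply: eq_bigr => x _; apply: eq_bigr => y _; congr (`|_| ^+ 2).
by rewrite summxE; apply: eq_bigr => i _; rewrite mxE.
Qed.

Lemma cov_boundl N (W : 'M[C]_(N, D)) :
  \sum_p \sum_q \sum_x \sum_y `|\sum_i (W *m A i) p q * A i x y| ^+ 2 <= kap * s2 * frob2 W.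
Proof. by apply: le_trans (cov_bound _) _; rewrite -mulrA ler_wpM2l. Qed.

Lemma cov_boundr N (W : 'M[C]_(N, D)) :
  \sum_p \sum_q \sum_x \sum_y `|\sum_i (A i *m W^t*) p q * A i x y| ^+ 2 <= kap * s2 * frob2 W.
Proof.
apply: le_trans (cov_bound _) _; rewrite -mulrA ler_wpM2l //.
apply: le_trans (Avar W); rewrite le_eqVlt; apply/orP; left; apply/eqP.
apply: eq_bigr => i _; rewrite -[LHS]frob2_tr; congr frob2.
by rewrite trmx_mul map_mxM trmxCK sA.
Qed.

Lemma word_trace0 a M N : wtr 0 a M N = \tr (M *m E (X ^+ a) *m N).
Proof. by rewrite /word_trace expr0 mul1mx cexp_embr cexp_embl. Qed.

Section Extremes.
Variables (N : nat) (V : 'M[C]_(N, D)) (s : nat).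
Hypothesis VE : V^t* *m V = E (X ^+ s).
Implicit Types S : 'I_D * 'I_D -> 'M[C]_D.

Let E0 : E (X ^+ 0) = 1%:M. Proof. by rewrite expr0; exact: cexp1. Qed.

Let sum_delta (k : 'I_D * 'I_D) (F : 'I_D * 'I_D -> C) :
  \sum_k' (1%:M : 'M[C]_D) k'.1 k.1 * (1%:M : 'M[C]_D) k.2 k'.2 * F k' = F k.
Proof.
rewrite (bigD1 k) //= !mxE !eqxx !mul1r big1 ?addr0 // => -[k1 k2].
by rewrite -pair_eqE negb_and !mxE /= eq_sym => /orP[]/negbTE h; rewrite ?[k.2 == _]eq_sym h ?mulr0 ?mul0r.
Qed.

Lemma hankel_a S : hankel S S s 0 0 0 = \sum_k \sum_l frob2 (S (k, l) *m V^t*).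
Proof.
rewrite /hankel_form E0 (pair_bigA _ (fun k l => frob2 (S (k, l) *m V^t*))) /=.
apply: eq_bigr => k _; rewrite sum_delta word_trace0 -VE -frob2E trmx_mul map_mxM trmxCK.
by rewrite -surjective_pairing !mulmxA.
Qed.

Lemma hankel_d S : hankel S S 0 0 0 s = \sum_k \sum_l frob2 (V *m S (k, l)).
Proof.
rewrite /hankel_form E0 (pair_bigA _ (fun k l => frob2 (V *m S (k, l)))) /=.
apply: eq_bigr => k _; rewrite sum_delta word_traceC // word_trace0 -VE -frob2E trmx_mul map_mxM.
by rewrite -surjective_pairing [RHS]mxtrace_mulC !mulmxA.
Qed.

Lemma frob2_sum I (z : I -> C) (r : seq I) (M : I -> 'M[C]_D) :
  frob2 (\sum_(k <- r) z k *: M k) =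
  \sum_(k <- r) \sum_(l <- r) z k * (z l)^* * \tr (M k *m (M l)^t*).
Proof.
rewrite -frob2E mulmx_suml linear_sum; apply: eq_bigr => k _ /=.
rewrite linear_sum /= raddf_sum mulmx_sumr linear_sum; apply: eq_bigr => l _ /=.
rewrite -scalemxAl linearZ /= -mulrA; congr (_ * _).
rewrite (_ : (z l *: M l)^t* = (z l)^* *: (M l)^t*); last first.
  by apply/matrixP=> x y; rewrite !mxE rmorphM.
by rewrite -scalemxAr linearZ.
Qed.

Lemma hankel_b S : hankel S S 0 s 0 0 =
  \sum_r \sum_l frob2 (\sum_k V r k *: S (k, l)).
Proof.
under [RHS]eq_bigr => r _ do under eq_bigr => l _ do rewrite frob2_sum.
rewrite sum_swapAC /hankel_form E0 (pair_bigA _ (fun k l => \sum_r \sum_k'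
   V r k * (V r k')^* * \tr (S (k, l) *m (S (k', l))^t*))) /=.
apply: eq_bigr => -[k l] _ /=; rewrite [RHS]exchange_big /=.
rewrite (eq_bigr (fun k' : 'I_D * 'I_D => E (X ^+ s) k'.1 k * (1%:M : 'M[C]_D) l k'.2 *
   wtr 0 0 (S (k, l)) ((S (k'.1, k'.2))^t*))); last by case.
rewrite -(pair_bigA _ (fun k' l' => E (X ^+ s) k' k * (1%:M : 'M[C]_D) l l' *
   wtr 0 0 (S (k, l)) ((S (k', l'))^t*))) /=.
apply: eq_bigr => k' _; rewrite (bigD1 l) //= big1 ?addr0; last first.
  by move=> l' /negbTE ll; rewrite !mxE eq_sym ll mulr0 mul0r.
rewrite word_trace0 E0 mulmx1 -mulr_suml -VE [X in _ * X * _]mxE eqxx mulr1 [X in X * _]mxE; congr (_ * _).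
by apply: eq_bigr => r _; rewrite !mxE mulrC.
Qed.

Lemma hankel_c S : hankel S S 0 0 s 0 =
  \sum_k \sum_r frob2 (\sum_l (V r l)^* *: S (k, l)).
Proof.
under [RHS]eq_bigr => k _ do under eq_bigr => r _ do rewrite frob2_sum.
under [RHS]eq_bigr => k _ do rewrite exchange_big /=.
rewrite /hankel_form E0 (pair_bigA _ (fun k l => \sum_r \sum_l'
   (V r l)^* * (V r l')^*^* * \tr (S (k, l) *m (S (k, l'))^t*))) /=.
apply: eq_bigr => -[k l] _ /=.
rewrite (eq_bigr (fun k' : 'I_D * 'I_D => (1%:M : 'M[C]_D) k'.1 k * E (X ^+ s) l k'.2 *
   wtr 0 0 (S (k, l)) ((S (k'.1, k'.2))^t*))); last by case.
rewrite -(pair_bigA _ (fun k' l' => (1%:M : 'M[C]_D) k' k * E (X ^+ s) l l' *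
   wtr 0 0 (S (k, l)) ((S (k', l'))^t*))) /=.
rewrite (bigD1 k) //= [X in _ + X]big1 ?addr0; last first.
  by move=> k' /negbTE kk; apply: big1 => l' _; rewrite !mxE kk !mul0r.
rewrite [RHS]exchange_big; apply: eq_bigr => l' _ /=.
rewrite word_trace0 E0 mulmx1 -mulr_suml -VE [X in X * _ * _]mxE eqxx mul1r [X in X * _]mxE; congr (_ * _).
by apply: eq_bigr => r _; rewrite !mxE conjCK.
Qed.

Local Notation B := (kap * s2 * \tr (E (X ^+ s))).

Lemma trVE : \tr (E (X ^+ s)) = frob2 V.
Proof. by rewrite -VE mxtrace_mulC frob2E. Qed.

(** When all of [s] sits in one slot, the other three moments are the identity and
    the form is a squared norm of the covariance tensor multiplied by [V] in one of
    its four indices; by symmetry it is bounded as in [cov_boundl] or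
    [cov_boundr]. *)
Lemma tensor_row_extremes :
  [/\ hankel tensor_row tensor_row s 0 0 0 <= B, hankel tensor_row tensor_row 0 s 0 0 <= B,
      hankel tensor_row tensor_row 0 0 s 0 <= B & hankel tensor_row tensor_row 0 0 0 s <= B].
Proof.
rewrite hankel_a hankel_b hankel_c hankel_d trVE /frob2; split.
- rewrite sum_swapP; apply: le_trans (cov_boundr V); rewrite le_eqVlt; apply/orP; left; apply/eqP.
  apply: eq_bigr => p _; apply: eq_bigr => q _; apply: eq_bigr => x _; apply: eq_bigr => y _.
  congr (`|_| ^+ 2); rewrite mxE.
  under eq_bigr => j _ do rewrite mxE /cov4 mulr_suml.
  rewrite exchange_big; apply: eq_bigr => i _; rewrite mxE mulr_suml; apply: eq_bigr => j _ /=; ring.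
- apply: le_trans (cov_boundl V); rewrite le_eqVlt; apply/orP; left; apply/eqP.
  apply: eq_bigr => p _; apply: eq_bigr => q _; apply: eq_bigr => x _; apply: eq_bigr => y _.
  congr (`|_| ^+ 2); rewrite summxE.
  under eq_bigr => j _ do rewrite !mxE /cov4 mulr_sumr.
  rewrite exchange_big; apply: eq_bigr => i _; rewrite mxE mulr_suml; apply: eq_bigr => j _ /=; ring.
- apply: le_trans (cov_boundr V); rewrite le_eqVlt; apply/orP; left; apply/eqP.
  apply: eq_bigr => p _; apply: eq_bigr => q _; apply: eq_bigr => x _; apply: eq_bigr => y _.
  congr (`|_| ^+ 2); rewrite summxE.
  under eq_bigr => j _ do rewrite !mxE /cov4 mulr_sumr.
  rewrite exchange_big; apply: eq_bigr => i _; rewrite mxE mulr_suml; apply: eq_bigr => j _ /=.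
  rewrite !mxE; ring.
- rewrite sum_swapP; apply: le_trans (cov_boundl V); rewrite le_eqVlt; apply/orP; left; apply/eqP.
  apply: eq_bigr => p _; apply: eq_bigr => q _; apply: eq_bigr => x _; apply: eq_bigr => y _.
  congr (`|_| ^+ 2); rewrite mxE.
  under eq_bigr => j _ do rewrite mxE /cov4 mulr_sumr.
  rewrite exchange_big; apply: eq_bigr => i _; rewrite mxE mulr_suml; apply: eq_bigr => j _ /=; ring.
Qed.

Lemma tensor_mid_extremes :
  [/\ hankel tensor_mid tensor_mid s 0 0 0 <= B, hankel tensor_mid tensor_mid 0 s 0 0 <= B,
      hankel tensor_mid tensor_mid 0 0 s 0 <= B & hankel tensor_mid tensor_mid 0 0 0 s <= B].
Proof.
rewrite hankel_a hankel_b hankel_c hankel_d trVE /frob2; split.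
- rewrite sum_swapBD; apply: le_trans (cov_boundr V); rewrite le_eqVlt; apply/orP; left; apply/eqP.
  apply: eq_bigr => p _; apply: eq_bigr => q _; apply: eq_bigr => x _; apply: eq_bigr => y _.
  congr (`|_| ^+ 2); rewrite mxE.
  under eq_bigr => j _ do rewrite mxE /cov4 mulr_suml.
  rewrite exchange_big; apply: eq_bigr => i _; rewrite mxE mulr_suml; apply: eq_bigr => j _ /=; ring.
- rewrite sum_swapBD; apply: le_trans (cov_boundl V); rewrite le_eqVlt; apply/orP; left; apply/eqP.
  apply: eq_bigr => p _; apply: eq_bigr => q _; apply: eq_bigr => x _; apply: eq_bigr => y _.
  congr (`|_| ^+ 2); rewrite summxE.
  under eq_bigr => j _ do rewrite !mxE /cov4 mulr_sumr.
  rewrite exchange_big; apply: eq_bigr => i _; rewrite mxE mulr_suml; apply: eq_bigr => j _ /=; ring.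
- rewrite sum_swapAC; apply: le_trans (cov_boundr V); rewrite le_eqVlt; apply/orP; left; apply/eqP.
  apply: eq_bigr => p _; apply: eq_bigr => q _; apply: eq_bigr => x _; apply: eq_bigr => y _.
  congr (`|_| ^+ 2); rewrite summxE.
  under eq_bigr => j _ do rewrite !mxE /cov4 mulr_sumr.
  rewrite exchange_big; apply: eq_bigr => i _; rewrite mxE mulr_suml; apply: eq_bigr => j _ /=.
  rewrite !mxE; ring.
- rewrite sum_swapAC; apply: le_trans (cov_boundl V); rewrite le_eqVlt; apply/orP; left; apply/eqP.
  apply: eq_bigr => p _; apply: eq_bigr => q _; apply: eq_bigr => x _; apply: eq_bigr => y _.
  congr (`|_| ^+ 2); rewrite mxE.
  under eq_bigr => j _ do rewrite mxE /cov4 mulr_sumr.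
  rewrite exchange_big; apply: eq_bigr => i _; rewrite mxE mulr_suml; apply: eq_bigr => j _ /=; ring.
Qed.
End Extremes.

Lemma tensor_mid_adj k : (tensor_mid k)^t* = \sum_j A j *m delta_mx k.1 k.2 *m A j.
Proof.
apply/matrixP=> x y; rewrite !mxE /cov4 rmorph_sum summxE /=; apply: eq_bigr => j _.
rewrite rmorphM /= mxE (bigD1 k.2) //= big1 ?addr0; last first.
  move=> l lk; rewrite mxE big1 ?mul0r // => m _; rewrite !mxE.
  by rewrite (negbTE lk) andbF mulr0.
rewrite mxE (bigD1 k.1) //= big1 ?addr0; last first.
  by move=> m mk; rewrite !mxE (negbTE mk) mulr0.
have sAE x' y' : (A j x' y')^* = A j y' x' by rewrite -[in RHS]sA !mxE.
by rewrite !mxE !eqxx mulr1 !sAE mulrC.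
Qed.

(** The indices i, j, i, j occur in crossing order around the trace. *)
Definition crossing a b c d : C := \sum_i \sum_j
  wtr d a (A i) (A j *m (E (X ^+ b) *m A i *m E (X ^+ c)) *m A j).

Lemma crossing_hankel a b c d :
  crossing a b c d = hankel tensor_row tensor_mid a b c d.
Proof.
rewrite /hankel_form /crossing.
have rowE k : tensor_row k = \sum_i A i k.1 k.2 *: A i.
  by apply/matrixP=> x y; rewrite !mxE summxE; apply: eq_bigr => i _; rewrite !mxE.
under [RHS]eq_bigr => k _ do under eq_bigr => k' _ do
  rewrite rowE (word_trace_suml trX) mulr_sumr.
under [RHS]eq_bigr => k _ do rewrite exchange_big /=.
rewrite [RHS]exchange_big /=; apply: eq_bigr => i _.
have midE (k' : 'I_D * 'I_D) : wtr d a (A i) ((tensor_mid k')^t*) =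
    \sum_j wtr d a (A i) (A j *m delta_mx k'.1 k'.2 *m A j).
  rewrite tensor_mid_adj (eq_bigr (fun j => 1 *: (A j *m delta_mx k'.1 k'.2 *m A j))).
    by rewrite word_trace_sumr; apply: eq_bigr => j _; rewrite mul1r.
  by move=> j _; rewrite scale1r.
under [RHS]eq_bigr => k _ do under eq_bigr => k' _ do rewrite midE !mulr_sumr.
under [RHS]eq_bigr => k _ do rewrite exchange_big /=.
rewrite [RHS]exchange_big /=; apply: eq_bigr => j _; rewrite exchange_big /=.
have -> : A j *m (E (X ^+ b) *m A i *m E (X ^+ c)) *m A j =
   \sum_(k' : 'I_D * 'I_D) (\sum_k E (X ^+ b) k'.1 k.1 * A i k.1 k.2 * E (X ^+ c) k.2 k'.2) *:
     (A j *m delta_mx k'.1 k'.2 *m A j).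
  rewrite {1}[E (X ^+ b) *m A i *m E (X ^+ c)]matrix_sum_delta.
  rewrite (pair_bigA _ (fun k l => (E (X ^+ b) *m A i *m E (X ^+ c)) k l *: delta_mx k l)) /=.
  rewrite mulmx_sumr mulmx_suml; apply: eq_bigr => k' _.
  rewrite -scalemxAr -scalemxAl; congr (_ *: _).
  rewrite mxE -(pair_bigA _ (fun k l => E (X ^+ b) k'.1 k * A i k l * E (X ^+ c) l k'.2)) /=.
  rewrite [RHS]exchange_big; apply: eq_bigr => l _; rewrite mxE mulr_suml.
  by apply: eq_bigr.
rewrite word_trace_sumr; apply: eq_bigr => k' _; rewrite mulr_suml; apply: eq_bigr => k _.
ring.
Qed.

(** Cut each exponent in two so that both halves have total [m]: Cauchy-Schwarz
    reduces the mixed form to the two pure forms, and [hankel_max] reduces these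
    to their extreme exponents. *)
Lemma crossing_bound m a b c d : (a + b + c + d = m.*2)%N ->
  `|crossing a b c d| <= kap * s2 * \tr (E (X ^+ m.*2)).
Proof.
move=> e.
have [N [V VE]] := moment_factorization htau m.+1 sX.
have Vm : (V m)^t* *m V m = E (X ^+ m.*2) by rewrite VE // addnn.
have B0 : 0 <= kap * s2 * \tr (E (X ^+ m.*2)).
  by rewrite (trVE Vm) !mulr_ge0 ?frob2_ge0.
have [a1 [b1 [c1 [d1 [ea eb ec ed es]]]]] : exists a1 b1 c1 d1,
    [/\ (a1 <= a)%N, (b1 <= b)%N, (c1 <= c)%N, (d1 <= d)%N & (a1 + b1 + c1 + d1 = m)%N].
  exists (minn a m), (minn b (m - minn a m)), (minn c (m - minn a m - minn b (m - minn a m))),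
    (m - minn a m - minn b (m - minn a m) - minn c (m - minn a m - minn b (m - minn a m)))%N.
  by split; lia.
rewrite -(@ler_pXn2r _ 2) ?nnegrE // crossing_hankel.
rewrite -(subnKC ea) -(subnKC eb) -(subnKC ec) -(subnKC ed).
have K1 : (b1 < m.+1)%N by lia. have K2 : (b - b1 < m.+1)%N by lia.
have K3 : (c1 < m.+1)%N by lia. have K4 : (c - c1 < m.+1)%N by lia.
apply: le_trans (hankel_CS htau sX trX VE tensor_row tensor_mid a1 d1 (a - a1) (d - d1) K1 K2 K3 K4) _.
have [ra rb rc rd] := tensor_row_extremes Vm.
have [ma mb mc md] := tensor_mid_extremes Vm.
rewrite expr2; apply: ler_pM.
- exact: (hankel_ge0 htau sX trX VE).
- exact: (hankel_ge0 htau sX trX VE).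
- by apply: (hankel_max htau sX trX VE (ltnSn m)) es.
- by apply: (hankel_max htau sX trX VE (ltnSn m)) => //; lia.
Qed.
End Crossing.

(** * Integration against a density *)

Import numFieldNormedType.Exports.
Local Open Scope classical_set_scope.
Local Open Scope ring_scope.

Section DensityTransfer.
Context d (Om : measurableType d) (R : realType).
Variables (Q : {measure set Om -> \bar R}) (X : Om -> R) (h : Om -> R).
Hypothesis mX : measurable_fun setT X.
Hypothesis mh : measurable_fun setT h.
Hypothesis h0 : forall w, 0 <= h w.
Variables (nu : {measure set (measurableTypeR R) -> \bar R}) (c : R).
Hypothesis Qnu : forall B : set R, measurable B ->
  (\int[Q]_w (\1_B (X w) * h w)%:E = c%:E * nu B)%E.

Import HBNNSimple.

Let nnsfun_transfer (f : {nnsfun (measurableTypeR R) >-> R}) :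
  (\int[Q]_w (f (X w) * h w)%:E = c%:E * \int[nu]_x (f x)%:E)%E.
Proof.
have mi (r : R) : measurable_fun setT (fun w => (\1_(f @^-1` [set r]) (X w) * h w)%:E).
  apply/measurable_EFinP; apply: measurable_funM => //.
  have mB : measurable (f @^-1` [set r]) by [].
  exact: (measurableT_comp (measurable_indic mB) mX).
under [LHS]eq_integral.
  move=> w _; rewrite fimfunE mulr_fsuml -fsumEFin //.
  under eq_fsbigr do rewrite -mulrA EFinM.
  over.
have pos (r : R) (w : Om) : (0 <= r%:E * (\1_(f @^-1` [set r]) (X w) * h w)%:E)%E.
  have := @nnfun_muleindic_ge0 _ _ _ f r (X w).
  by rewrite [in X in _ -> X]EFinM muleA => ?; rewrite mule_ge0 // lee_fin.
rewrite ge0_integral_fsum //; last first.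
  by move=> r; exact: measurable_funeM.
under [X in (_ = _ * X)%E]eq_integral do rewrite fimfunE -fsumEFin//.
rewrite [in RHS]ge0_integral_fsum //; last 2 first.
  - by move=> r; apply/measurable_EFinP/measurable_funM.
  - by move=> r x _; rewrite EFinM nnfun_muleindic_ge0.
rewrite ge0_mule_fsumr; last first.
  move=> r; apply: integral_ge0 => x _.
  by rewrite EFinM nnfun_muleindic_ge0.
apply: eq_fsbigr => r _.
rewrite integralZl_indic_nnsfun // integral_indic // setIT muleCA -Qnu //.
have [r0|r0] := ltP r 0.
  rewrite preimage_nnfun0 //.
  rewrite !integral0_eq ?mule0 // => w _; by rewrite indic0 !mul0r ?mule0.
rewrite ge0_integralZl //.
by move=> w _; rewrite lee_fin mulr_ge0.
have mB : measurable (f @^-1` [set r]) by [].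
exact: mB.
Qed.

(** If the law of [X] under the weight [h] is [c * nu] on measurable sets, then it is
    so on nonnegative functions: pass to simple functions, then to monotone
    limits. *)
Lemma density_transfer (f : R -> R) : measurable_fun setT f -> (forall x, 0 <= f x) ->
  (\int[Q]_w (f (X w) * h w)%:E = c%:E * \int[nu]_x (f x)%:E)%E.
Proof.
move=> mf f0.
have mEf : measurable_fun [set: measurableTypeR R] (EFin \o f) by exact/measurable_EFinP.
pose f_ := nnsfun_approx measurableT mEf.
have cvf x : ((f_ n x)%:E @[n --> \oo] --> (f x)%:E)%E.
  by apply: cvg_nnsfun_approx => // y _; rewrite lee_fin.
have ndf x a b : (a <= b)%N -> f_ a x <= f_ b x.
  by move=> ab; exact/lefP/nd_nnsfun_approx.
transitivity (limn (fun n => \int[Q]_w (f_ n (X w) * h w)%:E)%E).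
  rewrite -monotone_convergence//=.
  - apply: eq_integral => w _; apply/esym/cvg_lim => //.
    rewrite EFinM; under eq_fun do rewrite EFinM.
    by apply: cvgeZr => //; exact: cvf.
  - move=> n; apply/measurable_EFinP/measurable_funM => //.
    have mfn : measurable_fun [set: measurableTypeR R] (f_ n) by [].
    exact: (measurableT_comp mfn mX).
  - by move=> n w _; rewrite lee_fin mulr_ge0.
  - by move=> w _ a b ab; rewrite lee_fin ler_wpM2r // ndf.
have -> : (\int[nu]_x (f x)%:E = limn (fun n => \int[nu]_x (f_ n x)%:E))%E.
  rewrite -monotone_convergence//=.
  - by apply: eq_integral => x _; apply/esym/cvg_lim => //; exact: cvf.
  - by move=> n; exact/measurable_EFinP/measurable_funTS.
  - by move=> n x _; rewrite lee_fin.
  - by move=> x _ a b ab; rewrite lee_fin ndf.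
rewrite -limeMl//.
  by congr (limn _); apply/funext => n /=; rewrite nnsfun_transfer.
apply/ereal_nondecreasing_is_cvgn => a b ab; apply: ge0_le_integral => //.
- by move=> x _; rewrite lee_fin.
- exact/measurable_EFinP/measurable_funTS.
- exact/measurable_EFinP/measurable_funTS.
- by move=> x _; rewrite lee_fin ndf.
Qed.
End DensityTransfer.

(** * Moments of the Gaussian weight *)

Section NormalMoments.
Context {R : realType}.
Implicit Types (x : R) (j k : nat).
Notation mu := (@lebesgue_measure R).

Definition gexp (x : R) : R := expR (- (x ^+ 2) / 2).

Lemma gexp_ge0 x : 0 <= gexp x. Proof. exact: expR_ge0. Qed.

Lemma normal_pdf01E x : normal_pdf 0 1 x = normal_peak 1 * gexp x.
Proof.
rewrite normal_pdfE ?oner_neq0 // /normal_fun /gexp subr0 expr1n -mulr_natr mul1r.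
by [].
Qed.

Lemma is_derive_gexp x : is_derive x 1 gexp (- x * gexp x).
Proof.
rewrite /gexp; have -> : - x * expR (- (x ^+ 2) / 2) =
    expR (- (x ^+ 2) / 2) * (- (2 * x) / 2) by field.
apply: is_derive1_comp.
apply: is_derive_eq => /=.
by rewrite !scaler0 add0r /GRing.scale /=; field.
Qed.

(** Half of the Gaussian exponent absorbs every power, by the exponential series. *)
Lemma pow_gauss_bound k : exists2 C, 0 <= C &
  forall x, `|x| ^+ k * gexp x <= C * expR (- (x ^+ 2) / 4).
Proof.
have ypow (y : R) : 0 <= y -> y ^+ k <= k`!%:R * expR y.
  move=> y0; case: k => [|k]; first by rewrite expr0 fact0 mul1r -expR0 ler_expR.
  have f0 : (0 : R) < k.+1`!%:R by rewrite ltr0n fact_gt0.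
  rewrite mulrC -ler_pdivrMr //; apply: le_trans (expR_ge1Dxn k y0).
  by rewrite lerDr.
exists (1 + 4 ^+ k * k`!%:R); first by rewrite addr_ge0 // mulr_ge0 // exprn_ge0.
move=> x; pose y := x ^+ 2 / 4.
have y0 : 0 <= y by rewrite divr_ge0 // sqr_ge0.
have ge : gexp x = expR (- y) * expR (- y) by rewrite -expRD; congr expR; rewrite /y; field.
have -> : - x ^+ 2 / 4 = - y by rewrite /y; field.
rewrite ge mulrA ler_pM2r ?expR_gt0 // expRN ler_pdivrMr ?expR_gt0 //.
apply: le_trans (_ : 1 + (x ^+ 2) ^+ k <= _).
  rewrite -exprM mulnC exprM -normrX; have : 0 <= `|x ^+ k| by [].
  have : `|x ^+ k| ^+ 2 = (x ^+ k) ^+ 2 by rewrite real_normK ?num_real.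
  set u := `|_| => <- u0; have := sqr_ge0 (u - 1); nra.
have -> : x ^+ 2 = 4 * y by rewrite /y; field.
rewrite exprMn mulrDl mul1r lerD //.
  by rewrite -expR0 ler_expR.
by rewrite -mulrA ler_wpM2l ?exprn_ge0 // ypow.
Qed.

Lemma measurable_gexp : measurable_fun setT gexp.
Proof.
apply: continuous_measurable_fun => x.
by apply/differentiable_continuous/derivable1_diffP; case: (is_derive_gexp x).
Qed.

Lemma is_derive_pow_gexp j x : is_derive x 1 (fun y => y ^+ j * gexp y)
  (j%:R * x ^+ j.-1 * gexp x - x ^+ j.+1 * gexp x).
Proof.
have d := is_derive_gexp x; case: j => [|j].
  rewrite (_ : (fun y => _) = gexp); last by apply/funext => y; rewrite expr0 mul1r.
  by apply: is_derive_eq; rewrite mul0r mul0r sub0r expr1 mulNr.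
rewrite (_ : (fun y => _) = (id : R -> R) ^+ j.+1 * gexp); last first.
  by apply/funext => y; rewrite !fctE.
apply: is_derive_eq; rewrite /GRing.scale /= !fctE !exprS.
ring.
Qed.

Lemma measurable_pow_gexp j : measurable_fun setT (fun x => x ^+ j * gexp x).
Proof. by apply: measurable_funM; [exact: exprn_measurable|exact: measurable_gexp]. Qed.

Lemma integrable_pow_gexp j : mu.-integrable setT (fun x => (x ^+ j * gexp x)%:E).
Proof.
have [C C0 bd] := pow_gauss_bound j.
have s2 : Num.sqrt 2 != 0 :> R by rewrite sqrtr_eq0 -ltNge.
pose c := C / normal_peak (Num.sqrt 2).
apply: (@le_integrable _ _ _ mu setT measurableT _ (fun x => (c * normal_pdf 0 (Num.sqrt 2) x)%:E)).
- by apply/measurable_EFinP; exact: measurable_pow_gexp.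
- move=> x _; rewrite lee_fin normrM normrX (ger0_norm (gexp_ge0 x)).
  rewrite [X in _ <= X]ger0_norm; last first.
    by rewrite mulr_ge0 ?normal_pdf_ge0 // divr_ge0 // normal_peak_ge0.
  apply: le_trans (bd x) _; rewrite normal_pdfE // /c mulrA divfK; last first.
    by rewrite gt_eqF // normal_peak_gt0.
  rewrite /normal_fun subr0 sqr_sqrtr //.
  by have -> : 2 *+ 2 = 4 :> R by ring.
- under eq_fun do rewrite EFinM.
  by apply: integrableZl => //; exact: integrable_normal_pdf.
Qed.

Definition gmom j : R := (\int[mu]_x (x ^+ j * gexp x))%R.

(** Integration by parts for the Gaussian weight: the boundary terms of
    [x ^+ j * gexp x] over growing intervals vanish. *)
Lemma gmom_rec j : gmom j.+1 = j%:R * gmom j.-1.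
Proof.
pose q x := j%:R * (x ^+ j.-1 * gexp x) - x ^+ j.+1 * gexp x.
have iq1 : mu.-integrable setT (fun x => (j%:R * (x ^+ j.-1 * gexp x))%:E).
  under eq_fun do rewrite EFinM.
  by apply: integrableZl => //; exact: integrable_pow_gexp.
have iq2 := integrable_pow_gexp j.+1.
have iq : mu.-integrable setT (EFin \o q).
  rewrite (_ : EFin \o q = fun x => ((j%:R * (x ^+ j.-1 * gexp x))%:E - (x ^+ j.+1 * gexp x)%:E)%E) //.
  exact: integrableB.
suff q0 : (\int[mu]_x (q x))%R = 0.
  apply/eqP; rewrite -subr_eq0 -oppr_eq0 opprB -q0.
  rewrite RintegralB // RintegralZl //; exact: integrable_pow_gexp.
have [C C0 bd] := pow_gauss_bound j.+1.
pose I n : set R := `[- n.+1%:R, n.+1%:R]%classic.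
pose H x := x ^+ j * gexp x.
have dH x : is_derive x 1 H (q x).
  by have := is_derive_pow_gexp j x; rewrite /q mulrA.
have Hb n : `|H n.+1%:R - H (- n.+1%:R)| <= 2 * C / n.+1%:R.
  have Hx x : `|x| = n.+1%:R -> `|H x| <= C / n.+1%:R.
    move=> xn; rewrite ler_pdivlMr ?ltr0n // -xn /H normrM normrX (ger0_norm (gexp_ge0 x)).
    rewrite mulrAC -exprSr; apply: le_trans (bd x) _.
    by rewrite ler_piMr // expR_le1 mulNr oppr_le0 divr_ge0 // sqr_ge0.
  apply: le_trans (ler_normB _ _) _; rewrite -mulrA mulr_natl mulr2n lerD //; apply: Hx.
    by rewrite ger0_norm.
  by rewrite normrN ger0_norm.
have cpg i : continuous (fun x => x ^+ i * gexp x).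
  move=> x; apply: differentiable_continuous; apply/derivable1_diffP.
  by case: (is_derive_pow_gexp i x).
have cq : continuous q.
  move=> x; apply: cvgB; last exact: cpg.
  by apply: cvgM; [exact: cvg_cst|exact: cpg].
have cH : continuous H by exact: cpg.
have Iq n : (\int[mu]_(x in I n) (q x)%:E = (H n.+1%:R - H (- n.+1%:R))%:E)%E.
  rewrite (@continuous_FTC2 _ q H) ?EFinB //.
  - by rewrite gtrN ?ltr0n.
  - exact: continuous_subspaceT.
  - split; first by move=> x _; case: (dH x).
      by apply: cvg_at_right_filter; exact: cH.
    by apply: cvg_at_left_filter; exact: cH.
  - by move=> x _; rewrite derive1E; case: (dH x).
have mI n : measurable (I n) by exact: measurable_itv.
pose f_ n x := ((EFin \o q) \_ (I n)) x.
have [|||||_ _ lim] := @dominated_convergence _ _ R mu setT measurableT f_ (EFin \o q) (fun x => (`|q x|)%:E).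
- move=> n; rewrite /f_; apply/(measurable_restrictT _ _).1 => //.
    exact: mI.
  by apply/measurable_funTS/measurable_EFinP; exact: continuous_measurable_fun.
- by apply/measurable_EFinP; exact: continuous_measurable_fun.
- apply/aeW => x _; apply: cvg_near_cst.
  near=> n; rewrite /f_ patchE mem_set //; rewrite /I /= in_itv /=.
  rewrite -ler_norml; near: n.
  exists (Num.truncn `|x|) => // n /= xn; apply: ltW; apply: lt_le_trans (truncnS_gt _) _.
  by rewrite ler_nat.
- by apply: (integrable_abse iq).
- apply/aeW => x n _; rewrite /f_ patchE; case: ifP => _ //=.
  by rewrite normr0 lee_fin.
have lim2 : ((H n.+1%:R - H (- n.+1%:R))%:E @[n --> \oo] --> (\int[mu]_x (q x)%:E)%E).
  rewrite (_ : (fun n => _) = fun n => (\int[mu]_x f_ n x)%E); first exact: lim.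
  by apply/funext => n; rewrite -Iq /f_ -integral_mkcond.
have lim3 : ((H n.+1%:R - H (- n.+1%:R)) @[n --> \oo] --> (0:R)).
  apply/cvgr0Pnorm_lt => e e0; near=> n.
  apply: le_lt_trans (Hb n) _; rewrite ltr_pdivrMr ?ltr0n // -ltr_pdivrMl //.
  near: n; exists (Num.truncn (e^-1 * (2 * C))) => // n /= xn; apply: lt_le_trans (truncnS_gt _) _.
  by rewrite ler_nat.
rewrite /Rintegral; have -> // : (\int[mu]_x (q x)%:E = 0)%E.
apply: (cvg_unique _ lim2) => //; apply: cvg_EFin => //.
by apply: nearW.
Unshelve. all: by end_near.
Qed.
End NormalMoments.

(** * Products of independent Gaussian variables *)

Section RintegralSum.
Context d (T : measurableType d) (R : realType) (mu : {measure set T -> \bar R}).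

Lemma integrable_sumR I (s : seq I) (F : I -> T -> R) :
  (forall i, mu.-integrable setT (EFin \o F i)) ->
  mu.-integrable setT (EFin \o (fun w => \sum_(i <- s) F i w)).
Proof.
move=> iF; rewrite (_ : _ \o _ = fun w => (\sum_(i <- s) (EFin \o F i) w)%E).
  by apply: integrable_sum.
by apply/funext => w; rewrite /= sumEFin.
Qed.

Lemma Rintegral_sum I (s : seq I) (F : I -> T -> R) :
  (forall i, mu.-integrable setT (EFin \o F i)) ->
  (\int[mu]_w (\sum_(i <- s) F i w))%R = \sum_(i <- s) (\int[mu]_w F i w)%R.
Proof.
move=> iF; elim: s => [|i s IH].
  rewrite big_nil -[RHS](mul0r (fine (mu setT))) -Rintegral_cst //.
  by apply: eq_Rintegral => w _; rewrite big_nil.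
rewrite big_cons -IH -RintegralD //; last exact: integrable_sumR.
by apply: eq_Rintegral => w _; rewrite big_cons.
Qed.
End RintegralSum.

Section GaussianProducts.
Context {R : realType} {dT : measure_display} {T : measurableType dT}.
Variables (P : probability T R) (n : nat) (g : 'I_n -> {RV P >-> R}).
Hypothesis hg : iid_standard_gaussian g.
Notation mu := (@lebesgue_measure R).

Definition nint (f : R -> R) : \bar R := (\int[mu]_x (f x * normal_pdf 0 1 x)%:E)%E.

Lemma integral_normal_density (f : R -> R) : measurable_fun setT f -> (forall x, 0 <= f x) ->
  (\int[normal_prob 0 1]_x (f x)%:E = nint f)%E.
Proof.
move=> mf f0; rewrite /nint.
have mid : measurable_fun setT (idfun : R -> R) by exact: measurable_id.
have Hyp (B : set R) : measurable B ->
    (\int[mu]_x (\1_B (idfun x) * normal_pdf 0 1 x)%:E = 1%:E * normal_prob (0:R) 1 B)%E.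
  move=> mB; rewrite mul1e /normal_prob [RHS]integral_mkcond; apply: eq_integral => x _.
  by rewrite /= patchE indicE; case: (x \in B); rewrite ?mul1r ?mul0r.
have := density_transfer (Q := mu) (nu := normal_prob 0 1) (c := 1) mid (measurable_normal_pdf 0 1) (normal_pdf_ge0 0 1) Hyp mf f0.
by rewrite mul1e => ->.
Qed.

Notation distr := (normal_prob (0:R) (1:R)).

Lemma nint_indic (B : set R) : measurable B -> nint \1_B = distr B.
Proof.
move=> mB; rewrite -integral_normal_density //; first by rewrite integral_indic // setIT.
Qed.

(** Independence, extended from events to nonnegative functions one variable at a
    time: [l] lists the variables whose function may fail to be an indicator, and
    [density_transfer] with weight the product of the other factors treats one of
    them. *)
Lemma integral_prod_indep (l : seq 'I_n) (phi : 'I_n -> R -> R) :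
  (forall i, measurable_fun setT (phi i)) -> (forall i x, 0 <= phi i x) ->
  (forall i, (nint (phi i) < +oo)%E) ->
  (forall i, i \notin l -> exists2 B : set R, measurable B & phi i = \1_B) ->
  (\int[P]_w (\prod_i phi i (g i w))%:E = (\prod_i fine (nint (phi i)))%:E)%E.
Proof.
have [indep gauss] := hg.
have nint0 f : (forall x, 0 <= f x) -> (0 <= nint f)%E.
  by move=> f0; apply: integral_ge0 => x _; rewrite lee_fin mulr_ge0 ?normal_pdf_ge0.
elim: l phi => [|j l IH] phi mphi phi0 fphi ind.
  have /choice[B HB] : forall i, exists B : set R, measurable B /\ phi i = \1_B.
    by move=> i; have [B mB e] := ind i isT; exists B.
  have mB i : measurable (B i) by case: (HB i).
  have mg i : measurable (g i @^-1` B i).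
    by rewrite -[X in measurable X]setTI; apply: measurable_funP.
  have -> : (fun w => (\prod_i phi i (g i w))%:E) = EFin \o \1_(\bigcap_(i in [set` [set: 'I_n]%SET]) (g i @^-1` B i)).
    apply/funext => w /=; congr EFin; rewrite indicE.
    have [wB|wB] := boolP (w \in _).
      rewrite big1 // => i _; have [_ ->] := HB i; rewrite indicE mem_set //.
      by move: wB; rewrite inE => /(_ i); apply; rewrite /= finset.in_setT.
    apply/eqP/prodf_eq0; apply: contrapT => nz; case/negP: wB.
    rewrite inE => i _; apply: contrapT => nB; apply: nz; exists i => //.
    by have [_ ->] := HB i; rewrite indicE memNset.
  rewrite integral_indic //; last by apply: fin_bigcap_measurable.
  rewrite setIT; etransitivity; first exact: (indep [set: 'I_n]%SET B mB).
  rewrite (big_morph EFin EFinM erefl); apply: eq_big => [i|i _]; first by rewrite finset.in_setT.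
  have [_ ->] := HB i; rewrite nint_indic // fineK ?fin_num_measure //.
    exact: gauss.
  exact: mB.
have fin i : (fine (nint (phi i)))%:E = nint (phi i).
  by rewrite fineK // ge0_fin_numE ?nint0.
pose h w := \prod_(i | i != j) phi i (g i w).
pose c := \prod_(i | i != j) fine (nint (phi i)).
have mg i : measurable_fun setT (g i) by [].
have mh : measurable_fun setT h.
  rewrite /h; under eq_fun do rewrite -big_filter.
  by apply: measurable_prod => i _; exact: (measurableT_comp (mphi i) (mg i)).
have h0 w : 0 <= h w by apply: prodr_ge0.
have Hyp (B : set R) : measurable B -> (\int[P]_w (\1_B (g j w) * h w)%:E = c%:E * distr B)%E.
  move=> mB; pose psi i := if i == j then \1_B : R -> R else phi i.
  have := IH psi.
  have -> : (fun w => (\prod_i psi i (g i w))%:E) = (fun w => (\1_B (g j w) * h w)%:E).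
    apply/funext => w; rewrite (bigD1 j) //= /psi eqxx; congr (_ * _)%:E.
    by apply: eq_bigr => i /negbTE->.
  move=> ->.
  - rewrite (bigD1 j) //= /psi eqxx EFinM muleC nint_indic // fineK ?fin_num_measure //.
    by congr (_%:E * _)%E; apply: eq_bigr => i /negbTE->.
  - by rewrite /psi => i; case: ifP => _ //; exact: measurable_indic.
  - by rewrite /psi => i x; case: ifP => _.
  - rewrite /psi => i; case: ifP => _ //; rewrite nint_indic //.
    rewrite -ge0_fin_numE ?measure_ge0 // fin_num_measure //; exact: mB.
  - move=> i il; rewrite /psi; have [ij|ij] := eqVneq i j; first by exists B.
    by apply: ind; rewrite inE negb_or ij.
have -> : (fun w => (\prod_i phi i (g i w))%:E) = (fun w => (phi j (g j w) * h w)%:E).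
  by apply/funext => w; rewrite (bigD1 j).
rewrite (density_transfer (Q := P) (nu := distr) (c := c) (mg j) mh h0 Hyp (mphi j) (phi0 j)) integral_normal_density //.
by rewrite (bigD1 j) //= [in RHS]EFinM fin muleC.
Qed.

Definition nmom k : R := normal_peak 1 * gmom k.

(** Positive and negative parts of the powers: independence was extended to
    nonnegative functions. *)
Let pm (b : bool) k (x : R) : R := Num.max (if b then x ^+ k else - x ^+ k) 0.
Let sg (b : bool) : R := if b then 1 else -1.

Let pm_ge0 b k x : 0 <= pm b k x. Proof. by rewrite le_max lexx orbT. Qed.

Let pmE k x : x ^+ k = \sum_b sg b * pm b k x.
Proof.
rewrite big_bool /sg /pm /= mul1r mulN1r; set y := x ^+ k.
case: (ltP 0 y) => h; case: (ltP (- y) 0) => h'; lra.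
Qed.

Let mpm b k : measurable_fun setT (pm b k).
Proof.
apply: measurable_maxr => //; case: b; first exact: exprn_measurable.
apply: measurableT_comp => //; exact: exprn_measurable.
Qed.

Let ipm b k : mu.-integrable setT (fun x => (pm b k x * normal_pdf 0 1 x)%:E).
Proof.
have i := integrableZl measurableT (normal_peak 1) (integrable_pow_gexp (R := R) k).
apply: le_integrable i => //.
  by apply/measurable_EFinP; apply: measurable_funM; [exact: mpm|exact: measurable_normal_pdf].
move=> x _ /=; rewrite lee_fin normal_pdf01E mulrCA !normrM ler_wpM2l // ler_wpM2r //.
rewrite ger0_norm ?pm_ge0 // /pm ge_max normr_ge0 andbT.
by case: b; [exact: ler_norm|rewrite -normrN; exact: ler_norm].
Qed.

Let npm b k : R := fine (nint (pm b k)).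

Let nmomE k : nmom k = \sum_b sg b * npm b k.
Proof.
rewrite /nmom /gmom -RintegralZl //; last exact: integrable_pow_gexp.
transitivity (\int[mu]_x (\sum_b sg b * (pm b k x * normal_pdf 0 1 x)))%R.
  apply: eq_Rintegral => x _; rewrite mulrCA -normal_pdf01E pmE mulr_suml.
  by apply: eq_bigr => b _; rewrite mulrA.
have i b : mu.-integrable setT (EFin \o (fun x => sg b * (pm b k x * normal_pdf 0 1 x))).
  rewrite (_ : _ \o _ = fun x => ((sg b)%:E * (pm b k x * normal_pdf 0 1 x)%:E)%E) //.
  exact: integrableZl.
rewrite Rintegral_sum //; apply: eq_bigr => b _; rewrite RintegralZl //; exact: ipm.
Qed.

(** Expand each power into its two nonnegative parts and apply
    [integral_prod_indep] to each choice of signs. *)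
Lemma gauss_prod (k : 'I_n -> nat) :
  P.-integrable setT (EFin \o (fun w => \prod_i g i w ^+ k i)) /\
  (\int[P]_w (\prod_i g i w ^+ k i))%R = \prod_i nmom (k i).
Proof.
pose H (f : {ffun 'I_n -> bool}) w := \prod_i (sg (f i) * pm (f i) (k i) (g i w)).
have HE w : \prod_i g i w ^+ k i = \sum_f H f w.
  by rewrite -(bigA_distr_bigA (fun i b => sg b * pm b (k i) (g i w))); apply: eq_bigr => i _.
have fin b m : (nint (pm b m) < +oo)%E.
  by have := integrable_fin_num measurableT (ipm b m); rewrite ge0_fin_numE // integral_ge0 // => x _;
    rewrite lee_fin mulr_ge0 ?normal_pdf_ge0.
have IH (f : {ffun 'I_n -> bool}) := integral_prod_indep (l := enum 'I_n)
   (fun i => mpm (f i) (k i)) (fun i => pm_ge0 (f i) (k i)) (fun i => fin (f i) (k i)).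
have {}IH (f : {ffun 'I_n -> bool}) : (\int[P]_w (\prod_i pm (f i) (k i) (g i w))%:E = (\prod_i npm (f i) (k i))%:E)%E.
  by apply: IH => i; rewrite mem_enum.
have ipr (f : {ffun 'I_n -> bool}) : P.-integrable setT (EFin \o (fun w => \prod_i pm (f i) (k i) (g i w))).
  apply/integrableP; split.
    apply/measurable_EFinP; apply: measurable_prod => i _.
    by apply: (measurableT_comp (mpm (f i) (k i))).
  rewrite (eq_integral (fun w => (\prod_i pm (f i) (k i) (g i w))%:E)) ?IH ?ltry //.
  by move=> w _ /=; rewrite ger0_norm // prodr_ge0.
have HfE f : H f = fun w => (\prod_i sg (f i)) * \prod_i pm (f i) (k i) (g i w).
  by apply/funext => w; rewrite /H big_split.
have iH f : P.-integrable setT (EFin \o H f).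
  rewrite HfE (_ : _ \o _ = fun w => ((\prod_i sg (f i))%:E * (\prod_i pm (f i) (k i) (g i w))%:E)%E) //.
  by apply: integrableZl => //; exact: ipr.
rewrite (_ : (fun w => _) = fun w => \sum_f H f w); last by apply/funext => w; exact: HE.
split; first exact: integrable_sumR.
rewrite Rintegral_sum //.
rewrite [RHS](eq_bigr (fun i => \sum_b sg b * npm b (k i))); last by move=> i _; exact: nmomE.
rewrite bigA_distr_bigA; apply: eq_bigr => f _.
transitivity (\int[P]_w ((\prod_i sg (f i)) * \prod_i pm (f i) (k i) (g i w)))%R.
  by apply: eq_Rintegral => w _; rewrite HfE.
by rewrite RintegralZl // /Rintegral IH /= -big_split.
Qed.

Lemma nmom_rec k : nmom k.+1 = k%:R * nmom k.-1.
Proof. by rewrite /nmom gmom_rec mulrCA. Qed.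

Definition gword (w : seq 'I_n) (t : T) : R := \prod_(i <- w) g i t.
Definition expect (f : T -> R) : R := (\int[P]_t f t)%R.

Lemma gword_count w t : gword w t = \prod_i g i t ^+ count_mem i w.
Proof.
elim: w => [|j w IH]; rewrite /gword ?big_nil.
  by rewrite big1 // => i _; rewrite expr0.
rewrite big_cons -/(gword w t) IH [RHS](bigD1 j) //= eqxx add1n exprS -mulrA.
rewrite (bigD1 j) //=; congr (_ * (_ * _)); apply: eq_bigr => i ij.
by rewrite eq_sym (negbTE ij).
Qed.

Lemma integrable_gword w : P.-integrable setT (EFin \o gword w).
Proof.
by rewrite (_ : gword w = fun t => \prod_i g i t ^+ count_mem i w);
  [case: (gauss_prod (fun i => count_mem i w))|apply/funext => t; exact: gword_count].
Qed.

Lemma expect_gword w : expect (gword w) = \prod_i nmom (count_mem i w).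
Proof.
case: (gauss_prod (fun i => count_mem i w)) => _ <-.
by apply: eq_Rintegral => t _; exact: gword_count.
Qed.

(** Only the number k of occurrences of [i] in [w] matters, and m_(k+1) = k m_(k-1)
    says that the new letter can be cancelled against any of the k others. *)
Lemma expect_gword_ibp i w : expect (gword (i :: w)) =
  \sum_(x <- splits w) (x.1.2 == i)%:R * expect (gword (x.1.1 ++ x.2)).
Proof.
pose m := \prod_(j | j != i) nmom (count_mem j w).
have step : forall x, List.In x (splits w) -> (x.1.2 == i)%:R * expect (gword (x.1.1 ++ x.2)) =
    (x.1.2 == i)%:R * (nmom (count_mem i w).-1 * m).
  move=> x xw; have [xi|] := eqVneq x.1.2 i; last by rewrite !mul0r.
  have wE : w = x.1.1 ++ x.1.2 :: x.2.
    elim: (w) x xw {xi} => [|a w' IHw] x //= [<- //|] /List.in_map_iff[y [<- /IHw e]].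
    by rewrite /= e.
  rewrite expect_gword (bigD1 i) //=; congr (_ * (nmom _ * _)).
    by rewrite wE xi !count_cat /= eqxx addnCA.
  apply: eq_bigr => j ji; congr nmom; rewrite [in RHS]wE !count_cat /= xi.
  by rewrite eq_sym (negbTE ji).
rewrite (eq_big_In step) -mulr_suml expect_gword (bigD1 i) //= eqxx add1n nmom_rec.
rewrite -mulrA; congr (_ * (_ * _)).
  elim: (w) => [|a w' IHw]; first by rewrite big_nil.
  by rewrite big_splits_cons /= -IHw natrD.
by apply: eq_bigr => j ji; rewrite eq_sym (negbTE ji).
Qed.
End GaussianProducts.

(** * Gaussian expectation of polynomials with parameter *)

Section ParamPolynomials.
Context {R : realType} {n : nat}.
Notation vec := ('I_n -> R).

(** The functions c and c' and a word w, for the term c(theta) x_(w_1) ... x_(w_m)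
    of a polynomial in x whose coefficients have derivative c'. *)
Definition pterm := ((R -> R) * (R -> R) * seq 'I_n)%type.
Definition monom (w : seq 'I_n) (x : vec) : R := \prod_(i <- w) x i.
Definition gmonom i (w : seq 'I_n) (x : vec) : R :=
  \sum_(y <- splits w) (y.1.2 == i)%:R * monom (y.1.1 ++ y.2) x.

Definition peval (p : seq pterm) th x := \sum_(t <- p) t.1.1 th * monom t.2 x.
Definition pderiv (p : seq pterm) th x := \sum_(t <- p) t.1.2 th * monom t.2 x.
Definition pgrad i (p : seq pterm) th x := \sum_(t <- p) t.1.1 th * gmonom i t.2 x.

(** The function [F] is a polynomial in x with coefficients differentiable in theta,
    with theta-derivative [dF] and x-gradient [gF]. Carrying the three along
    together makes integrability, integration by parts and differentiation under
    the expectation statements about monomials. *)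
Definition ppoly (F dF : R -> vec -> R) (gF : 'I_n -> R -> vec -> R) : Prop :=
  exists p : seq pterm,
  [/\ forall t, List.In t p -> forall th : R, is_derive th 1 t.1.1 (t.1.2 th),
      forall th x, F th x = peval p th x, forall th x, dF th x = pderiv p th x
    & forall i th x, gF i th x = pgrad i p th x].

Lemma ppoly_ext F dF gF F' dF' gF' : ppoly F dF gF ->
  (forall th x, F' th x = F th x) -> (forall th x, dF' th x = dF th x) ->
  (forall i th x, gF' i th x = gF i th x) -> ppoly F' dF' gF'.
Proof.
move=> [p [op e1 e2 e3]] f1 f2 f3; exists p; split=> // *.
- by rewrite f1.
- by rewrite f2.
- by rewrite f3.
Qed.

Lemma ppoly0 : ppoly (fun _ _ => 0) (fun _ _ => 0) (fun _ _ _ => 0).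
Proof.
by exists [::]; split=> // *; rewrite /peval /pderiv /pgrad big_nil.
Qed.

Lemma ppoly_cst (r : R) : ppoly (fun _ _ => r) (fun _ _ => 0) (fun _ _ _ => 0).
Proof.
exists [:: ((fun=> r), (fun=> 0), [::])]; split => [t [<- //|//]|th x|th x|i th x] /=.
- by move=> th; exact: is_derive_cst.
- by rewrite /peval big_seq1 /= /monom big_nil mulr1.
- by rewrite /pderiv big_seq1 /= mul0r.
- by rewrite /pgrad big_seq1 /= /gmonom big_nil mulr0.
Qed.

Lemma ppolyD F dF gF F' dF' gF' : ppoly F dF gF -> ppoly F' dF' gF' ->
  ppoly (fun th x => F th x + F' th x) (fun th x => dF th x + dF' th x)
    (fun i th x => gF i th x + gF' i th x).
Proof.
move=> [p [op e1 e2 e3]] [q [oq f1 f2 f3]]; exists (p ++ q); split.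
- by move=> t /List.in_app_iff[/op|/oq].
- by move=> th x; rewrite e1 f1 /peval big_cat.
- by move=> th x; rewrite e2 f2 /pderiv big_cat.
- by move=> i th x; rewrite e3 f3 /pgrad big_cat.
Qed.

Lemma ppoly_sum I (r : seq I) F dF gF :
  (forall k, ppoly (F k) (dF k) (gF k)) ->
  ppoly (fun th x => \sum_(k <- r) F k th x) (fun th x => \sum_(k <- r) dF k th x)
    (fun i th x => \sum_(k <- r) gF k i th x).
Proof.
move=> h; elim: r => [|k r IH].
  by apply: ppoly_ext ppoly0 _ _ _ => *; rewrite big_nil.
by apply: ppoly_ext (ppolyD (h k) IH) _ _ _ => *; rewrite big_cons.
Qed.

Lemma ppolyZ (c c' : R -> R) F dF gF : (forall th : R, is_derive th 1 c (c' th)) ->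
  ppoly F dF gF ->
  ppoly (fun th x => c th * F th x) (fun th x => c' th * F th x + c th * dF th x)
    (fun i th x => c th * gF i th x).
Proof.
move=> dc [p [op e1 e2 e3]].
exists [seq ((fun th => c th * t.1.1 th), (fun th => c' th * t.1.1 th + c th * t.1.2 th), t.2) | t <- p].
split.
- move=> t /List.in_map_iff[t' [<- /op dt]] th /=.
  have dct := dc th; have dtt := dt th.
  have := is_deriveM dct dtt; rewrite /GRing.scale /=.
  by move=> h; apply: is_derive_eq h _; ring.
- by move=> th x; rewrite e1 /peval big_map mulr_sumr; apply: eq_bigr => t _; rewrite mulrA.
- move=> th x; rewrite e1 e2 /peval /pderiv big_map !mulr_sumr -big_split /=.
  by apply: eq_bigr => t _; ring.
- by move=> i th x; rewrite e3 /pgrad big_map mulr_sumr; apply: eq_bigr => t _; rewrite mulrA.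
Qed.

Lemma ppolyX j F dF gF : ppoly F dF gF ->
  ppoly (fun th x => x j * F th x) (fun th x => x j * dF th x)
    (fun i th x => (j == i)%:R * F th x + x j * gF i th x).
Proof.
move=> [p [op e1 e2 e3]].
have monoX w x : monom (j :: w) x = x j * monom w x by rewrite /monom big_cons.
exists [seq (t.1, j :: t.2) | t <- p]; split.
- by move=> t /List.in_map_iff[t' [<- /op]].
- move=> th x; rewrite e1 /peval big_map mulr_sumr; apply: eq_bigr => t _ /=.
  by rewrite monoX; ring.
- move=> th x; rewrite e2 /pderiv big_map mulr_sumr; apply: eq_bigr => t _ /=.
  by rewrite monoX; ring.
- move=> i th x; rewrite e1 e3 /peval /pgrad big_map !mulr_sumr -big_split /=.
  apply: eq_bigr => t _; rewrite /gmonom big_splits_cons /= mulrDr; congr (_ + _).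
    by ring.
  rewrite !mulr_sumr; apply: eq_bigr => y _ /=; rewrite monoX; ring.
Qed.
End ParamPolynomials.

Section GaussExpectation.
Context {R : realType} {dT : measure_display} {T : measurableType dT}.
Variables (P : probability T R) (n : nat) (g : 'I_n -> {RV P >-> R}).
Hypothesis hg : iid_standard_gaussian g.
Notation EE := (@expect R dT T P).
Notation vec := ('I_n -> R).
Let gv (t : T) : vec := fun i => g i t.

Definition gint (f : vec -> R) : Prop := P.-integrable setT (EFin \o (fun t => f (gv t))).
Definition gE (f : vec -> R) : R := EE (fun t => f (gv t)).

Lemma gint_monom w : gint (monom w).
Proof. exact: (integrable_gword hg w). Qed.

Lemma gintZ c f : gint f -> gint (fun x => c * f x).
Proof.
move=> h; rewrite /gint (_ : _ \o _ = fun t => (c%:E * (f (gv t))%:E)%E) //.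
exact: integrableZl.
Qed.

Lemma gEZ c f : gint f -> gE (fun x => c * f x) = c * gE f.
Proof. by move=> h; rewrite /gE /expect RintegralZl. Qed.

Lemma gintD f f' : gint f -> gint f' -> gint (fun x => f x + f' x).
Proof.
move=> h h'; rewrite /gint (_ : _ \o _ = fun t => ((f (gv t))%:E + (f' (gv t))%:E)%E) //.
exact: integrableD.
Qed.

Lemma gED f f' : gint f -> gint f' -> gE (fun x => f x + f' x) = gE f + gE f'.
Proof. by move=> h h'; rewrite /gE /expect RintegralD. Qed.

Lemma gint_sum I (r : seq I) (F : I -> vec -> R) : (forall i, gint (F i)) ->
  gint (fun x => \sum_(i <- r) F i x).
Proof. by move=> h; exact: (integrable_sumR r h). Qed.

Lemma gE_sum I (r : seq I) (F : I -> vec -> R) : (forall i, gint (F i)) ->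
  gE (fun x => \sum_(i <- r) F i x) = \sum_(i <- r) gE (F i).
Proof. by move=> h; rewrite /gE /expect; exact: Rintegral_sum. Qed.

Lemma eq_gE f f' : f =1 f' -> gE f = gE f'.
Proof. by move=> e; apply: eq_Rintegral => t _; rewrite e. Qed.

Lemma gE_le f f' : gint f -> gint f' -> (forall x, f x <= f' x) -> gE f <= gE f'.
Proof. by move=> h h' le; apply: le_Rintegral => // t _; exact: le. Qed.

Lemma gE_cst c : gint (fun=> c) /\ gE (fun=> c) = c.
Proof.
split; first by apply: finite_measure_integrable_cst.
rewrite /gE /expect Rintegral_cst //; have -> : fine (P setT) = 1 by rewrite probability_setT.
by rewrite mulr1.
Qed.

Section OnPpoly.
Variables (F dF : R -> vec -> R) (gF : 'I_n -> R -> vec -> R).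
Hypothesis pF : ppoly F dF gF.

Let gint_lin (p : seq (pterm (R:=R) (n:=n))) (c : pterm -> R) :
  gint (fun x => \sum_(t <- p) c t * monom t.2 x).
Proof. by apply: gint_sum => t; apply: gintZ; exact: gint_monom. Qed.

Lemma gint_ppoly th : gint (F th).
Proof.
case: pF => p [_ e _ _]; rewrite (_ : F th = fun x => \sum_(t <- p) t.1.1 th * monom t.2 x).
  exact: (gint_lin p (fun t => t.1.1 th)).
by apply/funext => x; rewrite e.
Qed.

Lemma gint_gmonom i w : gint (gmonom i w).
Proof. by apply: gint_sum => y; apply: gintZ; exact: gint_monom. Qed.

Lemma gint_pgrad i th : gint (gF i th).
Proof.
case: pF => p [_ _ _ e]; rewrite (_ : gF i th = fun x => \sum_(t <- p) t.1.1 th * gmonom i t.2 x).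
  by apply: gint_sum => t; apply: gintZ; exact: gint_gmonom.
by apply/funext => x; rewrite e.
Qed.

Lemma gE_ibp i th : gE (fun x => x i * F th x) = gE (gF i th).
Proof.
case: pF => p [_ e _ e'].
transitivity (gE (fun x => \sum_(t <- p) t.1.1 th * monom (i :: t.2) x)).
  apply: eq_gE => x; rewrite e /peval mulr_sumr; apply: eq_bigr => t _.
  by rewrite /monom big_cons; ring.
transitivity (gE (fun x => \sum_(t <- p) t.1.1 th * gmonom i t.2 x)); last first.
  by apply: eq_gE => x; rewrite e'.
rewrite !gE_sum.
- apply: eq_bigr => t _; rewrite !gEZ; [|exact: gint_gmonom|exact: gint_monom].
  congr (_ * _); rewrite /gmonom gE_sum; last by move=> y; apply: gintZ; exact: gint_monom.
  rewrite [LHS](expect_gword_ibp hg); apply: eq_bigr => y _.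
  by rewrite gEZ //; exact: gint_monom.
- by move=> t; apply: gintZ; exact: gint_gmonom.
- by move=> t; apply: gintZ; exact: gint_monom.
Qed.

Lemma gE_derive (th : R) : is_derive th 1 (fun th => gE (F th)) (gE (dF th)).
Proof.
case: pF => p [dp e e' _].
have E1 c : gE (fun x => \sum_(t <- p) c t * monom t.2 x) = \sum_(t <- p) c t * gE (monom t.2).
  rewrite gE_sum; last by move=> t; apply: gintZ; exact: gint_monom.
  by apply: eq_bigr => t _; rewrite gEZ //; exact: gint_monom.
rewrite (_ : (fun th => _) = fun th => \sum_(t <- p) t.1.1 th * gE (monom t.2)); last first.
  by apply/funext => u; rewrite -E1; apply: eq_gE => x; rewrite e.
rewrite (eq_gE (e' th)) E1.
elim: p dp {e e' E1} => [|t p IH] dp.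
  rewrite big_nil (_ : (fun u : R => \sum_(t <- [::]) t.1.1 u * gE (monom t.2)) = cst 0); last first.
    by apply/funext => u; rewrite big_nil.
  exact: is_derive_cst.
rewrite big_cons (_ : (fun u : R => \sum_(t <- t :: p) t.1.1 u * gE (monom t.2)) = (fun u => t.1.1 u * gE (monom t.2)) +
   (fun u => \sum_(t <- p) t.1.1 u * gE (monom t.2))); last first.
  by apply/funext => u; rewrite big_cons.
apply: is_deriveD; last by apply: IH => u up; apply: dp; right.
have dt := dp t (or_introl erefl) th.
have := is_deriveM dt (is_derive_cst (gE (monom t.2)) th 1).
by rewrite /GRing.scale /= => h; apply: is_derive_eq h _; ring.
Qed.
End OnPpoly.
End GaussExpectation.

(** * The path of random operators *)

Section MatrixPath.
Context {R : realType} {CA : cstarAlgType R} {D n : nat}.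
Notation C := R[i].
Variables (tau : {scalar CA}) (htau : faithful_state tau).
Variables (s : 'I_n -> CA) (hs : free_semicircular tau s).
Notation E := (@cexp R CA D tau).
Variables (A0 : 'M[C]_D) (A : 'I_n -> 'M[C]_D).
Notation vec := ('I_n -> R).
Notation letter := (@letter R CA D n s).

(** The factor [W] stays in front while the powers of the path are unfolded one at
    a time. *)
Definition re_trace (W Y : 'M[CA]_D) : R := complex.Re (\tr (E (W *m Y))).

Lemma Re_real (r : R) (z : C) : complex.Re (r%:C%C * z) = r * complex.Re z.
Proof. by case: z => a b /=; rewrite mul0r subr0. Qed.

Lemma re_traceDr W Y Y' : re_trace W (Y + Y') = re_trace W Y + re_trace W Y'.
Proof. by rewrite /re_trace mulmxDr cexpD mxtraceD raddfD. Qed.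

Lemma re_trace0 W : re_trace W 0 = 0.
Proof. by apply: (addIr (re_trace W 0)); rewrite -re_traceDr !add0r. Qed.

Lemma re_trace_sumr W I (r : seq I) (Y : I -> 'M[CA]_D) :
  re_trace W (\sum_(i <- r) Y i) = \sum_(i <- r) re_trace W (Y i).
Proof. by elim: r => [|i r IH]; rewrite ?big_nil ?re_trace0 // !big_cons re_traceDr IH. Qed.

Lemma emb_scalarC (z : C) (W : 'M[CA]_D) : W *m emb (z%:M) = emb (z%:M) *m W.
Proof.
apply/matrixP=> i j; rewrite !mxE (bigD1 j) //= big1 ?addr0; last first.
  by move=> k /negbTE kj; rewrite !mxE kj scale0r mulr0.
rewrite [RHS](bigD1 i) //= big1 ?addr0; last first.
  by move=> k /negbTE ki; rewrite !mxE eq_sym ki scale0r mul0r.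
by rewrite !mxE !eqxx !mulr1n -scalerAr -scalerAl mulr1 mul1r.
Qed.

Lemma re_traceZ (r : R) W (M : 'M[C]_D) Y :
  re_trace W (emb (r%:C%C *: M) *m Y) = r * re_trace (W *m emb M) Y.
Proof.
rewrite /re_trace -mul_scalar_mx embM !mulmxA emb_scalarC -!mulmxA cexp_embl.
by rewrite mul_scalar_mx linearZ /= Re_real !mulmxA.
Qed.

Definition interp th (x : vec) : @affine R D n :=
  (A0 + \sum_i (sin th * x i)%:C%C *: A i, fun i => (cos th)%:C%C *: A i).
Definition flow th x : 'M[CA]_D := aff s (interp th x).
Definition dflow th (x : vec) : 'M[CA]_D :=
  aff s (\sum_i (cos th * x i)%:C%C *: A i, fun i => (- sin th)%:C%C *: A i).

Lemma embD (M N : 'M[C]_D) : emb (M + N) = emb M + emb N :> 'M[CA]_D.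
Proof. exact: tensmxDl. Qed.

Lemma emb_sum I (r : seq I) (M : I -> 'M[C]_D) :
  emb (\sum_(i <- r) M i) = \sum_(i <- r) emb (M i) :> 'M[CA]_D.
Proof.
by elim: r => [|i r IH]; [rewrite !big_nil /emb tensmx0l | rewrite !big_cons embD IH].
Qed.

Lemma re_trace_flow W th x Y : re_trace W (flow th x *m Y) = re_trace (W *m emb A0) Y +
  \sum_i sin th * (x i * re_trace (W *m emb (A i)) Y) +
  \sum_i cos th * re_trace (W *m (emb (A i) *m letter i)) Y.
Proof.
rewrite /flow affE /= embD !mulmxDl !re_traceDr -!addrA; congr (_ + _).
  by rewrite /re_trace mulmxA.
rewrite emb_sum !mulmx_suml !re_trace_sumr; congr (_ + _); apply: eq_bigr => i _.
  by rewrite re_traceZ mulrA.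
by rewrite -mulmxA re_traceZ /re_trace !mulmxA.
Qed.

Lemma re_trace_dflow W th x Y : re_trace W (dflow th x *m Y) =
  \sum_i cos th * (x i * re_trace (W *m emb (A i)) Y) +
  \sum_i - sin th * re_trace (W *m (emb (A i) *m letter i)) Y.
Proof.
rewrite /dflow affE /= !mulmxDl !re_traceDr.
rewrite emb_sum !mulmx_suml !re_trace_sumr; congr (_ + _); apply: eq_bigr => i _.
  by rewrite re_traceZ mulrA.
by rewrite -mulmxA re_traceZ /re_trace !mulmxA.
Qed.

(** Unfolding the first factor of the power makes it an affine combination of
    powers of lower order, with other matrices [W]. *)
Lemma ppoly_pow m W : ppoly (fun th x => re_trace W (flow th x ^+ m))
  (fun th x => \sum_(k < m) re_trace W (flow th x ^+ k *m dflow th x *m flow th x ^+ (m.-1 - k)))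
  (fun i th x => \sum_(k < m) sin th * re_trace W (flow th x ^+ k *m emb (A i) *m flow th x ^+ (m.-1 - k))).
Proof.
elim: m W => [|m IH] W.
  by apply: ppoly_ext (ppoly_cst (re_trace W 1%:M)) _ _ _ => *; rewrite ?big_ord0.
have dsin (th : R) : is_derive th 1 sin (cos th) by exact: is_derive_sin.
have dcos (th : R) : is_derive th 1 cos (- sin th) by exact: is_derive_cos.
have h1 := IH (W *m emb A0).
have h2 := ppoly_sum (index_enum 'I_n) (fun i => ppolyZ dsin (ppolyX i (IH (W *m emb (A i))))).
have h3 := ppoly_sum (index_enum 'I_n) (fun i => ppolyZ dcos (IH (W *m (emb (A i) *m letter i)))).
have shift th x (k : 'I_m) (Y : 'M[CA]_D) : flow th x ^+ (bump 0 k) *m Y *m flow th x ^+ (m - bump 0 k) =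
   flow th x *m (flow th x ^+ k *m Y *m flow th x ^+ (m.-1 - k)).
  rewrite /bump /= add1n exprS !mulmxA; congr (_ *m _ ^+ _); lia.
apply: ppoly_ext (ppolyD (ppolyD h1 h2) h3) _ _ _ => [th x|th x|i th x].
- by rewrite exprS re_trace_flow.
- apply/esym; rewrite big_ord_recl /= expr0 mul1mx subn0 re_trace_dflow.
  under [X in _ = _ + X]eq_bigr => k _ do rewrite shift re_trace_flow.
  rewrite !big_split /= [X in _ = _ + (_ + X + _)]exchange_big [X in _ = _ + (_ + _ + X)]exchange_big /=.
  under [X in _ = _ + (_ + X + _)]eq_bigr => i _ do rewrite -!mulr_sumr.
  under [X in _ = _ + (_ + _ + X)]eq_bigr => i _ do rewrite -mulr_sumr.
  ring.
- apply/esym; rewrite big_ord_recl /= expr0 mul1mx subn0.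
  under [X in _ = _ + X]eq_bigr => k _ do rewrite shift re_trace_flow !mulrDr !mulr_sumr.
  rewrite !big_split /= [X in _ = _ + (_ + X + _)]exchange_big [X in _ = _ + (_ + _ + X)]exchange_big /=.
  have -> : \sum_i0 sin th * ((i0 == i)%:R * re_trace (W *m emb (A i0)) (flow th x ^+ m) +
      x i0 * \sum_(k < m) sin th * re_trace (W *m emb (A i0)) (flow th x ^+ k *m emb (A i) *m flow th x ^+ (m.-1 - k))) =
     sin th * re_trace W (emb (A i) *m flow th x ^+ m) +
     \sum_j \sum_(k < m) sin th * (sin th * (x j * re_trace (W *m emb (A j)) (flow th x ^+ k *m emb (A i) *m flow th x ^+ (m.-1 - k)))).
    under eq_bigr => j _ do rewrite mulrDr.
    rewrite big_split /=; congr (_ + _).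
      rewrite (bigD1 i) //= eqxx mul1r big1 ?addr0; last first.
        by move=> j /negbTE->; rewrite mul0r mulr0.
      by rewrite /re_trace !mulmxA.
    apply: eq_bigr => j _; rewrite !mulr_sumr; apply: eq_bigr => k _; ring.
  have -> : \sum_i0 cos th * \sum_(k < m) sin th * re_trace (W *m (emb (A i0) *m letter i0)) (flow th x ^+ k *m emb (A i) *m flow th x ^+ (m.-1 - k)) =
     \sum_j \sum_(k < m) sin th * (cos th * re_trace (W *m (emb (A j) *m letter j)) (flow th x ^+ k *m emb (A i) *m flow th x ^+ (m.-1 - k))).
    apply: eq_bigr => j _; rewrite !mulr_sumr; apply: eq_bigr => k _; ring.
  ring.
Qed.

Hypothesis sA0 : A0^t* = A0.
Hypothesis sA : forall i, (A i)^t* = A i.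

Lemma flow_adj th x : adjmx (flow th x) = flow th x.
Proof.
have real (r : R) : (r%:C%C)^* = r%:C%C :> C.
  by apply/CrealP; rewrite complex_real.
have realZ (r : R) (M : 'M[C]_D) : M^t* = M -> (r%:C%C *: M)^t* = r%:C%C *: M.
  by move=> sM; rewrite linearZ /= map_mxZ sM; congr (_ *: _); exact: real.
have adjD (Y Y' : 'M[CA]_D) : adjmx (Y + Y') = adjmx Y + adjmx Y'.
  by apply/matrixP=> i j; rewrite !mxE cstarD.
have adj_sum I (r : seq I) (Y : I -> 'M[CA]_D) : adjmx (\sum_(i <- r) Y i) = \sum_(i <- r) adjmx (Y i).
  elim: r => [|i r IH]; last by rewrite !big_cons adjD IH.
  by rewrite !big_nil; apply/matrixP=> i j; rewrite !mxE cstar0.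
rewrite /flow /aff /= adjD adjmx_emb embD adj_sum; congr (_ + _).
  rewrite -embD raddfD map_mxD sA0; congr (emb (_ + _)).
  rewrite raddf_sum raddf_sum; apply: eq_bigr => i _; exact: realZ.
apply: eq_bigr => i _; apply/matrixP=> k l; rewrite !mxE cstarZ; congr (_ *: _).
  have := realZ (cos th) _ (sA i); move/matrixP/(_ k l); rewrite !mxE //.
by case: hs => h _; rewrite h.
Qed.

Lemma flow_trace th x u v w M N :
  \tr (E (flow th x ^+ u *m emb M *m flow th x ^+ v *m emb N *m flow th x ^+ w)) =
  \tr (E (flow th x ^+ (w + u) *m emb M *m flow th x ^+ v *m emb N)).
Proof. exact: (mxtrace_cexp_pow htau hs). Qed.

Lemma re_trace_cyc th x k m (Y : 'M[CA]_D) Z : Y = aff s Z -> (k <= m)%N ->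
  re_trace 1%:M (flow th x ^+ k *m Y *m flow th x ^+ (m - k)) = re_trace 1%:M (Y *m flow th x ^+ m).
Proof.
move=> YE km; rewrite /re_trace !mul1mx; congr (complex.Re _).
have := mxtrace_cexpC htau hs (nseq k (interp th x)) (Z :: nseq (m - k) (interp th x)).
rewrite /= !aprod_nseq -YE -/(flow th x) mulmxA => ->.
by rewrite -mulmxA -[_ ^+ _ *m _ ^+ _]exprD subnK.
Qed.
End MatrixPath.

(** * The derivative of the moments along the path *)

Section DerivativeBound.
Context {R : realType} {CA : cstarAlgType R} {D n : nat}.
Notation C := R[i].
Variables (tau : {scalar CA}) (htau : faithful_state tau).
Variables (s : 'I_n -> CA) (hs : free_semicircular tau s).
Notation E := (@cexp R CA D tau).
Variables (A0 : 'M[C]_D) (A : 'I_n -> 'M[C]_D).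
Hypothesis sA0 : A0^t* = A0.
Hypothesis sA : forall i, (A i)^t* = A i.
Variables kr sr : R.
Hypothesis kr0 : 0 <= kr.
Hypothesis sr0 : 0 <= sr.
Hypothesis Acov : forall c : 'I_n -> C,
  frob2 (\sum_i c i *: A i) <= kr%:C%C * \sum_i `|c i| ^+ 2.
Hypothesis Avar : forall N (W : 'M[C]_(N, D)),
  \sum_i frob2 (W *m A i) <= sr%:C%C * frob2 W.
Context {dT : measure_display} {T : measurableType dT}.
Variables (P : probability T R) (g : 'I_n -> {RV P >-> R}).
Hypothesis hg : iid_standard_gaussian g.
Notation vec := ('I_n -> R).
Notation X := (flow s A0 A).
Notation dX := (dflow s A).
Notation rfun := (re_trace tau).
Notation letter := (@letter R CA D n s).
Notation gE := (gE g).
Notation gint := (gint g).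

Definition moment th (x : vec) m : R := rfun 1%:M (X th x ^+ m.*2).
Definition mean_moment p th : R := gE (fun x => moment th x p).

Lemma gint_moment p th : gint (fun x => moment th x p).
Proof. exact: (gint_ppoly hg (ppoly_pow tau s A0 A p.*2 1%:M) th). Qed.

Lemma Re_sum I (r : seq I) (F : I -> C) :
  complex.Re (\sum_(i <- r) F i) = \sum_(i <- r) complex.Re (F i).
Proof.
elim: r => [|i r IH]; rewrite ?big_nil // !big_cons -IH.
by case: (F i) => a b; case: (\sum_(_ <- _) _).
Qed.

Lemma mxtrace_sum I (r : seq I) (F : I -> 'M[C]_D) :
  \tr (\sum_(i <- r) F i) = \sum_(i <- r) \tr (F i).
Proof. by elim: r => [|i r IH]; rewrite ?big_nil ?mxtrace0 // !big_cons mxtraceD IH. Qed.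

(** What separates Gaussian integration by parts from the Schwinger-Dyson equation:
    the failure of id (x) tau to be multiplicative across the second [A i]. *)
Definition gap th x k l : R :=
  \sum_i complex.Re (\tr (A i *m (E (X th x ^+ k *m emb (A i) *m X th x ^+ l) -
    E (X th x ^+ k) *m A i *m E (X th x ^+ l)))).

(** [free_covariance_pow] for a power of the path: each innermost joining pair has
    index [j] and coefficients cos theta, and crosses the pair [i]. *)
Lemma gapE th x k l : gap th x k l =
  cos th ^+ 2 * \sum_(a < k) \sum_(c < l)
    complex.Re (crossing tau (X th x) A a (k.-1 - a) c (l.-1 - c)).
Proof.
rewrite /gap (eq_bigr (fun i => \sum_(a < k) \sum_(c < l) cos th ^+ 2 *
   complex.Re (\sum_j word_trace tau (X th x) (l.-1 - c) a (A i)
     (A j *m (E (X th x ^+ (k.-1 - a)) *m A i *m E (X th x ^+ c)) *m A j)))); last first.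
  move=> i _; rewrite /flow free_covariance_pow // mulmx_sumr mxtrace_sum Re_sum.
  apply: eq_bigr => a _; rewrite mulmx_sumr mxtrace_sum Re_sum; apply: eq_bigr => c _.
  rewrite mulmx_sumr mxtrace_sum -Re_real mulr_sumr; congr complex.Re.
  apply: eq_bigr => j _ /=.
  have -> : (cos th)%:C%C *: A j *m E (aff s (interp A0 A th x) ^+ (k.-1 - a)) *m A i *m
      E (aff s (interp A0 A th x) ^+ c) *m ((cos th)%:C%C *: A j) =
      (cos th ^+ 2)%:C%C *: (A j *m (E (aff s (interp A0 A th x) ^+ (k.-1 - a)) *m A i *m
      E (aff s (interp A0 A th x) ^+ c)) *m A j).
    by rewrite -!scalemxAl -scalemxAr scalerA -rmorphM /= -expr2 !mulmxA.
  set N := (A j *m _ *m A j).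
  have trX := flow_trace htau hs A0 A th x.
  have := word_trace_sumr tau (aff s (interp A0 A th x)) (l.-1 - c) a (A i) [:: tt] (fun=> (cos th ^+ 2)%:C%C) (fun=> N).
  rewrite !big_seq1 => <-; rewrite /word_trace.
  have := trX 0 a (l.-1 - c)%N (A i) ((cos th ^+ 2)%:C%C *: N).
  rewrite addn0 expr0 mul1mx => <-.
  by rewrite -cexp_embl !mulmxA.
rewrite exchange_big mulr_sumr; apply: eq_bigr => a _; rewrite exchange_big mulr_sumr.
apply: eq_bigr => c _; rewrite -mulr_sumr; congr (_ * _).
by rewrite /crossing Re_sum.
Qed.

Lemma Re_crossing_bound th x m a b c d : (a + b + c + d = m.*2)%N ->
  `|complex.Re (crossing tau (X th x) A a b c d)| <= kr * sr * moment th x m.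
Proof.
move=> e.
have k0 : 0 <= kr%:C%C :> C by rewrite lecR.
have s0 : 0 <= sr%:C%C :> C by rewrite lecR.
have := crossing_bound htau (flow_adj hs sA0 sA th x) (flow_trace htau hs A0 A th x) sA k0 s0 Acov Avar e.
move=> h; have := le_trans (normc_ge_Re _) h; rewrite lecE => /andP[_] /=.
by rewrite -rmorphM /= Re_real /moment /re_trace mul1mx.
Qed.

Lemma moment_ge0 th x m : 0 <= moment th x m.
Proof.
rewrite /moment /re_trace mul1mx -addnn exprD -{2}(adjmx_exp m (flow_adj hs sA0 sA th x)).
by have := mxtrace_cexp_adj_ge0 htau (X th x ^+ m); rewrite lecE => /andP[].
Qed.

Lemma gap_bound th x k l m : (k + l = m.+1.*2)%N ->
  `|gap th x k l| <= (k * l)%:R * (kr * sr * moment th x m).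
Proof.
move=> e; rewrite gapE normrM.
have c1 : `|cos th ^+ 2| <= 1.
  by rewrite ger0_norm ?sqr_ge0 // cos2sin2 lerBlDr lerDl sqr_ge0.
apply: le_trans (_ : 1 * \sum_(a < k) \sum_(c < l) kr * sr * moment th x m <= _); last first.
  by rewrite mul1r !sumr_const !card_ord -mulrnA mulnC mulr_natl.
rewrite ler_pM // (le_trans (ler_norm_sum _ _ _)) //; apply: ler_sum => a _.
rewrite (le_trans (ler_norm_sum _ _ _)) //; apply: ler_sum => c _.
apply: Re_crossing_bound; have := ltn_ord a; have := ltn_ord c; lia.
Qed.

Definition dmean_moment p th : R := gE (fun x => \sum_(k < p.*2)
  rfun 1%:M (X th x ^+ k *m dX th x *m X th x ^+ (p.*2.-1 - k))).

Lemma mean_moment_derive p (th : R) : is_derive th 1 (mean_moment p) (dmean_moment p th).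
Proof. exact: (gE_derive hg (ppoly_pow tau s A0 A p.*2 1%:M) th). Qed.

(** The factor x_i of the derivative in theta, after Gaussian integration by parts,
    and the factor s_i, to which the Schwinger-Dyson equation applies. *)
Let grad th i p x : R := \sum_(k < p.*2.+1) sin th *
  rfun (1%:M *m emb (A i)) (X th x ^+ k *m emb (A i) *m X th x ^+ (p.*2.+1.-1 - k)).
Let slope th i p x : R := rfun (1%:M *m (emb (A i) *m letter i)) (X th x ^+ p.*2.+1).

Let gint_grad th i p : gint (grad th i p).
Proof.
exact: (gint_pgrad hg (ppoly_pow tau s A0 A p.*2.+1 (1%:M *m emb (A i))) i th).
Qed.

Let gint_slope th i p : gint (slope th i p).
Proof.
exact: (gint_ppoly hg (ppoly_pow tau s A0 A p.*2.+1 (1%:M *m (emb (A i) *m letter i))) th).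
Qed.

Let slopeE th i p x : slope th i p x = cos th * \sum_(k < p.*2.+1)
   complex.Re (\tr (A i *m (E (X th x ^+ k) *m A i *m E (X th x ^+ (p.*2 - k))))).
Proof.
rewrite /slope /re_trace mul1mx -mulmxA cexp_embl schwinger_dyson_pow // mulmx_sumr.
rewrite mxtrace_sum Re_sum mulr_sumr; apply: eq_bigr => k _ /=.
by rewrite -scalemxAr -scalemxAl -scalemxAr linearZ /= Re_real.
Qed.

Let gap_split th p x : \sum_i (cos th * grad th i p x + (- sin th) * slope th i p x) =
  sin th * cos th * \sum_(k < p.*2.+1) gap th x k (p.*2 - k).
Proof.
rewrite /gap exchange_big mulr_sumr; apply: eq_bigr => i _.
rewrite slopeE /grad -mulr_sumr.
have -> : \sum_(k < p.*2.+1) complex.Re (\tr (A i *m (E (X th x ^+ k *m emb (A i) *m X th x ^+ (p.*2 - k)) -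
    E (X th x ^+ k) *m A i *m E (X th x ^+ (p.*2 - k))))) =
   \sum_(k < p.*2.+1) rfun (1%:M *m emb (A i)) (X th x ^+ k *m emb (A i) *m X th x ^+ (p.*2 - k)) -
   \sum_(k < p.*2.+1) complex.Re (\tr (A i *m (E (X th x ^+ k) *m A i *m E (X th x ^+ (p.*2 - k))))).
  rewrite -sumrB; apply: eq_bigr => k _; rewrite mulmxBr raddfB /=.
  rewrite /re_trace mul1mx cexp_embl.
  by case: (\tr _) => a b; case: (\tr _) => c d.
rewrite /=; ring.
Qed.

Lemma gint_gap th p : gint (fun x => sin th * cos th * \sum_(k < p.*2.+1) gap th x k (p.*2 - k)).
Proof.
rewrite (_ : (fun x => _) = fun x => \sum_i (cos th * grad th i p x + (- sin th) * slope th i p x)).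
  by apply: gint_sum => i; apply: gintD; apply: gintZ; [exact: gint_grad|exact: gint_slope].
by apply/funext => x; rewrite gap_split.
Qed.

Lemma dmean_momentE p th : dmean_moment p.+1 th = p.+1.*2%:R *
  gE (fun x => sin th * cos th * \sum_(k < p.*2.+1) gap th x k (p.*2 - k)).
Proof.
pose f1 i x := x i * rfun (1%:M *m emb (A i)) (X th x ^+ p.*2.+1).
have i1 i : gint (f1 i).
  exact: (gint_ppoly hg (ppolyX i (ppoly_pow tau s A0 A p.*2.+1 (1%:M *m emb (A i)))) th).
have e1 x : \sum_(k < p.+1.*2) rfun 1%:M (X th x ^+ k *m dX th x *m X th x ^+ (p.+1.*2.-1 - k)) =
   p.+1.*2%:R * \sum_i (cos th * f1 i x + (- sin th) * slope th i p x).
  rewrite big_split /= -(re_trace_dflow tau s A 1%:M th x).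
  rewrite (eq_bigr (fun=> rfun 1%:M (dX th x *m X th x ^+ p.*2.+1))).
    by rewrite sumr_const card_ord mulr_natl.
  move=> k _; apply: (re_trace_cyc htau hs A0 A th x erefl).
  by have := ltn_ord k; lia.
have i2 i : gint (fun x => cos th * f1 i x + (- sin th) * slope th i p x).
  by apply: gintD; apply: gintZ.
rewrite /dmean_moment (eq_gE g e1) gEZ; last exact: gint_sum.
congr (_ * _); rewrite (gE_sum _ i2).
rewrite -(eq_gE g (gap_split th p)) gE_sum; last by move=> i; apply: gintD; apply: gintZ.
apply: eq_bigr => i _; rewrite !gED; try exact: gintZ.
rewrite !gEZ //; congr (_ * _ + _).
exact: (gE_ibp hg (ppoly_pow tau s A0 A p.*2.+1 (1%:M *m emb (A i))) i th).
Qed.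

(** There are 2 p + 1 gaps with k + l = 2 p, each a sum of k l <= p^2 crossing
    terms, and |sin cos| <= 1/2. For p = 0 the bound is 0: the second moment is
    constant along the path. *)
Lemma dmean_moment_bound p th :
  `|dmean_moment p.+1 th| <= (p.+1 * (p.*2.+1 * p ^ 2))%:R * (kr * sr) * mean_moment p.-1 th.
Proof.
pose c : R := (p.*2.+1 * p ^ 2)%:R * (kr * sr) / 2.
have ks0 : 0 <= kr * sr by rewrite mulr_ge0.
have c0 : 0 <= c by rewrite divr_ge0 // mulr_ge0.
have bd x : `|sin th * cos th * \sum_(k < p.*2.+1) gap th x k (p.*2 - k)| <= c * moment th x p.-1.
  have sc : `|sin th * cos th| <= 1 / 2.
    have := cos2Dsin2 th; have := sqr_ge0 (cos th - sin th); have := sqr_ge0 (cos th + sin th).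
    by rewrite ler_norml sqrrB sqrrD => h1 h2 h3; apply/andP; split; lra.
  have mk : `|\sum_(k < p.*2.+1) gap th x k (p.*2 - k)| <= (p.*2.+1 * p ^ 2)%:R * (kr * sr * moment th x p.-1).
    apply: le_trans (ler_norm_sum _ _ _) _.
    apply: le_trans (_ : \sum_(k < p.*2.+1) (p ^ 2)%:R * (kr * sr * moment th x p.-1) <= _); last first.
      by rewrite sumr_const card_ord -[X in X <= _]mulr_natl mulrA -natrM.
    apply: ler_sum => k _; have kp := ltn_ord k.
    have m0 : 0 <= kr * sr * moment th x p.-1 by rewrite mulr_ge0 // moment_ge0.
    case: (posnP p) => [p0|p0].
      rewrite gapE [\sum_(a < k) _]big1 ?mulr0 ?normr0; first by rewrite mulr_ge0.
      by move=> [a ak]; exfalso; lia.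
    apply: le_trans (gap_bound th x (m := p.-1) _) _; first by rewrite prednK //; lia.
    rewrite ler_wpM2r // ler_nat.
      have [h _] := nat_AGM2 k (p.*2 - k); move: h; rewrite (subnKC (kp : k <= p.*2)%N).
      by rewrite -[X in (_ <= X ^ 2)%N -> _]mul2n expnMn leq_pmul2l.
  rewrite normrM /c; have := ler_pM (normr_ge0 _) (normr_ge0 _) sc mk.
  by move/le_trans; apply; rewrite le_eqVlt; apply/orP; left; apply/eqP; field.
rewrite dmean_momentE normrM normr_nat.
have gb : gint (fun x => c * moment th x p.-1) by apply: gintZ; exact: gint_moment.
have le1 := gE_le (gint_gap th p) gb (fun x => le_trans (ler_norm _) (bd x)).
have gbN : gint (fun x => (- c) * moment th x p.-1) by apply: gintZ; exact: gint_moment.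
have le2 : gE (fun x => (- c) * moment th x p.-1) <= gE (fun x => sin th * cos th * \sum_(k < p.*2.+1) gap th x k (p.*2 - k)).
  apply: gE_le => // [|x]; first exact: gint_gap.
  by have := bd x; rewrite ler_norml mulNr => /andP[].
rewrite (gEZ c (gint_moment p.-1 th)) in le1.
rewrite (gEZ (- c) (gint_moment p.-1 th)) in le2.
have phi0 : 0 <= mean_moment p.-1 th.
  have [i0 e0] := gE_cst g 0; rewrite -e0 /mean_moment; apply: gE_le => //; first exact: gint_moment.
  by move=> x; exact: moment_ge0.
apply: le_trans (_ : p.+1.*2%:R * (c * mean_moment p.-1 th) <= _).
  by rewrite ler_wpM2l // ler_norml le1 -mulNr le2.
rewrite mulrA /c le_eqVlt; apply/orP; left; apply/eqP; congr (_ * _).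
by rewrite -muln2 !natrM; field.
Qed.
End DerivativeBound.

(** * The differential inequality *)

Lemma quadratic_ge0 (R : realFieldType) (a b c t : R) : 0 <= a -> 0 <= c ->
  b ^+ 2 <= a * c -> 0 <= a + t *+ 2 * b + t ^+ 2 * c.
Proof.
move=> a0; rewrite le_eqVlt => /predU1P[<-|c0] h.
  have b0 : b = 0.
    by apply/eqP; rewrite -sqrf_eq0 eq_le sqr_ge0 andbT; rewrite mulr0 in h.
  by rewrite b0 !mulr0 !addr0.
rewrite -(pmulr_rge0 _ c0); apply: le_trans (_ : (b + t * c) ^+ 2 + (a * c - b ^+ 2) <= _).
  by rewrite addr_ge0 ?sqr_ge0 // subr_ge0.
by rewrite le_eqVlt; apply/orP; left; apply/eqP; ring.
Qed.

(** Where [c] is positive, take t = - b / c; where it is not, a suitable t shows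
    that [b] and [c] vanish. *)
Lemma discriminant_le (R : realFieldType) (a b c : R) : 0 <= a ->
  (forall t, 0 <= a + b * t *+ 2 + c * t ^+ 2) -> b ^+ 2 <= a * c.
Proof.
move=> a0 h.
have [c0|c0] := leP c 0; last first.
  have := h (- b / c); rewrite -(pmulr_lge0 _ c0) => h1.
  rewrite -subr_ge0 [a * c]mulrC; apply: le_trans h1 _; rewrite le_eqVlt; apply/orP; left; apply/eqP.
  by field; rewrite gt_eqF.
have [be|b0] := eqVneq b 0.
  rewrite be expr0n /=; have [->|c1] := eqVneq c 0; first by rewrite mulr0.
  have c2 : c < 0 by rewrite lt_neqAle c1.
  have p0 : 0 < (1 - a / c) by rewrite subr_gt0 (le_lt_trans _ ltr01) // mulr_ge0_le0 // invr_le0.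
  have := h (1 - a / c); rewrite be mul0r mul0rn addr0 => h1.
  exfalso; have : c * (1 - a / c) = c - a by field.
  nra.
exfalso; have b2 : 0 < b ^+ 2 by rewrite exprn_even_gt0.
have := h (- (a + 1) / b); have -> : b * (- (a + 1) / b) *+ 2 = - (a + 1) *+ 2 by field.
by have := sqr_ge0 (- (a + 1) / b); nra.
Qed.

(** Since [u 0 = 1] and the ratios of consecutive terms increase,
    [u k ^+ k.+1 <= u k.+1 ^+ k]; two such steps are composed. *)
Lemma lyapunov (R : realFieldType) (u : nat -> R) : u 0%N = 1 -> (forall k, 0 <= u k) ->
  (forall k, u k.+1 ^+ 2 <= u k * u k.+2) ->
  forall k, u k ^+ k.+2 <= u k.+2 ^+ k.
Proof.
move=> u0 up lc.
have step k : u k ^+ k.+1 <= u k.+1 ^+ k.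
  elim: k => [|k IH]; first by rewrite u0 expr1n.
  have [e|e] := eqVneq (u k.+1) 0; first by rewrite e expr0n exprn_ge0.
  have p : 0 < u k.+1 by rewrite lt_neqAle eq_sym e up.
  rewrite -(ler_pM2l (exprn_gt0 k p)).
  apply: le_trans (_ : (u k.+1 ^+ 2) ^+ k.+1 <= _).
    by rewrite -exprM -exprD le_eqVlt; apply/orP; left; apply/eqP; congr (_ ^+ _); lia.
  apply: le_trans (lerXn2r _ _ _ (lc k)) _; rewrite ?nnegrE ?exprn_ge0 ?mulr_ge0 //.
  by rewrite exprMn ler_wpM2r // exprn_ge0.
move=> k; have := step k; have := step k.+1 => s1 s0.
rewrite -(ler_pXn2r (ltn0Sn k)) ?nnegrE ?exprn_ge0 //.
rewrite -exprM mulnC exprM.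
apply: le_trans (lerXn2r _ _ _ s0) _; rewrite ?nnegrE ?exprn_ge0 //.
rewrite -exprM mulnC exprM.
apply: le_trans (lerXn2r _ _ _ s1) _; rewrite ?nnegrE ?exprn_ge0 //.
by rewrite -!exprM mulnC.
Qed.

(** In this form the fourth root is uniformly continuous: (b + c)^4 exceeds
    b^4 + c^4 by nonnegative cross terms. *)
Lemma quartic_dist (R : realFieldType) (a b c : R) : 0 <= a -> 0 <= b ->
  a ^+ 4 <= b ^+ 4 + c ^+ 4 -> 0 <= c -> a <= b + c.
Proof.
move=> a0 b0 h c0; have bc : 0 <= b + c by rewrite addr_ge0.
rewrite -(ler_pXn2r (isT : (0 < 4)%N)) ?nnegrE //; apply: le_trans h _.
rewrite -subr_ge0; have -> : (b + c) ^+ 4 - (b ^+ 4 + c ^+ 4) =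
  b * c * (b ^+ 2 *+ 4 + b * c *+ 6 + c ^+ 2 *+ 4) by ring.
have p := mulr_ge0 b0 c0; rewrite mulr_ge0 // addr_ge0 ?addr_ge0 ?mulrn_wge0 ?sqr_ge0 //.
Qed.

Section ODE.
Context {R : realType}.
Variables (f df : R -> R) (r K : R).
Hypothesis r0 : 0 < r.
Hypothesis f0 : forall t, 0 <= f t.
Hypothesis hd : forall t : R, is_derive t 1 f (df t).
Hypothesis bd : forall e t : R, 0 < e -> `|df t| <= K * (f t + e) `^ (1 - r).

(** The derivative of (f + e)^r is r (f + e)^(r - 1) f', and the hypothesis on f'
    cancels the power. The shift by [e] avoids the point 0, at which the power need
    not be differentiable. *)
Lemma powR_growth_eps (e a b : R) : 0 < e -> a < b ->
  `|(f b + e) `^ r - (f a + e) `^ r| <= r * K * (b - a).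
Proof.
move=> e0 ab.
have fe t : 0 < f t + e by rewrite ltr_wpDl.
pose h t := (f t + e) `^ r.
have hh (t : R) : is_derive t 1 h (r * (f t + e) `^ (r - 1) * df t).
  have d1 : is_derive t 1 (fun t => f t + e) (df t).
    have := is_deriveD (hd t) (is_derive_cst e t (1 : R)).
    by rewrite addr0.
  have := @is_derive1_comp _ (fun x : R => x `^ r) (fun t => f t + e) t _ _ (is_derive1_powR r (fe t)) d1.
  by move=> h1; apply: is_derive_eq h1 _; rewrite /GRing.scale /=; ring.
have [|c _ hc] := MVT ab (fun t _ => hh t).
  apply: continuous_subspaceT => t.
  by apply: differentiable_continuous; apply/derivable1_diffP; case: (hh t).
have ab0 : 0 <= b - a by rewrite subr_ge0 ltW.
rewrite -/(h b) -/(h a) hc normrM (ger0_norm ab0).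
rewrite ler_pM2r ?subr_gt0 // normrM normrM (ger0_norm (ltW r0)) -mulrA ler_pM2l //.
rewrite ger0_norm ?powR_ge0 //.
apply: le_trans (_ : (f c + e) `^ (r - 1) * (K * (f c + e) `^ (1 - r)) <= _).
  by rewrite ler_wpM2l ?powR_ge0 // bd.
have z : r - 1 + (1 - r) = 0 by ring.
rewrite mulrCA -powRD; last by rewrite (gt_eqF (fe c)) implybT.
by rewrite z powRr0 mulr1.
Qed.

(** The shift is removed without a continuity argument: it can be chosen so that
    (f a + e)^r = (f a)^r + d exactly, for any given d > 0. *)
Lemma powR_growth a b : a < b -> `|f b `^ r - f a `^ r| <= r * K * (b - a).
Proof.
move=> ab.
have lim (A B C : R) : 0 <= A -> 0 <= B ->
    (forall e : R, 0 < e -> (A + e) `^ r <= (B + e) `^ r + C) -> A `^ r <= B `^ r + C.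
  move=> A0 B0 h; apply/ler_addgt0Pr => d d0.
  (* (B + e)^r = B^r + d *)
  pose e := (B `^ r + d) `^ r^-1 - B.
  have e0 : 0 < e.
    rewrite subr_gt0 -[X in X < _]powRr1 // -(mulfV (lt0r_neq0 r0)) powRrM.
    by rewrite gt0_ltr_powR ?invr_gt0 // ?nnegrE ?ltrDl ?addr_ge0 ?powR_ge0 // ltW.
  have Be : B + e = (B `^ r + d) `^ r^-1 by rewrite /e addrCA subrr addr0.
  have := h e e0; rewrite Be -powRrM mulVf ?gt_eqF // powRr1; last first.
    by rewrite addr_ge0 ?powR_ge0 // ltW.
  rewrite addrAC; apply: le_trans; rewrite ge0_ler_powR ?nnegrE ?(ltW r0) ?lerDl ?(ltW e0) //.
  by rewrite addr_ge0 // ltW.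
rewrite ler_distlC; apply/andP; split.
  rewrite lerBlDr; apply: lim => // e e0.
  by have := powR_growth_eps e0 ab; rewrite ler_distl => /andP[].
apply: lim => // e e0.
by have := powR_growth_eps e0 ab; rewrite ler_distl lerBlDr => /andP[].
Qed.

End ODE.

(** The bound that closes the differential inequality for u_(k+2), shifted by [e]
    as [powR_growth_eps] requires. *)
Lemma lyapunov_powR (R : realType) (u : nat -> R) : u 0%N = 1 -> (forall k, 0 <= u k) ->
  (forall k, u k.+1 ^+ 2 <= u k * u k.+2) ->
  forall k (e : R), 0 < e -> u k <= (u k.+2 + e) `^ (1 - 2 / k.+2%:R).
Proof.
move=> u0 up lc k e e0; have L := lyapunov u0 up lc k.
have k0 : k.+2%:R != 0 :> R by rewrite pnatr_eq0.
have ue0 : 0 <= u k.+2 + e by rewrite addr_ge0 // ltW.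
rewrite -(ler_pXn2r (ltn0Sn k.+1)) ?nnegrE ?powR_ge0 //.
apply: le_trans L _; rewrite -[X in _ <= X]powR_mulrn ?powR_ge0 // -powRrM.
have -> : (1 - 2 / k.+2%:R) * k.+2%:R = k%:R :> R.
  rewrite mulrBl mul1r divfK // -[k.+2]addn2 natrD; ring.
by rewrite powR_mulrn // lerXn2r ?nnegrE // lerDl ltW.
Qed.

Lemma powR_root_dist (R : realType) (x y c : R) (p : nat) : (0 < p)%N ->
  0 <= x -> 0 <= y -> 0 <= c -> `|x `^ (2 / p%:R) - y `^ (2 / p%:R)| <= c ^+ 4 ->
  `|x `^ (2 * p)%:R^-1 - y `^ (2 * p)%:R^-1| <= c.
Proof.
move=> p0 x0 y0 c0; have pn : p%:R != 0 :> R by rewrite pnatr_eq0 -lt0n.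
have r4 z : z `^ (2 / p%:R) = (z `^ (2 * p)%:R^-1) ^+ 4 :> R.
  rewrite -powR_mulrn ?powR_ge0 // -powRrM; congr (_ `^ _).
  by rewrite natrM; field.
rewrite !r4 ler_distl => /andP[]; rewrite lerBlDr => h1 h2.
by rewrite ler_distl lerBlDr !(quartic_dist _ _ _ c0) ?powR_ge0.
Qed.

Section Interpolation.
Context {R : realType} {CA : cstarAlgType R} {D n : nat}.
Notation C := R[i].
Variables (tau : {scalar CA}) (htau : faithful_state tau).
Variables (s : 'I_n -> CA) (hs : free_semicircular tau s).
Notation E := (@cexp R CA D tau).
Variables (A0 : 'M[C]_D) (A : 'I_n -> 'M[C]_D).
Hypothesis sA0 : A0^t* = A0.
Hypothesis sA : forall i, (A i)^t* = A i.
Variables kr sr : R.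
Hypothesis kr0 : 0 <= kr.
Hypothesis sr0 : 0 <= sr.
Hypothesis Acov : forall c : 'I_n -> C,
  frob2 (\sum_i c i *: A i) <= kr%:C%C * \sum_i `|c i| ^+ 2.
Hypothesis Avar : forall N (W : 'M[C]_(N, D)),
  \sum_i frob2 (W *m A i) <= sr%:C%C * frob2 W.
Hypothesis D0 : (0 < D)%N.
Context {dT : measure_display} {T : measurableType dT}.
Variables (P : probability T R) (g : 'I_n -> {RV P >-> R}).
Hypothesis hg : iid_standard_gaussian g.
Notation mom := (moment tau s A0 A).
Notation phi := (mean_moment tau s A0 A g).

Lemma moment0 th x : mom th x 0 = D%:R.
Proof.
rewrite /moment /re_trace mul1mx expr0.
have -> : E 1 = 1%:M by exact: (cexp1 htau).
by rewrite mxtrace1 -(rmorph_nat (real_complex R)).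
Qed.

(** Cauchy-Schwarz for X^k and X^(k+2). *)
Lemma moment_log_convex th x k : mom th x k.+1 ^+ 2 <= mom th x k * mom th x k.+2.
Proof.
pose Y := flow s A0 A th x.
have sY m : adjmx (Y ^+ m) = Y ^+ m by apply: adjmx_exp; exact: (flow_adj hs sA0 sA).
have eY a b m : (a + b = m.*2)%N -> \tr (E (Y ^+ a *m adjmx (Y ^+ b))) = \tr (E (Y ^+ m.*2)).
  by move=> <-; rewrite sY exprD.
have := mxtrace_CauchySchwarz htau (fun _ : 'I_1 => Y ^+ k) (fun=> Y ^+ k.+2).
rewrite !big_ord1 (eY k k.+2 k.+1) ?(eY k k k) ?(eY k.+2 k.+2 k.+2); try lia.
have mE m : \tr (E (Y ^+ m.*2)) = (mom th x m)%:C%C.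
  have := mxtrace_cexp_adj_ge0 htau (Y ^+ m); rewrite (eY m m m) ?addnn //.
  move/ger0_Im => h; rewrite /moment /re_trace mul1mx -/Y.
  by case: (\tr _) h => a b /= ->.
by rewrite !mE normc_def /= expr0n addr0 sqrtr_sqr -!rmorphXn -rmorphM lecR real_normK ?num_real.
Qed.

Let Phi k th : R := phi k th / D%:R.

Let Phi0 th : Phi 0 th = 1.
Proof.
rewrite /Phi /mean_moment (eq_gE g (fun x => moment0 th x)) (gE_cst g _).2 divff //.
by rewrite pnatr_eq0 -lt0n.
Qed.

Let Phi_ge0 k th : 0 <= Phi k th.
Proof.
rewrite divr_ge0 // /mean_moment; have [i0 e0] := gE_cst g 0; rewrite -e0; apply: gE_le => //.
  exact: gint_moment.
by move=> x; exact: moment_ge0.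
Qed.

(** Averaging preserves log-convexity: for each t the quadratic polynomial with the
    moments as coefficients is nonnegative pointwise, hence on average. *)
Let Phi_log_convex th k : Phi k.+1 th ^+ 2 <= Phi k th * Phi k.+2 th.
Proof.
have Dp : 0 < (D%:R ^+ 2)^-1 :> R by rewrite invr_gt0 exprn_gt0 // ltr0n.
rewrite /Phi expr_div_n mulrACA -invfM -expr2 ler_pM2r //.
have gm j := gint_moment tau s A0 A hg j th.
apply: discriminant_le => [|t].
  by rewrite -(pmulr_lge0 _ (_ : 0 < D%:R^-1)) ?invr_gt0 ?ltr0n //; exact: Phi_ge0.
have -> : phi k th + phi k.+1 th * t *+ 2 + phi k.+2 th * t ^+ 2 =
   gE g (fun x => mom th x k + t *+ 2 * mom th x k.+1 + t ^+ 2 * mom th x k.+2).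
  rewrite !gED ?gEZ //; try by repeat (apply: gintD || apply: gintZ).
  by rewrite /mean_moment; ring.
have [i0 e0] := gE_cst g 0; rewrite -e0; apply: gE_le => //.
  by repeat (apply: gintD || apply: gintZ).
move=> x; have := moment_log_convex th x k.
have := moment_ge0 htau hs sA0 sA th x k; have := moment_ge0 htau hs sA0 sA th x k.+2.
by move=> c0 a0 lc; exact: quadratic_ge0.
Qed.

(** The case p = 1 is separate because 1 - 2/p is negative: there the bound on the
    derivative is 0. The constant 4/p is 2/p, from the power 2/p of the moment,
    times a bound on the length pi/2. *)
Lemma interpolation p (c : R) : (0 < p)%N -> 0 <= c ->
  (p * (p.-1.*2.+1 * p.-1 ^ 2))%:R * (kr * sr) * (4 / p%:R) <= c ^+ 4 ->
  `|(phi p (pi / 2) / D%:R) `^ (2 * p)%:R^-1 - (phi p 0 / D%:R) `^ (2 * p)%:R^-1| <= c.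
Proof.
move=> p0 c0 hc; apply: powR_root_dist => //; try exact: Phi_ge0.
set K := _ * (kr * sr) in hc.
have K0 : 0 <= K by rewrite mulr_ge0 // mulr_ge0.
have r0 : 0 < 2 / p%:R :> R by rewrite divr_gt0 // ltr0n.
pose dPhi th := dmean_moment tau s A0 A g p th / D%:R.
have hd (th : R) : is_derive th 1 (Phi p) (dPhi th).
  have := is_deriveM (mean_moment_derive tau s A0 A hg p th) (is_derive_cst (D%:R^-1 : R) th (1 : R)).
  by move=> h; apply: is_derive_eq h _; rewrite /GRing.scale /= /dPhi; ring.
have bd (e th : R) : 0 < e -> `|dPhi th| <= K * (Phi p th + e) `^ (1 - 2 / p%:R).
  move=> e0; case: p p0 @K @dPhi hc K0 r0 hd => [//|q] _ K dPhi _ K0 _ _.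
  apply: le_trans (_ : K * Phi q.-1 th <= _).
    rewrite normrM mulrA [`|_^-1|]ger0_norm // ler_pM2r ?invr_gt0 ?ltr0n //.
    exact: dmean_moment_bound.
  case: q @K {dPhi} K0 => [|q] K K0; first by rewrite /K muln0 !mul0r.
  rewrite ler_wpM2l //.
  exact: (lyapunov_powR (Phi0 th) (fun k => Phi_ge0 k th) (Phi_log_convex th) q e0).
have pi2 : 0 < pi / 2 :> R by rewrite divr_gt0 // pi_gt0.
have G := powR_growth r0 (Phi_ge0 p) hd bd pi2.
apply: le_trans G _.
apply: le_trans hc; rewrite subr0.
apply: le_trans (_ : 2 / p%:R * K * 2 <= _).
  by rewrite ler_wpM2l ?mulr_ge0 ?(ltW r0) // ltW // pihalf_lt2.
by rewrite le_eqVlt; apply/orP; left; apply/eqP; ring.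
Qed.

End Interpolation.

(** * The parameters v and sigma *)

Section VarianceNorms.
Context {R : realType} {d : nat}.
Notation C := R[i].
Implicit Types M N : 'M[C]_d.

Lemma normc_norm (z : C) : (Normc.normc z)%:C%C = `|z|.
Proof. by rewrite normc_def; case: z. Qed.

Lemma cauchy_schwarz (J : finType) (a b : J -> C) :
  `|\sum_j a j * b j| ^+ 2 <= (\sum_j `|a j| ^+ 2) * (\sum_j `|b j| ^+ 2).
Proof.
apply: (@quadratic_CS _ _ _ _ (\sum_j (a j * b j)^*)) => [z||]; last first.
- by apply: sumr_ge0 => j _; rewrite exprn_ge0.
- by apply: sumr_ge0 => j _; rewrite exprn_ge0.
rewrite !mulr_sumr -!big_split /=; apply: sumr_ge0 => j _.
have -> : `|a j| ^+ 2 + z^* * (a j * b j) + z * (a j * b j)^* + `|z| ^+ 2 * `|b j| ^+ 2 =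
  `|a j + z * (b j)^*| ^+ 2.
  by rewrite !normCK !(rmorphD, rmorphM) /= conjCK; ring.
by rewrite exprn_ge0.
Qed.

Lemma frob2_cnorm2 (x : 'cV[C]_d) : frob2 x = (cnorm2 x ^+ 2)%:C%C.
Proof.
rewrite /cnorm2 sqr_sqrtr; last by apply: sumr_ge0 => i _; rewrite sqr_ge0.
rewrite /frob2 rmorph_sum /=; apply: eq_bigr => i _.
by rewrite big_ord1 rmorphXn /= normc_norm.
Qed.

Lemma opnorm_has_ubound M :
  has_ubound [set cnorm2 (M *m x) | x in [set x | cnorm2 x <= 1]].
Proof.
exists (Num.sqrt (\sum_i \sum_j Normc.normc (M i j) ^+ 2)) => _ [x /= x1 <-].
rewrite /cnorm2 ler_wsqrtr // -lecR rmorph_sum.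
have fx : frob2 x <= 1.
  rewrite frob2_cnorm2 -(rmorph1 (real_complex R)) lecR.
  by rewrite expr_le1 // /cnorm2 sqrtr_ge0.
rewrite [leRHS]rmorph_sum; apply: ler_sum => i _.
rewrite rmorphXn /= normc_norm mxE; apply: le_trans (cauchy_schwarz _ _) _.
rewrite -[leRHS]mulr1; apply: ler_pM => //; try by apply: sumr_ge0 => j _; rewrite exprn_ge0.
  by rewrite rmorph_sum; apply: ler_sum => j _; rewrite rmorphXn /= normc_norm.
by apply: le_trans fx; apply: ler_sum => j _; rewrite big_ord1.
Qed.

Lemma opnorm_ge0 M : 0 <= opnorm M.
Proof.
apply: (@le_trans _ _ (cnorm2 (M *m 0))); first by rewrite /cnorm2 sqrtr_ge0.
apply: (ub_le_sup (opnorm_has_ubound M)); exists 0 => //=.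
by rewrite /cnorm2 big1 ?sqrtr0 // => i _; rewrite mxE Normc.normc0 expr0n.
Qed.

Lemma cnorm2Z (t : R) (x : 'cV[C]_d) : 0 <= t -> cnorm2 (t%:C%C *: x) = t * cnorm2 x.
Proof.
move=> t0; rewrite /cnorm2 -{2}(ger0_norm t0) -sqrtr_sqr -sqrtrM ?sqr_ge0 // mulr_sumr.
congr Num.sqrt; apply: eq_bigr => i _; rewrite mxE Normc.normcM exprMn; congr (_ * _).
by rewrite /= expr0n addr0 sqr_sqrtr ?sqr_ge0.
Qed.

Lemma cnorm2_mul M (x : 'cV[C]_d) : cnorm2 (M *m x) <= opnorm M * cnorm2 x.
Proof.
have [e|e] := eqVneq (cnorm2 x) 0.
  have x0 : x = 0.
    have := frob2_cnorm2 x; rewrite e expr0n => /eqP; rewrite psumr_eq0; last first.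
      by move=> i _; apply: sumr_ge0 => j _; rewrite exprn_ge0.
    move=> /allP h; apply/colP => i; have := h i; rewrite mem_index_enum => /(_ isT).
    by rewrite big_ord1 sqrf_eq0 normr_eq0 mxE => /eqP.
  by rewrite e mulr0 x0 mulmx0 /cnorm2 big1 ?sqrtr0 // => i _; rewrite mxE Normc.normc0 expr0n.
have e0 : 0 < cnorm2 x by rewrite lt_neqAle eq_sym e /cnorm2 sqrtr_ge0.
rewrite -ler_pdivrMr // mulrC -cnorm2Z ?invr_ge0 ?(ltW e0) // scalemxAr.
apply: (ub_le_sup (opnorm_has_ubound M)); exists ((cnorm2 x)^-1%:C%C *: x) => //=.
by rewrite cnorm2Z ?invr_ge0 ?(ltW e0) // mulVf.
Qed.

(** Cauchy-Schwarz, with the operator norm applied to the adjoint of the row. *)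
Lemma row_form_le M (w : 'rV[C]_d) : `|\tr (w *m M *m w^t*)| <= (opnorm M)%:C%C * frob2 w.
Proof.
set x := w^t*; have xw : frob2 w = frob2 x by rewrite /x frob2_tr.
have c0 : 0 <= (cnorm2 x)%:C%C :> C by rewrite lecR /cnorm2 sqrtr_ge0.
rewrite xw -(ler_pXn2r (isT : (0 < 2)%N)) ?nnegrE ?normr_ge0 //; last first.
  by rewrite mulr_ge0 ?frob2_ge0 // lecR opnorm_ge0.
rewrite -mulmxA trace_mx11 mxE; apply: le_trans (cauchy_schwarz _ _) _.
have -> : \sum_j `|w 0 j| ^+ 2 = frob2 x by rewrite -xw /frob2 big_ord1.
have -> : \sum_j `|(M *m x) j 0| ^+ 2 = frob2 (M *m x) by apply: eq_bigr => j _; rewrite big_ord1.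
rewrite exprMn [_ ^+ 2 as X in _ <= _ * X]expr2 mulrA mulrC ler_wpM2r ?frob2_ge0 //.
rewrite !frob2_cnorm2 -rmorphXn -rmorphM lecR -exprMn.
by rewrite ler_pXn2r ?nnegrE ?cnorm2_mul ?mulr_ge0 ?opnorm_ge0 // /cnorm2 sqrtr_ge0.
Qed.

Lemma mxtrace_form_le n M (W : 'M[C]_(n, d)) :
  `|\tr (W *m M *m W^t*)| <= (opnorm M)%:C%C * frob2 W.
Proof.
have -> : \tr (W *m M *m W^t*) = \sum_i \tr (row i W *m M *m (row i W)^t*).
  apply: eq_bigr => i _; rewrite trace_mx11 -row_mul !mxE; apply: eq_bigr => j _.
  by rewrite !mxE; congr (_ * _).
have -> : frob2 W = \sum_i frob2 (row i W).
  by apply: eq_bigr => i _; rewrite /frob2 big_ord1; apply: eq_bigr => j _; rewrite mxE.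
rewrite mulr_sumr; apply: le_trans (ler_norm_sum _ _ _) _; apply: ler_sum => i _.
exact: row_form_le.
Qed.

Context {n : nat}.
Variable A : 'I_n -> 'M[C]_d.

Lemma sigma_sqr : sigma A ^+ 2 =
  Num.max (opnorm (\sum_i ((A i)^t* *m A i))) (opnorm (\sum_i (A i *m (A i)^t*))).
Proof. apply: sqr_sqrtr; rewrite le_max; apply/orP; left; exact: opnorm_ge0. Qed.

Lemma sum_frob2_form m (W : 'M[C]_(m, d)) (B : 'I_n -> 'M[C]_d) :
  \sum_i frob2 (W *m B i) <= (opnorm (\sum_i (B i *m (B i)^t*)))%:C%C * frob2 W.
Proof.
have e : \sum_i frob2 (W *m B i) = \tr (W *m (\sum_i (B i *m (B i)^t*)) *m W^t*).
  rewrite mulmx_sumr mulmx_suml linear_sum; apply: eq_bigr => i _.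
  by rewrite -frob2E trmx_mul map_mxM !mulmxA.
rewrite -[leLHS]ger0_norm ?e; first exact: mxtrace_form_le.
by rewrite -e; apply: sumr_ge0 => i _; exact: frob2_ge0.
Qed.

Lemma sigma_bound m (W : 'M[C]_(m, d)) :
  \sum_i frob2 (W *m A i) <= (sigma A ^+ 2)%:C%C * frob2 W /\
  \sum_i frob2 (W *m (A i)^t*) <= (sigma A ^+ 2)%:C%C * frob2 W.
Proof.
rewrite sigma_sqr; split.
  apply: (le_trans (sum_frob2_form W A)).
  by rewrite ler_wpM2r ?frob2_ge0 // lecR le_max; apply/orP; right; exact: lexx.
apply: (le_trans (sum_frob2_form W (fun i => (A i)^t*))).
rewrite (eq_bigr (fun i => (A i)^t* *m A i)); last by move=> i _; rewrite trmxCK.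
by rewrite ler_wpM2r ?frob2_ge0 // lecR le_max; apply/orP; left; exact: lexx.
Qed.

Let vset := [set \sum_i Normc.normc (\tr (A i *m M)) ^+ 2 |
                 M in [set M | \tr (absmx M ^+ 2) <= 1]].

Lemma trace_absmx_sqr M : \tr (absmx M ^+ 2) = frob2 M.
Proof. by rewrite absmx_sqr mxtrace_mulC frob2E. Qed.

(** A crude bound; it makes the supremum defining v finite. *)
Lemma sum_tr_le M : \sum_i `|\tr (A i *m M)| ^+ 2 <= (\sum_i frob2 (A i)) * frob2 M.
Proof.
rewrite mulr_suml; apply: ler_sum => i _.
rewrite (_ : \tr _ = \sum_(xy : 'I_d * 'I_d) A i xy.1 xy.2 * M xy.2 xy.1); last first.
  rewrite -(pair_bigA _ (fun x y => A i x y * M y x)) /=.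
  by apply: eq_bigr => x _; rewrite mxE.
apply: le_trans (cauchy_schwarz _ _) _.
rewrite -(pair_bigA _ (fun x y => `|A i x y| ^+ 2)) -(pair_bigA _ (fun x y => `|M y x| ^+ 2)) /=.
by rewrite [X in _ * X]exchange_big.
Qed.

Let normc_sum M : (\sum_i Normc.normc (\tr (A i *m M)) ^+ 2)%:C%C = \sum_i `|\tr (A i *m M)| ^+ 2.
Proof. by rewrite rmorph_sum; apply: eq_bigr => i _; rewrite rmorphXn /= normc_norm. Qed.

Lemma vset_has_ubound : has_ubound vset.
Proof.
have r0 : 0 <= \sum_i frob2 (A i) by apply: sumr_ge0 => i _; exact: frob2_ge0.
exists (complex.Re (\sum_i frob2 (A i))) => _ [M /= M1 <-].
rewrite -lecR normc_sum; have := ger0_Im r0.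
case: (\sum_i frob2 (A i)) (sum_tr_le M) r0 => a b le1 r0 /= b0.
apply: le_trans le1 _; rewrite b0 in r0 *.
by rewrite -[leRHS]mulr1 ler_wpM2l // -trace_absmx_sqr.
Qed.

Lemma vpar_sqr : vpar A ^+ 2 = sup vset.
Proof.
rewrite /vpar sqr_sqrtr //.
apply: (@le_trans _ _ (\sum_i Normc.normc (\tr (A i *m 0)) ^+ 2)).
  by apply: sumr_ge0 => i _; rewrite sqr_ge0.
apply: (ub_le_sup vset_has_ubound); exists 0 => //.
by rewrite /= trace_absmx_sqr /frob2 big1 // => x _; rewrite big1 // => y _; rewrite mxE normr0 expr0n.
Qed.

Lemma frob2Z (t : C) M : frob2 (t *: M) = `|t| ^+ 2 * frob2 M.
Proof.
rewrite /frob2 mulr_sumr; apply: eq_bigr => x _; rewrite mulr_sumr; apply: eq_bigr => y _.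
by rewrite mxE normrM exprMn.
Qed.

(** The definition of v, extended from the unit ball by scaling. *)
Lemma vpar_trace M : \sum_i `|\tr (A i *m M)| ^+ 2 <= (vpar A ^+ 2)%:C%C * frob2 M.
Proof.
have [e|e] := eqVneq (frob2 M) 0.
  by have := sum_tr_le M; rewrite e !mulr0.
have M0 : 0 < frob2 M by rewrite lt_def e frob2_ge0.
pose t := (sqrtC (frob2 M))^-1.
have t2 : `|t| ^+ 2 = (frob2 M)^-1.
  by rewrite -normrX exprVn sqrtCK ger0_norm // invr_ge0 ltW.
rewrite -ler_pdivrMr // mulrC -t2 mulr_sumr vpar_sqr.
have -> : \sum_i `|t| ^+ 2 * `|\tr (A i *m M)| ^+ 2 = \sum_i `|\tr (A i *m (t *: M))| ^+ 2.
  by apply: eq_bigr => i _; rewrite -scalemxAr linearZ /= normrM exprMn.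
rewrite -normc_sum lecR; apply: (ub_le_sup vset_has_ubound); exists (t *: M) => //=.
by rewrite trace_absmx_sqr frob2Z t2 mulVf.
Qed.

(** By definition v is the norm of M |-> (Tr A_i M)_i, and c |-> sum_i c_i A_i is its
    adjoint up to conjugation. *)
Lemma vpar_bound (c : 'I_n -> C) :
  frob2 (\sum_i c i *: A i) <= (vpar A ^+ 2)%:C%C * \sum_i `|c i| ^+ 2.
Proof.
set N := \sum_i _; have [e|e] := eqVneq (frob2 N) 0.
  rewrite e mulr_ge0 ?lecR ?sqr_ge0 //; apply: sumr_ge0 => i _; exact: exprn_ge0.
have N0 : 0 < frob2 N by rewrite lt_def e frob2_ge0.
rewrite -(ler_pM2r N0).
have fN : frob2 N = \sum_i c i * \tr (A i *m N^t*).
  rewrite -frob2E {1}/N mulmx_suml linear_sum; apply: eq_bigr => i _.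
  by rewrite -scalemxAl linearZ.
rewrite -expr2 -{1}(ger0_norm (ltW N0)) {1}fN; apply: le_trans (cauchy_schwarz _ _) _.
rewrite [leRHS]mulrAC mulrC ler_wpM2r //; first by apply: sumr_ge0 => i _; exact: exprn_ge0.
by rewrite -(frob2_tr N); exact: vpar_trace.
Qed.
End VarianceNorms.

(** * Hermitian dilation *)

Section Dilation.
Context {R : realType} {CA : cstarAlgType R} {d : nat}.
Notation C := R[i].

(** Hermitian dilations, of scalar matrices and of matrices over the algebra. Even
    powers of a dilation are block diagonal, with powers of Z Z^* and of Z^* Z as
    blocks. *)
Definition cdil (M : 'M[C]_d) : 'M[C]_(d + d) := block_mx 0 M (M^t*) 0.
Definition hdil (Z : 'M[CA]_d) : 'M[CA]_(d + d) := block_mx 0 Z (adjmx Z) 0.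

Lemma cdil_herm M : (cdil M)^t* = cdil M.
Proof. by rewrite /cdil tr_block_mx map_block_mx !trmx0 !map_mx0 trmxCK. Qed.

Lemma conj_real (r : R) : (r%:C%C)^* = r%:C%C :> C.
Proof. by apply/CrealP; rewrite complex_real. Qed.

Lemma cdilD M N : cdil (M + N) = cdil M + cdil N.
Proof. by rewrite /cdil add_block_mx !addr0 linearD map_mxD. Qed.

Lemma cdilZ (r : R) M : cdil (r%:C%C *: M) = r%:C%C *: cdil M.
Proof.
rewrite /cdil scale_block_mx !scaler0; congr (block_mx _ _ _ _).
by apply/matrixP=> i j; rewrite !mxE rmorphM /=; congr (_ * _); exact: conj_real.
Qed.

Lemma cdil_sum I (r : seq I) (M : I -> 'M[C]_d) :
  cdil (\sum_(i <- r) M i) = \sum_(i <- r) cdil (M i).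
Proof.
elim: r => [|i r IH]; last by rewrite !big_cons cdilD IH.
by rewrite !big_nil /cdil trmx0 map_mx0 block_mx0.
Qed.

Lemma hdilD Y Z : hdil (Y + Z) = hdil Y + hdil Z.
Proof.
rewrite /hdil add_block_mx !addr0; congr (block_mx _ _ _ _).
by apply/matrixP=> i j; rewrite !mxE cstarD.
Qed.

Lemma hdil_sum I (r : seq I) (Z : I -> 'M[CA]_d) :
  hdil (\sum_(i <- r) Z i) = \sum_(i <- r) hdil (Z i).
Proof.
elim: r => [|i r IH]; last by rewrite !big_cons hdilD IH.
rewrite !big_nil /hdil (_ : adjmx 0 = 0) ?block_mx0 //.
by apply/matrixP=> i j; rewrite !mxE cstar0.
Qed.

Lemma tensmx_cdil M (a : CA) : cstar a = a -> tensmx (cdil M) a = hdil (tensmx M a).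
Proof.
move=> sa; rewrite /tensmx /cdil /hdil map_block_mx.
have z : map_mx (fun z => z *: a) (0 : 'M[C]_d) = 0.
  by apply/matrixP=> i j; rewrite !mxE scale0r.
rewrite !z; congr (block_mx _ _ _ _).
by apply/matrixP=> i j; rewrite !mxE cstarZ sa.
Qed.

Lemma flow_cdil n (tau : {scalar CA}) (s : 'I_n -> CA) (hs : free_semicircular tau s)
    (A0 : 'M[C]_d) (A : 'I_n -> 'M[C]_d) th x :
  flow s (cdil A0) (fun i => cdil (A i)) th x = hdil (flow s A0 A th x).
Proof.
rewrite /flow /aff hdilD hdil_sum /emb -tensmx_cdil ?cstar1 // /interp /=.
congr (tensmx _ 1 + _).
  by rewrite cdilD cdil_sum; congr (_ + _); apply: eq_bigr => i _; rewrite cdilZ.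
by apply: eq_bigr => i _; rewrite -cdilZ tensmx_cdil // hs.1.
Qed.

Lemma hdil_sqr Z : hdil Z *m hdil Z = block_mx (Z *m adjmx Z) 0 0 (adjmx Z *m Z).
Proof. by rewrite /hdil mulmx_block !mul0mx !mulmx0 !addr0 !add0r. Qed.

Lemma hdil_even Z m : hdil Z ^+ m.*2 =
  block_mx ((Z *m adjmx Z) ^+ m) 0 0 ((adjmx Z *m Z) ^+ m).
Proof.
rewrite -mul2n exprM (expr2 (hdil Z)) [hdil Z * _]hdil_sqr.
elim: m => [|m IH]; first by rewrite !expr0 -[RHS]scalar_mx_block.
rewrite !exprS IH [LHS]mulmx_block.
by rewrite !mul0mx !mulmx0 !addr0 !add0r.
Qed.

Lemma mxtrace_cexp_block (tau : {scalar CA}) (a b c e : 'M[CA]_d) :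
  \tr (cexp tau (block_mx a b c e)) = \tr (cexp tau a) + \tr (cexp tau e).
Proof.
rewrite /mxtrace big_split_ord /=; apply: (congr2 (fun u v => u + v)).
  by apply: eq_bigr => i _; rewrite mxE block_mxEul [RHS]mxE.
by apply: eq_bigr => i _; rewrite mxE block_mxEdr [RHS]mxE.
Qed.

Section Moments.
Context {n : nat}.
Variables (tau : {scalar CA}) (htau : faithful_state tau).
Variables (s : 'I_n -> CA) (hs : free_semicircular tau s).
Variables (A0 : 'M[C]_d) (A : 'I_n -> 'M[C]_d).

(** This is not a general identity, as tau is not assumed tracial; it holds since tau is
    tracial on the algebra generated by the semicircular family. Let Q be the
    projection on the second block. Moving one factor X of Tr E(Q X^(2m+2)) from
    the end to the front gives Tr E(X Q X^(2m+1)), which sees the first block. *)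
Lemma mxtrace_cexp_swap th x m : let Z := flow s A0 A th x in
  \tr (cexp tau ((Z *m adjmx Z) ^+ m.+1)) = \tr (cexp tau ((adjmx Z *m Z) ^+ m.+1)).
Proof.
move=> Z; pose Q : 'M[C]_(d + d) := block_mx 0 0 0 1%:M.
have := flow_trace htau hs (cdil A0) (fun i => cdil (A i)) th x 0 m.*2.+1 1 Q 1%:M.
rewrite (flow_cdil hs) -/Z expr0 expr1 mul1mx /emb tensmx11 !mulmx1 -/(emb Q).
have QE : emb Q = block_mx 0 0 0 1%:M :> 'M[CA]_(d + d).
  rewrite /emb /tensmx /Q map_block_mx.
  have z : map_mx (fun z => z *: 1) (0 : 'M[C]_d) = 0 :> 'M[CA]_d.
    by apply/matrixP=> i j; rewrite !mxE scale0r.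
  by rewrite !z -/(tensmx 1%:M 1) tensmx11.
rewrite -mulmxA -[hdil Z ^+ _ *m hdil Z]exprSr -doubleS hdil_even QE.
rewrite (exprS (hdil Z)) hdil_even -[_ * block_mx _ _ _ _]/(_ *m block_mx _ _ _ _).
have -> : block_mx 0 0 0 1%:M *m block_mx ((Z *m adjmx Z) ^+ m.+1) 0 0
    ((adjmx Z *m Z) ^+ m.+1) = block_mx 0 0 0 ((adjmx Z *m Z) ^+ m.+1) :> 'M[CA]_(d + d).
  by rewrite mulmx_block !mul0mx !mulmx0 !addr0 add0r mul1mx.
have -> : hdil Z *m block_mx 0 0 0 1%:M *m (hdil Z *m block_mx ((Z *m adjmx Z) ^+ m) 0 0
    ((adjmx Z *m Z) ^+ m)) = block_mx ((Z *m adjmx Z) ^+ m.+1) 0 0 0.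
  rewrite /hdil !mulmx_block !(mul0mx, mulmx0, mulmx1, addr0, add0r).
  by rewrite exprS mulmxA.
rewrite !mxtrace_cexp_block.
have z : \tr (cexp tau (0 : 'M[CA]_d)) = 0.
  by rewrite /mxtrace big1 // => i _; rewrite !mxE linear0.
by rewrite z add0r addr0 => ->.
Qed.

Lemma moment_cdil th x m : let Z := flow s A0 A th x in
  moment tau s (cdil A0) (fun i => cdil (A i)) th x m.+1 =
  2 * complex.Re (\tr (cexp tau ((adjmx Z *m Z) ^+ m.+1))).
Proof.
move=> Z; rewrite /moment /re_trace mul1mx (flow_cdil hs) -/Z hdil_even mxtrace_cexp_block.
rewrite mxtrace_cexp_swap -/Z; case: (\tr _) => a b /=; ring.
Qed.

End Moments.
End Dilation.

Section DilationNorms.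
Context {R : realType} {d n : nat}.
Notation C := R[i].
Variable A : 'I_n -> 'M[C]_d.

Lemma frob2_block (a b c e : 'M[C]_d) :
  frob2 (block_mx a b c e) = frob2 a + frob2 b + (frob2 c + frob2 e).
Proof.
rewrite /frob2 big_split_ord /=; apply: (congr2 (fun u v => u + v)).
  rewrite -big_split; apply: eq_bigr => i _; rewrite big_split_ord /=.
  by apply: (congr2 (fun u v => u + v)); apply: eq_bigr => j _; rewrite (block_mxEul, block_mxEur).
rewrite -big_split; apply: eq_bigr => i _; rewrite big_split_ord /=.
by apply: (congr2 (fun u v => u + v)); apply: eq_bigr => j _; rewrite (block_mxEdl, block_mxEdr).
Qed.

Lemma frob2_row m (a b : 'M[C]_(m, d)) : frob2 (row_mx a b) = frob2 a + frob2 b.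
Proof.
rewrite /frob2 -big_split; apply: eq_bigr => i _; rewrite big_split_ord /=.
by apply: (congr2 (fun u v => u + v)); apply: eq_bigr => j _; rewrite (row_mxEl, row_mxEr).
Qed.

Lemma frob2_0 m k : frob2 (0 : 'M[C]_(m, k)) = 0.
Proof. by rewrite /frob2 big1 // => x _; rewrite big1 // => y _; rewrite mxE normr0 expr0n. Qed.

(** The two off-diagonal blocks contribute v^2 each. *)
Lemma cdil_cov (c : 'I_n -> C) :
  frob2 (\sum_i c i *: cdil (A i)) <= (2 * vpar A ^+ 2)%:C%C * \sum_i `|c i| ^+ 2.
Proof.
have -> : \sum_i c i *: cdil (A i) =
   block_mx 0 (\sum_i c i *: A i) (\sum_i c i *: (A i)^t*) 0.
  elim/big_ind3: _ => [|u v w u' v' w' -> ->|i _]; first by rewrite block_mx0.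
    by rewrite add_block_mx !addr0.
  by rewrite scale_block_mx !scaler0.
rewrite frob2_block !frob2_0 add0r addr0.
have -> : \sum_i c i *: (A i)^t* = (\sum_i (c i)^* *: A i)^t*.
  by rewrite linear_sum map_mx_sum; apply: eq_bigr => i _; rewrite linearZ /= map_mxZ; congr (_ *: _); exact/esym/conjCK.
rewrite frob2_tr rmorphM (rmorph_nat (real_complex R) 2) -mulrA mulr_natl mulr2n.
apply: lerD; first exact: vpar_bound.
apply: le_trans (vpar_bound A _) _; rewrite le_eqVlt; apply/orP; left; apply/eqP.
by congr (_ * _); apply: eq_bigr => i _; rewrite norm_conjC.
Qed.

(** The two off-diagonal blocks see the two halves of [W], hence the maximum in the
    definition of sigma rather than a sum. *)
Lemma cdil_var N (W : 'M[C]_(N, d + d)) :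
  \sum_i frob2 (W *m cdil (A i)) <= (sigma A ^+ 2)%:C%C * frob2 W.
Proof.
rewrite -[W]hsubmxK; move: (lsubmx W) (rsubmx W) => a b.
have e i : frob2 (row_mx a b *m cdil (A i)) = frob2 (b *m (A i)^t*) + frob2 (a *m A i).
  by rewrite mul_row_block !mulmx0 add0r addr0 frob2_row.
rewrite (eq_bigr _ (fun i _ => e i)) big_split frob2_row mulrDr [leRHS]addrC.
by apply: lerD; [exact: (sigma_bound A b).2|exact: (sigma_bound A a).1].
Qed.

End DilationNorms.

(** * Comparison of the two moments *)

Section Endpoints.
Context {R : realType} {CA : cstarAlgType R} {d n : nat}.
Notation C := R[i].
Variables (tau : {scalar CA}) (htau : faithful_state tau).
Variables (s : 'I_n -> CA) (hs : free_semicircular tau s).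
Variables (A0 : 'M[C]_d) (A : 'I_n -> 'M[C]_d).
Context {dT : measure_display} {T : measurableType dT}.
Variables (P : probability T R) (g : 'I_n -> {RV P >-> R}).
Hypothesis hg : iid_standard_gaussian g.
Notation mom := (moment tau s (cdil A0) (fun i => cdil (A i))).
Notation phi := (mean_moment tau s (cdil A0) (fun i => cdil (A i)) g).

Lemma Re_dinv (z : C) : complex.Re (d%:R^-1 * z) = complex.Re z / d%:R.
Proof. by rewrite -(rmorph_nat (real_complex R)) -fmorphV /= Re_real mulrC. Qed.

Let double_ratio (r : R) : 2 * r / (d + d)%:R = r / d%:R.
Proof. by rewrite addnn -mul2n natrM invfM mulrACA divff // mul1r. Qed.

Lemma moment_pihalf x p : mom (pi / 2) x p.+1 / (d + d)%:R =
  complex.Re (ntr (((A0 + \sum_i (x i)%:C%C *: A i)^t* *m (A0 + \sum_i (x i)%:C%C *: A i)) ^+ p.+1)).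
Proof.
rewrite (moment_cdil htau hs) /ntr Re_dinv.
have -> : flow s A0 A (pi / 2) x = emb (A0 + \sum_i (x i)%:C%C *: A i).
  rewrite /flow /aff /interp /= sin_pihalf cos_pihalf [X in _ + X]big1 ?addr0; last first.
    by move=> j _; apply/matrixP=> a b; rewrite !mxE mul0r scale0r.
  by congr (emb (_ + _)); apply: eq_bigr => i _; rewrite mul1r.
set Y := A0 + _; rewrite adjmx_emb -embM.
have -> : emb (Y^t* *m Y) ^+ p.+1 = emb ((Y^t* *m Y) ^+ p.+1) :> 'M[CA]_d.
  elim: p => [|p IH]; first by rewrite !expr1.
  by rewrite exprS IH [in RHS]exprS [RHS]embM.
have -> (M : 'M[C]_d) : cexp tau (emb M) = M.
  by rewrite -[emb M]mulmx1 cexp_embl (cexp1 htau) mulmx1.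
by rewrite double_ratio.
Qed.

Lemma free_endpoint p : phi p.+1 0 / (d + d)%:R =
  complex.Re (tr_tens tau (abs_exp2 (Xfree A0 A s) p.+1)).
Proof.
have e x : mom 0 x p.+1 = 2 * complex.Re (\tr (cexp tau (abs_exp2 (Xfree A0 A s) p.+1))).
  rewrite (moment_cdil htau hs) /abs_exp2.
  have -> : flow s A0 A 0 x = Xfree A0 A s => //.
  rewrite /flow /aff /interp /= sin0 cos0 /Xfree /emb.
  have -> : \sum_i (0 * x i)%:C%C *: A i = 0.
    by rewrite big1 // => j _; rewrite mul0r scale0r.
  by rewrite addr0; congr (_ + _); apply: eq_bigr => i _; rewrite scale1r.
rewrite /mean_moment (eq_gE g e) (gE_cst g _).2 /tr_tens Re_dinv.
have -> : \tr (cexp tau (abs_exp2 (Xfree A0 A s) p.+1)) =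
   \sum_k tau (abs_exp2 (Xfree A0 A s) p.+1 k k).
  by apply: eq_bigr => k _; rewrite mxE.
by rewrite double_ratio.
Qed.

(** The semicircular part vanishes at pi/2. The dimension doubles and so does the
    trace, so normalized moments agree. *)
Lemma gauss_endpoint p : ('E_P[fun w => complex.Re (ntr (absmx (Xgauss A0 A g w) ^+ (2 * p.+1)))])%E =
  (phi p.+1 (pi / 2) / (d + d)%:R)%:E.
Proof.
rewrite mulrC -(gEZ (d + d)%:R^-1 (gint_moment tau s (cdil A0) (fun i => cdil (A i)) hg p.+1 (pi / 2))).
have gi := gintZ (d + d)%:R^-1 (gint_moment tau s (cdil A0) (fun i => cdil (A i)) hg p.+1 (pi / 2)).
rewrite /gE /expect /Rintegral fineK; last exact: integrable_fin_num gi.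
rewrite unlock; apply: eq_integral => w _; congr EFin.
by rewrite mulrC moment_pihalf exprM absmx_sqr.
Qed.

End Endpoints.

Theorem theorem2p7 (R : realType) (d n : nat) (hd : (2 <= d)%N)
    (A0 : 'M[R[i]]_d) (A : 'I_n -> 'M[R[i]]_d)
    (dT : measure_display) (T : measurableType dT) (P : probability T R)
    (g : 'I_n -> {RV P >-> R}) (hg : iid_standard_gaussian g)
    (CA : cstarAlgType R) (tau : {scalar CA}) (htau : faithful_state tau)
    (s : 'I_n -> CA) (hs : free_semicircular tau s)
    (p : nat) (hp : (0 < p)%N) :
  (`| 'E_P[fun w => complex.Re (ntr (absmx (Xgauss A0 A g w) ^+ (2 * p)))]
        `^ ((2 * p)%N%:R)^-1
      - (complex.Re (tr_tens tau (abs_exp2 (Xfree A0 A s) p))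
          `^ ((2 * p)%N%:R)^-1)%:E |
   <= (2 * p%:R `^ (3 / 4) * vtilde A)%:E)%E.
Proof.
have d0 : (0 < d)%N by apply: ltnW.
case: p hp => [//|p] _.
rewrite (gauss_endpoint htau hs A0 A hg) -(free_endpoint htau hs A0 A g).
rewrite poweR_EFin -EFinB abse_EFin lee_fin.
have v0 : 0 <= vpar A by rewrite /vpar sqrtr_ge0.
have s0 : 0 <= sigma A by rewrite /sigma sqrtr_ge0.
apply: (interpolation htau hs (cdil_herm A0) (fun i => cdil_herm (A i))
  (kr := 2 * vpar A ^+ 2) (sr := sigma A ^+ 2)) => //.
- by rewrite mulr_ge0 // sqr_ge0.
- by rewrite sqr_ge0.
- exact: cdil_cov.
- by move=> N W; exact: cdil_var.
- by rewrite addn_gt0 d0.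
- by rewrite !mulr_ge0 ?powR_ge0 // /vtilde sqrtr_ge0.
have c4 : (2 * p.+1%:R `^ (3 / 4) * vtilde A) ^+ 4 =
    16 * p.+1%:R ^+ 3 * (vpar A * sigma A) ^+ 2.
  rewrite !exprMn -[(p.+1%:R `^ _) ^+ 4]powR_mulrn ?powR_ge0 // -powRrM.
  have -> : 3 / 4 * 4%:R = 3%:R :> R by field.
  rewrite powR_mulrn // (exprM (vtilde A) 2 2) /vtilde sqr_sqrtr ?mulr_ge0 //.
  by rewrite exprMn; ring.
rewrite c4 /=.
have -> : (p.+1 * (p.*2.+1 * p ^ 2))%:R * (2 * vpar A ^+ 2 * sigma A ^+ 2) * (4 / p.+1%:R) =
   8 * (p.*2.+1 * p ^ 2)%:R * (vpar A * sigma A) ^+ 2.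
  by rewrite natrM exprMn; field; rewrite addrC natr1 pnatr_eq0.
rewrite ler_wpM2r ?sqr_ge0 // -natrX -!natrM ler_nat; nia.
Qed.
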